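(* Fix $\kappa\in(0,1)$ and $\lambda_\delta>0$. Let $\gamma_\kappa=p/\lceil\kappa n_2\rceil$, let $m_n(-\lambda_\delta)$ be the unique positive solution of $$\gamma_\kappa\lambda_\delta\, m_n(-\lambda_\delta)^2+(1-\gamma_\kappa+\lambda_\delta)\,m_n(-\lambda_\delta)-1=0,$$ and let $$m_{n,1}(-\lambda_\delta)=\frac{m_n(-\lambda_\delta)-\lambda_\delta m_n(-\lambda_\delta)^2}{1+\gamma_\kappa\lambda_\delta m_n(-\lambda_\delta)^2}.$$ Assume the setting described in the context (standing regularity conditions and Gaussian design) with $\Sigma^{(1)}=\Sigma^{(2)}=I$, $\|\beta^{(2)}\|_2=O(1)$ and $\|\tilde\beta\|_2=O(1)$. Then, with high probability over the randomness of $(Z^{(1)},Z^{(2)})$, $$R(\hat\beta_{\mathrm{BC}};\beta^{(2)})=\frac{\lambda_\delta^2(1+\gamma_\kappa m_{n,1}(-\lambda_\delta))}{(\lambda_\delta+1-\gamma_\kappa+\gamma_\kappa\lambda_\delta m_n(-\lambda_\delta))^2}\,R(\hat\beta_{\mathcal I};\beta^{(2)})+\sigma^2\gamma_\kappa\,\frac{\lambda_\delta+1-\gamma_\kappa+\gamma_\kappa\lambda_\delta m_n(-\lambda_\delta)-\lambda_\delta(1+\gamma_\kappa m_{n,1}(-\lambda_\delta))}{(\lambda_\delta+1-\gamma_\kappa+\gamma_\kappa\lambda_\delta m_n(-\lambda_\delta))^2}+o(1),$$ where $R(\hat\beta_{\mathcal I};\beta^{(2)})$ is the risk of the first-stage pooled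 interpolator, i.e. of the pooled min-$\ell_2$-norm interpolator with source sample size $n_1$ and target sample size $\lfloor(1-\kappa)n_2\rfloor$.
   Context: Model. For $k=1$ (source) and $k=2$ (target), $y^{(k)}=X^{(k)}\beta^{(k)}+\epsilon^{(k)}$ with $X^{(k)}=Z^{(k)}(\Sigma^{(k)})^{1/2}\in\mathbb R^{n_k\times p}$, $\beta^{(k)}\in\mathbb R^p$ independent of designs and noises (possibly deterministic; statements are conditional on them). $n=n_1+n_2$, $\tilde\beta=\beta^{(1)}-\beta^{(2)}$. Sizes and signals may depend on $p$. Standing regularity conditions. $Z^{(1)},Z^{(2)},\epsilon^{(1)},\epsilon^{(2)}$ are mutually independent; for a fixed $\tau\in(0,1)$: all eigenvalues of $\Sigma^{(1)},\Sigma^{(2)}$ lie in $[\tau,\tau^{-1}]$; entries of $\epsilon^{(k)}$ are independent, mean zero, variance $\sigma^2<\infty$; $p/n_1,\ p/n_2,\ p/n\in[1+\tau,\tau^{-1}]$. Gaussian design: entries of $Z^{(1)},Z^{(2)}$ are independent $\mathcal N(0,1)$. Bias-corrected estimator. Let $\mathcal I\subset\{1,\dots,n_2\}$ be a random subset of size $\lfloor(1-\kappa)n_2\rfloor$ (independent of the data), $\mathcal I^c$ its complement; subscripts $\mathcal I,\mathcal I^c$ denote restriction to the corresponding rows. First stage: $\hat\beta_{\mathcal I}=\arg\min\{\|b\|_2:\ y^{(1)}=X^{(1)}b,\ y^{(2)}_{\mathcal I}=X^{(2)}_{\mathcal I}b\}$. Second stage: $\hat\delta_{\lambda_\delta}=\arg\min_{\delta\in\mathbb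 R^p}\{\|y^{(2)}_{\mathcal I^c}-X^{(2)}_{\mathcal I^c}(\hat\beta_{\mathcal I}+\delta)\|_2^2+\lceil\kappa n_2\rceil\lambda_\delta\|\delta\|_2^2\}$. Output: $\hat\beta_{\mathrm{BC}}=\hat\beta_{\mathcal I}+\hat\delta_{\lambda_\delta}$. Risk. For an estimator $b$, $R(b;\beta^{(2)})=\mathbb E[(b-\beta^{(2)})^\top\Sigma^{(2)}(b-\beta^{(2)})\mid X]$, $X=(X^{(1)\top},X^{(2)\top})^\top$, for the given split $\mathcal I$. Conventions. ''With high probability'' means with probability tending to $1$ as $p\to\infty$; $o(1)$ is as $p\to\infty$. *)

(* Defs.v *)
From HB Require Import structures.
From mathcomp Require Export all_boot all_order all_algebra.
From mathcomp Require Export all_classical all_reals all_analysis.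
From mathcomp Require Export measurable_realfun.
Export Order.TTheory GRing.Theory Num.Theory.
Export numFieldNormedType.Exports.

Set Implicit Arguments.
Unset Strict Implicit.
Unset Printing Implicit Defensive.

Local Open Scope classical_set_scope.
Local Open Scope ring_scope.

(* The norm `|v| on matrices is the sup norm, hence this definition. *)
Definition l2norm (R : rcfType) (n : nat) (v : 'cV[R]_n) : R :=
  Num.sqrt (\sum_i v i 0 ^+ 2).

(* Some minimizer of f on D; x0 is a junk value used when there is none. *)
Definition argmin_on (R : realType) (U : choiceType) (x0 : U) (D : set U)
    (f : U -> R) : U :=
  xget x0 [set u | D u /\ forall v, D v -> f u <= f v].

Definition restrict_rows (R : Type) (m n : nat) (A : {set 'I_m})
    (M : 'M[R]_(m, n)) : 'M[R]_(#|A|, n) :=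
  rowsub (fun i : 'I_#|A| => enum_val i) M.

Definition response (R : realType) (n p : nat) (X : 'M[R]_(n, p))
    (beta : 'cV[R]_p) (eps : 'cV[R]_n) : 'cV[R]_n :=
  X *m beta + eps.

Definition ceil_nb (R : realType) (kappa : R) (n : nat) : R :=
  (Num.ceil (kappa * n%:R))%:~R.

Section Estimators.
Context (R : realType).

(* Minimum l2-norm interpolator of two pooled samples.  The junk value 0 is
   taken when no b interpolates both samples, which has probability zero in
   the Gaussian overparametrized regime. *)
Definition pooled_interpolator (n1 n2 p : nat)
    (X1 : 'M[R]_(n1, p)) (y1 : 'cV[R]_n1)
    (X2 : 'M[R]_(n2, p)) (y2 : 'cV[R]_n2) : 'cV[R]_p :=
  argmin_on 0 [set b | y1 = X1 *m b /\ y2 = X2 *m b] (@l2norm R p).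

Definition first_stage (n1 n2 p : nat) (I : {set 'I_n2})
    (X1 : 'M[R]_(n1, p)) (y1 : 'cV[R]_n1)
    (X2 : 'M[R]_(n2, p)) (y2 : 'cV[R]_n2) : 'cV[R]_p :=
  pooled_interpolator X1 y1 (restrict_rows I X2) (restrict_rows I y2).

Definition second_stage (n2 p : nat) (kappa lambda : R) (I : {set 'I_n2})
    (X2 : 'M[R]_(n2, p)) (y2 : 'cV[R]_n2) (b : 'cV[R]_p) : 'cV[R]_p :=
  argmin_on 0 [set: 'cV[R]_p] (fun delta : 'cV[R]_p =>
    l2norm (restrict_rows (~: I) y2
            - restrict_rows (~: I) X2 *m (b + delta)) ^+ 2
    + ceil_nb kappa n2 * lambda * l2norm delta ^+ 2).

Definition bias_corrected (n1 n2 p : nat) (kappa lambda : R)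
    (I : {set 'I_n2}) (X1 : 'M[R]_(n1, p)) (y1 : 'cV[R]_n1)
    (X2 : 'M[R]_(n2, p)) (y2 : 'cV[R]_n2) : 'cV[R]_p :=
  first_stage I X1 y1 X2 y2
  + second_stage kappa lambda I X2 y2 (first_stage I X1 y1 X2 y2).

Definition quad_loss (p : nat) (Sigma : 'M[R]_p) (b beta : 'cV[R]_p) : R :=
  ((b - beta)^T *m Sigma *m (b - beta)) 0 0.

Definition gamma_kappa (kappa : R) (p n2 : nat) : R :=
  p%:R / ceil_nb kappa n2.

(* The quadratic has exactly one positive root when gamma, lambda > 0: the
   product of its roots is - (gamma * lambda)^-1 < 0. *)
Definition is_mn (gamma lambda m : R) : Prop :=
  0 < m /\ gamma * lambda * m ^+ 2 + (1 - gamma + lambda) * m - 1 = 0.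

Definition mn1 (gamma lambda m : R) : R :=
  (m - lambda * m ^+ 2) / (1 + gamma * lambda * m ^+ 2).

End Estimators.

Section Probability.
Context (d : measure_display) (T : measurableType d) (R : realType).
Context (P : probability T R).

Definition entry_events (m n : nat) (M : T -> 'M[R]_(m, n)) (i : 'I_m)
    (k : 'I_n) : set (set T) :=
  preimage_set_system setT (fun w => M w i k) measurable.

Definition mx_events (m n : nat) (M : T -> 'M[R]_(m, n)) : set (set T) :=
  \bigcup_(ik in [set: 'I_m * 'I_n]) entry_events M ik.1 ik.2.

Definition sigma_mx (m n : nat) (M : T -> 'M[R]_(m, n)) : set (set T) :=
  <<s mx_events M >>.

(* The finite type {set 'I_n} carries its discrete sigma-algebra. *)
Definition sigma_split (n : nat) (I : T -> {set 'I_n}) : set (set T) :=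
  preimage_set_system setT I [set: set {set 'I_n}].

Definition random_mx (m n : nat) (M : T -> 'M[R]_(m, n)) : Prop :=
  sigma_mx M `<=` measurable.

Definition random_split (n : nat) (I : T -> {set 'I_n}) : Prop :=
  sigma_split I `<=` measurable.

Definition mutually_independent (J : finType) (G : J -> set (set T)) : Prop :=
  forall (K : {set J}) (A : J -> set T), (forall i, G i (A i)) ->
    P (\bigcap_(i in [set` K]) A i) = (\prod_(i in K) P (A i))%E.

Definition independent_entries (m n : nat) (M : T -> 'M[R]_(m, n)) : Prop :=
  mutually_independent (fun ik : 'I_m * 'I_n => entry_events M ik.1 ik.2).

Definition mutually_independent_seq (s : seq (set (set T))) : Prop :=
  mutually_independent (fun i : 'I_(size s) => nth set0 s i).

Definition gaussian_design (m n : nat) (Z : T -> 'M[R]_(m, n)) : Prop :=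
  [/\ random_mx Z, independent_entries Z &
      forall i k (B : set R), measurable B ->
        P ((fun w => Z w i k) @^-1` B) = normal_prob 0 1 B].

Definition noise (n : nat) (sigma : R) (eps : T -> 'cV[R]_n) : Prop :=
  [/\ random_mx eps, independent_entries eps &
      forall i, 'E_P[fun w => eps w i 0%R]%E = 0%E /\
        'V_P[fun w => eps w i 0%R]%E = (sigma ^+ 2)%:E].

(* g is a version of the conditional expectation E[f | G]. *)
Definition is_cond_expectation (G : set (set T)) (f g : T -> \bar R) : Prop :=
  (forall B : set (\bar R), measurable B -> G (g @^-1` B)) /\
  (forall A, G A ->
     (\int[P]_(w in A) g w = \int[P]_(w in A) f w)%E).

(* r is a version of E[(b - beta)^T Sigma (b - beta) | X] with the split I
   held fixed, i.e. the conditioning sigma-algebra is generated by (X, I). *)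
Definition is_risk (n n2 p : nat) (X : T -> 'M[R]_(n, p))
    (I : T -> {set 'I_n2}) (Sigma : 'M[R]_p) (b : T -> 'cV[R]_p)
    (beta : 'cV[R]_p) (r : T -> \bar R) : Prop :=
  is_cond_expectation <<s sigma_mx X `|` sigma_split I >>
    (fun w => (quad_loss Sigma (b w) beta)%:E) r.

End Probability.

(* Main.v *)
From HB Require Import structures.
Require Import Defs.
From mathcomp Require Import ring lra.

Set Implicit Arguments.
Unset Strict Implicit.
Unset Printing Implicit Defensive.

Local Open Scope classical_set_scope.
Local Open Scope ring_scope.

(** Fix the split S.  Let W be the pooled rows (the source sample and the
    target rows in S), Y the N fresh target rows, mu = N lambda, and
    K = mu (Y^T Y + mu)^-1.  When W W^T is invertible both stages have closed
    forms: the first-stage error is v + L eps with v and L functions of W, and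
    the second stage turns an error e into K e + mu^-1 K Y^T eps_fresh
    [first_stage_error], [corrected_error].  Since eps is independent of the
    design and the split, the conditional risks are
    RI = |v|^2 + sigma^2 tr (L L^T) = tr A with A = v v^T + sigma^2 L L^T, and
    RBC = tr (A K^2) + sigma^2 (tr K - tr K^2) / mu [corrected_riskE]; the
    cross term vanishes because pooled and fresh noise coordinates are
    disjoint.  Any version of the conditional expectation agrees with these
    almost surely [risk_version]; only events on which W W^T is invertible are
    tested, so measurability of the arbitrary minimizers on the exceptional
    null set is irrelevant.

    It remains to compare RBC with an affine function of RI.
    - Isotropy.  The law of Y is invariant under reflections of its columns and
      K^2 is equivariant, so given W the quantity tr (A K^2) is within
      O(tr A / sqrt p) of tr A * tr K^2 / p in mean square [isotropy]: sign
      changes and the 45-degree reflection make off-diagonal entries small and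
      uncorrelated with everything else, swaps equalize the diagonal.
    - Traces.  Leaving out one row at a time and applying isotropy to that row
      shows that g = tr K / mu satisfies p - tr K = N g / (1 + g) up to
      O(sqrt p) in mean [mp_equation].  The limit equation is strongly monotone,
      so g is close to gamma * m.  Since tr K^2 is the difference quotient of
      g in mu up to an error linear in the increment [trace_ridge2_diffquot],
      tr K^2 / p is close to the slope a of the theorem [risk_slope_diffquot].
    - Tightness of RI.  With G_s = (W W^T + s)^-1, Stein's identity for a single
      row [row_stein] bounds E tr G_s and, with column reflections and row
      swaps, E (D W b)^T G_s (D W b) uniformly in s > 0
      [trace_gram_inv_moment], [selected_quad_moment]; D keeps the source rows.
      Letting s tend to 0 gives both that W W^T is almost surely invertible and
      that RI is bounded in probability [pooled_tight].

    These bounds depend on S only through its cardinality, which is fixed, and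
    the split is independent of the design, so they hold for the random split
    [model_deviation].  Convergence in probability is converted into a single
    sequence o(1) by choosing a slowly decreasing level [ky_fan]. *)

(** * Expectations and laws of random elements *)

Section Expectation.
Context (d : measure_display) (T : measurableType d) (R : realType).
Context (P : probability T R).
Implicit Types f g : T -> R.

Definition L1 f := P.-integrable setT (EFin \o f).

(** A real number, whereas the integral is extended-real; the value is
    meaningful only together with [L1], since [fine] sends infinities to 0. *)
Definition Ex f : R := fine (\int[P]_w (f w)%:E)%E.

Lemma Ex_EFin f : L1 f -> (Ex f)%:E = (\int[P]_w (f w)%:E)%E.
Proof. by move=> lf; rewrite /Ex fineK// integrable_fin_num. Qed.

Lemma L1_measurable f : L1 f -> measurable_fun setT f.
Proof. by move=> /integrableP[/measurable_EFinP]. Qed.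

Lemma L1_eq f g : f =1 g -> L1 f -> L1 g.
Proof. by move=> /funext ->. Qed.

Lemma Ex_eq f g : f =1 g -> Ex f = Ex g.
Proof. by move=> /funext ->. Qed.

Lemma L1_cst (c : R) : L1 (fun=> c).
Proof. exact: finite_measure_integrable_cst. Qed.

Lemma Ex_cst (c : R) : Ex (fun=> c) = c.
Proof.
have := @integral_cst _ _ _ P setT measurableT c%:E.
by rewrite /Ex => -> ; rewrite [X in (_ * X)%E]probability_setT mule1.
Qed.

Lemma L1_le f g : measurable_fun setT f -> (forall w, `|f w| <= g w) ->
  L1 g -> L1 f.
Proof.
move=> mf fg lg; apply: (le_integrable measurableT _ _ lg).
  exact/measurable_EFinP.
by move=> w _ /=; rewrite lee_fin (le_trans (fg w))// ler_norm.
Qed.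

Lemma L1D f g : L1 f -> L1 g -> L1 (fun w => f w + g w).
Proof. by move=> lf lg; apply: eq_integrable (integrableD measurableT lf lg). Qed.

Lemma L1Z c f : L1 f -> L1 (fun w => c * f w).
Proof. by move=> lf; apply: eq_integrable (integrableZl measurableT c lf). Qed.

Lemma L1N f : L1 f -> L1 (fun w => - f w).
Proof. by move=> lf; apply: eq_integrable (integrableN lf). Qed.

Lemma L1B f g : L1 f -> L1 g -> L1 (fun w => f w - g w).
Proof. by move=> lf lg; apply: L1D => //; exact: L1N. Qed.

Lemma L1_norm f : L1 f -> L1 (fun w => `|f w|).
Proof. by move=> lf; apply: eq_integrable (integrable_abse lf). Qed.

Lemma L1_sum (J : Type) (s : seq J) (Q : pred J) (f : J -> T -> R) :
  (forall i, Q i -> L1 (f i)) -> L1 (fun w => \sum_(i <- s | Q i) f i w).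
Proof.
move=> lf; elim: s => [|a s IH].
  by apply: (L1_eq _ (L1_cst 0)) => w; rewrite big_nil.
case Qa : (Q a).
  by apply: (L1_eq _ (L1D (lf _ Qa) IH)) => w; rewrite big_cons Qa.
by apply: (L1_eq _ IH) => w; rewrite big_cons Qa.
Qed.

Lemma ExD f g : L1 f -> L1 g -> Ex (fun w => f w + g w) = Ex f + Ex g.
Proof.
move=> lf lg; apply: EFin_inj; rewrite EFinD !Ex_EFin//; last exact: L1D.
by rewrite -integralD_EFin.
Qed.

Lemma ExZ c f : L1 f -> Ex (fun w => c * f w) = c * Ex f.
Proof.
move=> lf; apply: EFin_inj; rewrite EFinM !Ex_EFin//; last exact: L1Z.
by rewrite -integralZl.
Qed.

Lemma ExN f : L1 f -> Ex (fun w => - f w) = - Ex f.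
Proof.
move=> lf; rewrite -mulN1r -ExZ//; apply: Ex_eq => w; by rewrite mulN1r.
Qed.

Lemma ExB f g : L1 f -> L1 g -> Ex (fun w => f w - g w) = Ex f - Ex g.
Proof. by move=> lf lg; rewrite ExD ?ExN//; exact: L1N. Qed.

Lemma Ex_sum (J : Type) (s : seq J) (Q : pred J) (f : J -> T -> R) :
  (forall i, Q i -> L1 (f i)) ->
  Ex (fun w => \sum_(i <- s | Q i) f i w) = \sum_(i <- s | Q i) Ex (f i).
Proof.
move=> lf; elim: s => [|a s IH].
  by rewrite big_nil -[RHS](Ex_cst 0); apply: Ex_eq => w; rewrite big_nil.
rewrite big_cons; case Qa : (Q a); last first.
  by rewrite -IH; apply: Ex_eq => w; rewrite big_cons Qa.
rewrite -IH -ExD//; [|exact: lf|exact: L1_sum].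
by apply: Ex_eq => w; rewrite big_cons Qa.
Qed.

Lemma Ex_ge0 f : (forall w, 0 <= f w) -> 0 <= Ex f.
Proof.
by move=> f0; apply/fine_ge0/integral_ge0 => w _; rewrite lee_fin.
Qed.

Lemma Ex_le f g : L1 f -> L1 g -> (forall w, f w <= g w) -> Ex f <= Ex g.
Proof.
move=> lf lg fg; rewrite -subr_ge0 -ExB//; apply: Ex_ge0 => w.
by rewrite subr_ge0.
Qed.

Lemma L1_bounded (c : R) f :
  measurable_fun setT f -> (forall w, `|f w| <= c) -> L1 f.
Proof. by move=> mf fc; apply: L1_le mf fc (L1_cst c). Qed.

(** Jensen for the square: expand (|f| - c)^2 >= 0. *)
Lemma Ex_norm_le_sqr (c : R) f : 0 < c -> measurable_fun setT f ->
  L1 (fun w => f w ^+ 2) -> Ex (fun w => f w ^+ 2) <= c ^+ 2 ->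
  L1 f /\ Ex (fun w => `|f w|) <= c.
Proof.
move=> c0 mf lf2 hc.
have lf : L1 f.
  apply: L1_le mf _ (L1D (L1_cst 1) lf2) => w.
  rewrite -[f w ^+ 2]real_normK ?num_real//.
  by move: (`|f w|) => a; nra.
split=> //.
have := @Ex_le (fun w => 2 * c * `|f w|) (fun w => f w ^+ 2 + c ^+ 2)
  (L1Z _ (L1_norm lf)) (L1D lf2 (L1_cst _)).
have -> : Ex (fun w => 2 * c * `|f w|) = 2 * c * Ex (fun w => `|f w|).
  by rewrite ExZ//; exact: L1_norm.
rewrite ExD// ?Ex_cst; last exact: L1_cst.
move=> /(_ _) h.
have : 2 * c * Ex (fun w : T => `|f w|) <= Ex (fun w : T => f w ^+ 2) + c ^+ 2.
  apply: h => w; rewrite -[f w ^+ 2]real_normK ?num_real//.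
  by rewrite -subr_ge0 (_ : _ - _ = (`|f w| - c) ^+ 2) ?sqr_ge0//; ring.
move=> h2; have : 2 * c * Ex (fun w : T => `|f w|) <= 2 * c * c by nra.
by rewrite ler_pM2l// mulr_gt0.
Qed.

Lemma Ex_markov (c : R) f : measurable_fun setT f -> (forall w, 0 <= f w) ->
  L1 f -> 0 < c -> (P [set w | (c <= f w)%R] <= (Ex f / c)%:E)%E.
Proof.
move=> mf f0 lf c0.
have mA : measurable [set w | c <= f w].
  by rewrite -[X in measurable X]setTI; apply: measurable_fun_ler.
have h : (c%:E * P [set w | (c <= f w)%R] <= (Ex f)%:E)%E.
  rewrite Ex_EFin// -(setIT [set w | c <= f w]) -integral_indic//.
  rewrite -ge0_integralZl_EFin//; [|exact/measurable_EFinP/measurable_indic|exact: ltW].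
  apply: ge0_le_integral => //.
  - by move=> w _; rewrite mule_ge0// lee_fin ltW.
  - by apply: measurable_funeM; exact/measurable_EFinP/measurable_indic.
  - exact/measurable_EFinP.
  move=> w _; rewrite -EFinM lee_fin indicE.
  case: (boolP (w \in _)) => [|_]; last by rewrite mulr0.
  by rewrite inE mulr1.
have := h; rewrite -[P _]fineK ?fin_num_measure// -EFinM !lee_fin.
by rewrite ler_pdivlMr// mulrC.
Qed.

End Expectation.

Section EqualLaws.
Context (d : measure_display) (T : measurableType d) (R : realType).

Lemma eq_integral_law (P1 P2 : probability T R) (F : T -> \bar R) :
  (forall B, measurable B -> P1 B = P2 B) ->
  (\int[P1]_w F w = \int[P2]_w F w)%E.
Proof. by move=> h; apply: eq_measure_integral => B mB _; exact: h. Qed.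

Lemma Ex_eq_law (P1 P2 : probability T R) (F : T -> R) :
  (forall B, measurable B -> P1 B = P2 B) -> Ex P1 F = Ex P2 F.
Proof. by move=> h; rewrite /Ex (eq_integral_law _ h). Qed.

Lemma L1_eq_law (P1 P2 : probability T R) (F : T -> R) :
  (forall B, measurable B -> P1 B = P2 B) -> L1 P1 F -> L1 P2 F.
Proof.
move=> h /integrableP[mF lF]; apply/integrableP; split=> //.
by rewrite -(eq_integral_law _ h).
Qed.

End EqualLaws.

Section Law.
Context (d d' : measure_display) (T : measurableType d) (T' : measurableType d').
Context (R : realType) (P : probability T R).

Definition law (f : T -> T') (mf : measurable_fun setT f) : probability T' R :=
  distribution P (mfun_Sub (mem_set mf : f \in mfun)).

Context (f : T -> T') (mf : measurable_fun setT f).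

Lemma lawE A : law mf A = P (f @^-1` A).
Proof. by []. Qed.

Lemma integral_law (g : T' -> \bar R) : measurable_fun setT g ->
  (forall y, (0 <= g y)%E) -> (\int[law mf]_y g y = \int[P]_w g (f w))%E.
Proof. by move=> mg g0; rewrite ge0_integral_distribution. Qed.

Lemma L1_law (g : T' -> R) : measurable_fun setT g ->
  L1 (law mf) g <-> L1 P (g \o f).
Proof.
move=> mg.
have E : (\int[law mf]_y `|(EFin \o g) y| = \int[P]_w `|(EFin \o (g \o f)) w|)%E.
  by rewrite integral_law//; apply/measurableT_comp => //; exact/measurable_EFinP.
split=> /integrableP[_ h]; apply/integrableP; split.
- exact/measurable_EFinP/measurableT_comp.
- by rewrite -E.
- exact/measurable_EFinP.
- by rewrite E.
Qed.

Lemma Ex_law (g : T' -> R) : measurable_fun setT g -> L1 P (g \o f) ->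
  Ex (law mf) g = Ex P (g \o f).
Proof.
move=> mg lg; rewrite /Ex; congr fine.
have := @integral_pushforward _ _ _ _ _ _ mf P setT (EFin \o g) _ _ measurableT.
by apply => //; exact/measurable_EFinP.
Qed.

End Law.

Section Product.
Context (d1 d2 : measure_display) (T1 : measurableType d1) (T2 : measurableType d2).
Context (R : realType) (P1 : probability T1 R) (P2 : probability T2 R).

Let prodP : set (T1 * T2) -> \bar R := (P1 \x P2)%E.

HB.instance Definition _ := Measure.on prodP.

Let prodT : prodP setT = 1%E.
Proof.
have -> : prodP setT = (P1 setT * P2 setT)%E.
  by rewrite -setXTT; exact: product_measure1E.
by rewrite !probability_setT mule1.
Qed.

HB.instance Definition _ := Measure_isProbability.Build _ _ _ prodP prodT.

Definition prodprob : probability (T1 * T2)%type R := prodP.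

Lemma prodprobE A B : measurable A -> measurable B ->
  prodprob (A `*` B) = (P1 A * P2 B)%E.
Proof. exact: product_measure1E. Qed.

Lemma integral_prod (F : T1 * T2 -> \bar R) : measurable_fun setT F ->
  (forall x, (0 <= F x)%E) ->
  (\int[prodprob]_z F z = \int[P1]_x \int[P2]_y F (x, y))%E.
Proof. by move=> mF F0; exact: fubini_tonelli1. Qed.

Lemma Ex_prod (F : T1 * T2 -> R) : measurable_fun setT F -> L1 prodprob F ->
  L1 P1 (fun x => Ex P2 (fun y => F (x, y))) /\
  Ex prodprob F = Ex P1 (fun x => Ex P2 (fun y => F (x, y))).
Proof.
move=> mF lF.
have lI := @integrable_fubini_F _ _ _ _ _ P1 P2 (EFin \o F) lF.
have mI : measurable_fun setT (fubini_F P2 (EFin \o F)).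
  by apply: measurable_int; exact: lI.
have mE : measurable_fun setT (fun x => (Ex P2 (fun y => F (x, y)))%:E).
  apply/measurable_EFinP; apply: (@measurableT_comp _ _ _ _ _ _ fine) => //.
have ae : ae_eq P1 setT (fubini_F P2 (EFin \o F))
                        (fun x => (Ex P2 (fun y => F (x, y)))%:E).
  have := integrable_ae measurableT lI.
  apply: filterS => x h _; rewrite /Ex fineK//; exact: h.
split; last first.
  rewrite /Ex; congr fine.
  rewrite -(ae_eq_integral _ _ _ mI mE ae)//.
  rewrite -(@integral12_prod_meas1 _ _ _ _ _ P1 P2 (EFin \o F))//.
apply/integrableP; split=> //.
have /integrableP[_] := lI.
rewrite (ae_eq_integral (abse \o fubini_F P2 (EFin \o F)) 
  (abse \o (fun x => (Ex P2 (fun y => F (x, y)))%:E)))//.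
- exact: measurableT_comp.
- exact: measurableT_comp.
- by apply: filterS ae => x /[apply] /= ->.
Qed.

End Product.

(** * Random matrices and the standard Gaussian law *)

Section MatrixSigmaAlgebra.
Context (R : realType) (m n : nat).

Definition mx_rect (A : 'I_m -> 'I_n -> set R) : set 'M[R]_(m, n) :=
  [set M | forall i j, A i j (M i j)].

(** Stable under intersection and generating, so that a law on matrices is
    determined by its values on products of Borel sets. *)
Definition mx_rects : set (set 'M[R]_(m, n)) :=
  [set X | exists2 A, (forall i j, measurable (A i j)) & X = mx_rect A].

HB.instance Definition _ := @isMeasurable.Build (sigma_display mx_rects)
  'M[R]_(m, n) <<s mx_rects >> (@sigma_algebra0 _ setT mx_rects)
  (@sigma_algebraC _ mx_rects) (@sigma_algebra_bigcup _ setT mx_rects).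

Lemma measurable_rect A : (forall i j, measurable (A i j)) ->
  measurable (mx_rect A).
Proof. by move=> mA; apply: sub_sigma_algebra; exists A. Qed.
Arguments measurable_rect [A] _.

Lemma mx_rects_setI : setI_closed mx_rects.
Proof.
move=> _ _ [A mA ->] [B mB ->]; exists (fun i j => A i j `&` B i j).
  by move=> i j; exact: measurableI.
apply/seteqP; split=> M /=; first by move=> [hA hB] i j; split.
by move=> h; split=> i j; have [] := h i j.
Qed.

Lemma mx_rects_setT : mx_rects setT.
Proof.
by exists (fun _ _ => setT) => //; apply/seteqP; split.
Qed.

Lemma measurable_entry i j : measurable_fun setT (fun M : 'M[R]_(m, n) => M i j).
Proof.
move=> _ B mB; rewrite setTI.
rewrite (_ : _ @^-1` _ =
  mx_rect (fun k l => if (k == i) && (l == j) then B else setT)).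
  by apply: measurable_rect => k l; case: ifP.
apply/seteqP; split=> M /=.
  by move=> hM k l; case: ifP => // /andP[/eqP-> /eqP->].
by move=> /(_ i j); rewrite !eqxx.
Qed.

Lemma measurable_mxP d (T : measurableType d) (f : T -> 'M[R]_(m, n)) :
  measurable_fun setT f <->
  forall i j, measurable_fun setT (fun w => f w i j).
Proof.
split=> [mf i j|mf].
  exact: (measurableT_comp (measurable_entry i j) mf).
apply: (measurability mx_rects) => // _ [_ [A mA ->] <-].
rewrite setTI (_ : _ @^-1` _ = \bigcap_(ij in [set` [set: 'I_m * 'I_n]])
   ((fun w => f w ij.1 ij.2) @^-1` A ij.1 ij.2)); last first.
  apply/seteqP; split=> w /=; first by move=> h ij _; exact: h.
  by move=> h i j; apply: (h (i, j)); rewrite /= inE.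
apply: fin_bigcap_measurable; first exact: finite_finset.
move=> ij _; rewrite -[X in measurable X]setTI; exact: mf.
Qed.

Lemma mx_law_unique (m1 m2 : probability 'M[R]_(m, n) R) :
  (forall A, (forall i j, measurable (A i j)) -> m1 (mx_rect A) = m2 (mx_rect A)) ->
  forall B, measurable B -> m1 B = m2 B.
Proof.
move=> h; apply: (measure_unique mx_rects (fun=> setT)) => //.
- exact: mx_rects_setI.
- by move=> _; exact: mx_rects_setT.
- by rewrite bigcup_const//; exists 0%N.
- by move=> _ [A mA ->]; exact: h.
- by move=> _; apply: le_lt_trans (probability_le1 _ _) _ => //; rewrite ltry.
Qed.

End MatrixSigmaAlgebra.

Section MeasurableMatrixOps.
Context (R : realType) (d : measure_display) (T : measurableType d).

(** Entrywise measurability is the form that passes through sums, products,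
    determinants and inverses; [measurable_mxP] relates it to the product
    sigma-algebra. *)
Definition mxm (m n : nat) (f : T -> 'M[R]_(m, n)) :=
  forall i j, measurable_fun setT (fun w => f w i j).

Lemma meas_eq (f g : T -> R) : f =1 g -> measurable_fun setT f ->
  measurable_fun setT g.
Proof. by move=> /funext->. Qed.

Lemma meas_sum (I : Type) (s : seq I) (Q : pred I) (f : I -> T -> R) :
  (forall i, measurable_fun setT (f i)) ->
  measurable_fun setT (fun w => \sum_(i <- s | Q i) f i w).
Proof.
move=> mf; elim: s => [|a s IH].
  by apply: (meas_eq (f := cst 0)) => // w; rewrite big_nil.
case Qa : (Q a); [apply: (meas_eq (f := fun w => f a w +
   \sum_(i <- s | Q i) f i w))|apply: meas_eq IH].
- by move=> w; rewrite big_cons Qa.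
- exact: measurable_funD.
- by move=> w; rewrite big_cons Qa.
Qed.

Lemma meas_prod (I : Type) (s : seq I) (Q : pred I) (f : I -> T -> R) :
  (forall i, measurable_fun setT (f i)) ->
  measurable_fun setT (fun w => \prod_(i <- s | Q i) f i w).
Proof.
move=> mf; elim: s => [|a s IH].
  by apply: (meas_eq (f := cst 1)) => // w; rewrite big_nil.
case Qa : (Q a); [apply: (meas_eq (f := fun w => f a w *
   \prod_(i <- s | Q i) f i w))|apply: meas_eq IH].
- by move=> w; rewrite big_cons Qa.
- exact: measurable_funM.
- by move=> w; rewrite big_cons Qa.
Qed.

Lemma meas_inv (f : T -> R) : measurable_fun setT f ->
  measurable_fun setT (fun w => (f w)^-1).
Proof.
move=> mf.
have mi : measurable_fun setT (fun x : R => x^-1).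
  have m0 : measurable_fun [set x : R | x != 0] (fun x : R => x^-1).
    apply: open_continuous_measurable_fun => [|x].
      rewrite (_ : [set x : R | x != 0] = ~` [set 0]).
        exact/closed_openC/closed_eq.
      by apply/seteqP; split=> x /= /eqP.
    by rewrite inE /= => x0; exact: inv_continuous.
  have E : [set: R] = [set x : R | x != 0] `|` [set 0].
    apply/seteqP; split=> x //= _; have [->|x0] := eqVneq x 0; [by right|by left].
  rewrite E; apply/measurable_funU => //.
    rewrite (_ : [set x : R | x != 0] = ~` [set 0]); first exact/measurableC.
    by apply/seteqP; split=> x /= /eqP.
  split=> //; exact: measurable_fun_set1.
exact: (measurableT_comp mi mf).
Qed.

Lemma mxm_cst m n (A : 'M[R]_(m, n)) : mxm (fun=> A).
Proof. by move=> i j; exact: measurable_cst. Qed.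

Lemma mxm_add m n (f g : T -> 'M[R]_(m, n)) : mxm f -> mxm g ->
  mxm (fun w => f w + g w).
Proof.
move=> mf mg i j; apply: (meas_eq (f := fun w => f w i j + g w i j)).
  by move=> w; rewrite mxE.
exact: measurable_funD.
Qed.

Lemma mxm_opp m n (f : T -> 'M[R]_(m, n)) : mxm f -> mxm (fun w => - f w).
Proof.
move=> mf i j; apply: (meas_eq (f := fun w => - f w i j)).
  by move=> w; rewrite mxE.
exact: measurable_funN.
Qed.

Lemma mxm_sub m n (f g : T -> 'M[R]_(m, n)) : mxm f -> mxm g ->
  mxm (fun w => f w - g w).
Proof. by move=> mf mg; apply: mxm_add => //; exact: mxm_opp. Qed.

Lemma mxm_scale m n (c : T -> R) (f : T -> 'M[R]_(m, n)) :
  measurable_fun setT c -> mxm f -> mxm (fun w => c w *: f w).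
Proof.
move=> mc mf i j; apply: (meas_eq (f := fun w => c w * f w i j)).
  by move=> w; rewrite mxE.
exact: measurable_funM.
Qed.

Lemma mxm_mul m n k (f : T -> 'M[R]_(m, n)) (g : T -> 'M[R]_(n, k)) :
  mxm f -> mxm g -> mxm (fun w => f w *m g w).
Proof.
move=> mf mg i j; apply: (meas_eq (f := fun w => \sum_l f w i l * g w l j)).
  by move=> w; rewrite mxE.
by apply: meas_sum => l; exact: measurable_funM.
Qed.

Lemma mxm_tr m n (f : T -> 'M[R]_(m, n)) : mxm f -> mxm (fun w => (f w)^T).
Proof.
move=> mf i j; apply: (meas_eq (f := fun w => f w j i)) => //.
by move=> w; rewrite mxE.
Qed.

Lemma mxm_rowsub m n k (h : 'I_k -> 'I_m) (f : T -> 'M[R]_(m, n)) :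
  mxm f -> mxm (fun w => rowsub h (f w)).
Proof.
move=> mf i j; apply: (meas_eq (f := fun w => f w (h i) j)) => //.
by move=> w; rewrite mxE.
Qed.

Lemma mxm_col m1 m2 n (f : T -> 'M[R]_(m1, n)) (g : T -> 'M[R]_(m2, n)) :
  mxm f -> mxm g -> mxm (fun w => col_mx (f w) (g w)).
Proof.
move=> mf mg i j; case: (splitP i) => k hk.
  apply: (meas_eq (f := fun w => f w k j)) => // w.
  by rewrite (_ : i = lshift _ k) ?col_mxEu//; apply: val_inj.
apply: (meas_eq (f := fun w => g w k j)) => // w.
by rewrite (_ : i = rshift _ k) ?col_mxEd//; apply: val_inj.
Qed.

Lemma meas_trace n (f : T -> 'M[R]_n) : mxm f ->
  measurable_fun setT (fun w => \tr (f w)).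
Proof. by move=> mf; apply: meas_sum => i. Qed.

Lemma meas_det n (f : T -> 'M[R]_n) : mxm f ->
  measurable_fun setT (fun w => \det (f w)).
Proof.
move=> mf; apply: meas_sum => s; apply: measurable_funM => //.
exact: meas_prod.
Qed.

Lemma mxm_inv n (f : T -> 'M[R]_n) : mxm f -> mxm (fun w => invmx (f w)).
Proof.
move=> mf i j.
apply: (meas_eq (f := fun w => if \det (f w) == 0 then f w i j else
   (\det (f w))^-1 * ((-1) ^+ (j + i) * \det (row' j (col' i (f w)))))).
  move=> w; rewrite /invmx unitmxE unitfE; case: eqP => //= _.
  by rewrite !mxE.
have md := meas_det mf.
apply: measurable_fun_ifT => //.
- by apply: measurable_fun_eqr.
- apply: measurable_funM; first exact: meas_inv.
  apply: measurable_funM => //; apply: meas_det => k l.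
  by apply: (meas_eq (f := fun w => f w (lift j k) (lift i l))) => // w; rewrite !mxE.
Qed.

End MeasurableMatrixOps.

Lemma measurable_idR (R : realType) :
  measurable_fun setT (idfun : measurableTypeR R -> R).
Proof. by move=> _ A mA; rewrite setTI. Qed.

Definition stdnormal (R : realType) : probability R R :=
  law (normal_prob 0 1 : probability (measurableTypeR R) R) (@measurable_idR R).

Section GaussianLaw.
Context (R : realType) (n p : nat).
Local Notation Mx := 'M[R]_(n, p).
Local Notation N := (stdnormal R).

Definition gauss_law (G : probability Mx R) : Prop :=
  forall A, (forall i j, measurable (A i j)) ->
    G (mx_rect A) = (\prod_(ij : 'I_n * 'I_p) N (A ij.1 ij.2))%E.

Lemma gauss_law_unique (G1 G2 : probability Mx R) :
  gauss_law G1 -> gauss_law G2 -> forall B, measurable B -> G1 B = G2 B.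
Proof. by move=> h1 h2; apply: mx_law_unique => A mA; rewrite h1// h2. Qed.

Definition set_entry (i : 'I_n) (j : 'I_p) (t : R) (M : Mx) : Mx :=
  \matrix_(k, l) (if (k == i) && (l == j) then t else M k l).

Definition mix (S : 'I_n -> 'I_p -> bool) (M M' : Mx) : Mx :=
  \matrix_(k, l) (if S k l then M k l else M' k l).

Lemma measurable_set_entry i j :
  measurable_fun setT (fun z : Mx * R => set_entry i j z.2 z.1).
Proof.
apply/measurable_mxP => k l.
apply: (meas_eq (f := fun z : Mx * R => if (k == i) && (l == j) then z.2 else z.1 k l)).
  by move=> z; rewrite mxE.
case: ((k == i) && (l == j)); first exact: measurable_snd.
exact: (measurableT_comp (measurable_entry k l) measurable_fst).
Qed.

Lemma measurable_mix S :
  measurable_fun setT (fun z : Mx * Mx => mix S z.1 z.2).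
Proof.
apply/measurable_mxP => k l.
apply: (meas_eq (f := fun z : Mx * Mx => if S k l then z.1 k l else z.2 k l)).
  by move=> z; rewrite mxE.
case: (S k l).
  exact: (measurableT_comp (measurable_entry k l) measurable_fst).
exact: (measurableT_comp (measurable_entry k l) measurable_snd).
Qed.

(** Resampling one entry independently preserves the law.  Integrating over
    the resampled entry first plays the part of conditioning on the others. *)
Lemma gauss_set_entry (G : probability Mx R) i j : gauss_law G ->
  gauss_law (law (prodprob G N) (measurable_set_entry i j)).
Proof.
move=> hG A mA; rewrite lawE.
pose A' k l := if (k == i) && (l == j) then setT else A k l.
rewrite (_ : _ @^-1` _ = mx_rect A' `*` A i j).
  have mA' k l : measurable (A' k l) by rewrite /A'; case: ifP.
  rewrite prodprobE//; last by apply measurable_rect.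
  rewrite hG// (bigD1 (i, j))//= [in RHS](bigD1 (i, j))//=.
  rewrite {1}/A' !eqxx/= probability_setT mul1e muleC; congr (_ * _)%E.
  by apply: eq_bigr => -[k l] /negPf; rewrite /A' /= xpair_eqE => ->.
apply/seteqP; split=> -[M t] /= h.
  split=> [k l|]; last by have := h i j; rewrite mxE !eqxx.
  rewrite /A'; case: ifP => // kl; by have := h k l; rewrite mxE kl.
move=> k l; rewrite mxE; case: ifP => [/andP[/eqP-> /eqP->]|kl]; first by case: h.
by have := h.1 k l; rewrite /A' kl.
Qed.

(** The same for a whole block: independence of disjoint sets of entries, in
    the form used for Fubini arguments. *)
Lemma gauss_mix (G : probability Mx R) S : gauss_law G ->
  gauss_law (law (prodprob G G) (measurable_mix S)).
Proof.
move=> hG A mA; rewrite lawE.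
pose A1 k l := if S k l then A k l else setT.
pose A2 k l := if S k l then setT else A k l.
rewrite (_ : _ @^-1` _ = mx_rect A1 `*` mx_rect A2).
  have mA1 k l : measurable (A1 k l) by rewrite /A1; case: ifP.
  have mA2 k l : measurable (A2 k l) by rewrite /A2; case: ifP.
  rewrite prodprobE//; [|by apply measurable_rect|by apply measurable_rect].
  rewrite !hG// -big_split/=; apply: eq_bigr => -[k l] _ /=.
  rewrite /A1 /A2; case: ifP => _; rewrite probability_setT ?mule1 ?mul1e//.
apply/seteqP; split=> -[M M'] /= h.
  by split=> k l; have := h k l; rewrite mxE /A1 /A2; case: ifP.
move=> k l; have := h.1 k l; have := h.2 k l; rewrite mxE /A1 /A2; case: ifP => //.
Qed.

Lemma integral_set_entry (G : probability Mx R) i j (F : Mx -> \bar R) :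
  gauss_law G -> measurable_fun setT F -> (forall M, (0 <= F M)%E) ->
  (\int[G]_M F M = \int[G]_M \int[N]_t F (set_entry i j t M))%E.
Proof.
move=> hG mF F0.
rewrite -(eq_integral_law _ (gauss_law_unique (gauss_set_entry i j hG) hG)).
rewrite integral_law// integral_prod//.
exact: (measurableT_comp mF (measurable_set_entry i j)).
Qed.

Lemma integral_mix (G : probability Mx R) S (F : Mx -> \bar R) :
  gauss_law G -> measurable_fun setT F -> (forall M, (0 <= F M)%E) ->
  (\int[G]_M F M = \int[G]_M' \int[G]_M F (mix S M M'))%E.
Proof.
move=> hG mF F0.
rewrite -(eq_integral_law _ (gauss_law_unique (gauss_mix S hG) hG)).
rewrite integral_law// (_ : (fun z => F _) = F \o (fun z : Mx * Mx => mix S z.1 z.2))//.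
rewrite /prodprob fubini_tonelli2//.
exact: (measurableT_comp mF (measurable_mix S)).
Qed.

Lemma Ex_set_entry (G : probability Mx R) i j (F : Mx -> R) :
  gauss_law G -> L1 G F ->
  L1 G (fun M => Ex N (fun t => F (set_entry i j t M))) /\
  Ex G F = Ex G (fun M => Ex N (fun t => F (set_entry i j t M))).
Proof.
move=> hG lF; have mF := L1_measurable lF.
have E := gauss_law_unique (gauss_set_entry i j hG) hG.
have lF' : L1 (prodprob G N) (F \o (fun z => set_entry i j z.2 z.1)).
  apply/(L1_law _ (measurable_set_entry i j)) => //.
  by apply: L1_eq_law lF => B mB; rewrite -E.
rewrite -(Ex_eq_law _ E) Ex_law//.
apply: Ex_prod => //.
exact: (measurableT_comp mF (measurable_set_entry i j)).
Qed.

End GaussianLaw.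

(** * Affine changes of variables for densities *)

Section Density.
Local Open Scope ereal_scope.
Context (d : measure_display) (T : measurableType d) (R : realType).
Context (mu nu : {measure set T -> \bar R}) (g : T -> R).
Hypothesis mg : measurable_fun setT g.
Hypothesis g0 : forall x, (0 <= g x)%R.
Hypothesis nuE : forall A, measurable A -> nu A = \int[mu]_(x in A) (g x)%:E.

Import HBNNSimple.

(** Monotone approximation by simple functions, for which the identity is the
    definition of a density. *)
Lemma integral_density (f : T -> \bar R) : measurable_fun setT f ->
  (forall x, 0 <= f x) -> \int[nu]_x f x = \int[mu]_x (f x * (g x)%:E).
Proof.
move=> mf f0.
pose h := nnsfun_approx measurableT mf.
have -> : \int[nu]_x f x = limn (fun n => \int[nu]_x (EFin \o h n) x).
  have fE x : f x = limn (fun n => (EFin \o h n) x).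
    by apply/esym/cvg_lim => //; exact: cvg_nnsfun_approx.
  under eq_integral => x _ do rewrite fE.
  apply: monotone_convergence => //.
  - by move=> n; exact/measurable_EFinP.
  - by move=> n x _ //=; rewrite lee_fin.
  - by move=> x _ a b ab; rewrite lee_fin; exact/lefP/nd_nnsfun_approx.
have -> : \int[mu]_x (f x * (g x)%:E) =
    limn (fun n => \int[mu]_x ((EFin \o h n) x * (g x)%:E)).
  have fg x : f x * (g x)%:E = limn (fun n => (EFin \o h n) x * (g x)%:E).
    apply/esym/cvg_lim => //; apply: cvgeZr => //; exact: cvg_nnsfun_approx.
  under eq_integral => x _ do rewrite fg.
  apply: monotone_convergence => //.
  - move=> n; apply: emeasurable_funM; exact/measurable_EFinP.
  - by move=> n x _ /=; rewrite mule_ge0 ?lee_fin.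
  - move=> x _ a b ab/=; rewrite lee_wpmul2r ?lee_fin//.
    exact/lefP/nd_nnsfun_approx.
apply: congr_lim; apply/funext => n.
transitivity (\int[nu]_x
   (\sum_(y \in range (h n)) (y * \1_(h n @^-1` [set y]) x)%:E)).
  by apply: eq_integral => t tE; rewrite /= fimfunE -fsumEFin.
have indich r : measurable_fun setT (fun x => (r * \1_(h n @^-1` [set r]) x)%:E).
  by apply/measurable_EFinP; exact: measurable_funM.
rewrite ge0_integral_fsum//; last by move=> y z _; exact: nnfun_muleindic_ge0.
transitivity (\int[mu]_x (\sum_(y \in range (h n))
    (y * \1_(h n @^-1` [set y]) x)%:E * (g x)%:E)); last first.
  under [RHS]eq_integral => x xE.
    rewrite /= fimfunE -fsumEFin// ge0_mule_fsuml; last first.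
      by move=> y; exact: nnfun_muleindic_ge0.
    over.
  by [].
rewrite ge0_integral_fsum//; last 2 first.
  - by move=> y; apply: emeasurable_funM => //; exact/measurable_EFinP.
  - by move=> y z _; rewrite mule_ge0 ?lee_fin// -lee_fin nnfun_muleindic_ge0.
apply: eq_fsbigr => r rhn.
under eq_integral do rewrite EFinM.
rewrite integralZl_indic_nnsfun => //.
under [RHS]eq_integral do rewrite EFinM -muleA.
have r0 : (0 <= r)%R by move: rhn; rewrite inE => -[t _ <-].
rewrite [RHS]ge0_integralZl//.
- rewrite integral_indic// setIT nuE//; congr (_ * _).
  rewrite integral_mkcond; apply: eq_integral => x _.
  rewrite patchE indicE; case: (x \in _); rewrite ?mul1e ?mul0e//.
- by apply: emeasurable_funM; exact/measurable_EFinP.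
- by move=> t _; rewrite mule_ge0 ?lee_fin.
Qed.

End Density.

Section Lebesgue.
Context (R : realType).
Local Notation mu := (@lebesgue_measure R).
Local Open Scope ereal_scope.

Lemma measurable_affineR (a b : R) :
  measurable_fun setT (fun t : measurableTypeR R => (a * t + b)%R : measurableTypeR R).
Proof.
have h : measurable_fun setT (fun t : measurableTypeR R => (a * t + b)%R : R).
  by apply: measurable_funD => //; apply: measurable_funM => //; exact: measurable_idR.
by move=> _ A mA; apply: h.
Qed.

Lemma integral_affine_gt0 (a b : R) (f : R -> \bar R) : (0 < a)%R ->
  measurable_fun setT f -> (forall x, 0 <= f x) ->
  \int[mu]_x f x = a%:E * \int[mu]_t f (a * t + b)%R.
Proof.
move=> a0 mf f0.
have mf' : measurable_fun setT (f : measurableTypeR R -> _).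
  exact: (measurableT_comp mf (@measurable_idR R)).
have maff := measurable_affineR a b.
pose aff := fun t : measurableTypeR R => (a * t + b)%R : measurableTypeR R.
pose pf : {measure set (measurableTypeR R) -> \bar R} :=
  measure_function_pushforward__canonical__measure_function_Measure mu maff.
have E A : measurable A -> mu A = (mscale (NngNum (ltW a0)) pf) A.
  apply: lebesgue_measure_unique => _ [[x y] _ <-]/=.
  rewrite /mscale/= /pf/= /pushforward.
  rewrite (_ : _ @^-1` _ = `](x - b) / a, (y - b) / a]%classic)%R; last first.
    apply/seteqP; split=> t /=; rewrite !in_itv/=.
      by rewrite ltr_pdivrMr// ler_pdivlMr// ltrBlDr lerBrDr mulrC.
    by rewrite ltr_pdivrMr// ler_pdivlMr// ltrBlDr lerBrDr mulrC.
  rewrite !lebesgue_measure_itv/= !lte_fin ltr_pM2r ?invr_gt0// ltrD2r.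
  case: ifP => _; last by rewrite mule0.
  by rewrite -!EFinB -EFinM; congr (_%:E); field; rewrite gt_eqF.
rewrite (eq_measure_integral (mscale (NngNum (ltW a0)) pf)); last first.
  by move=> A mA _; exact: E.
rewrite ge0_integral_mscale//; congr (_ * _).
by rewrite ge0_integral_pushforward.
Qed.

Lemma integral_affine (a b : R) (f : R -> \bar R) : (a != 0)%R ->
  measurable_fun setT f -> (forall x, 0 <= f x) ->
  \int[mu]_x f x = `|a|%:E * \int[mu]_t f (a * t + b)%R.
Proof.
move=> a0 mf f0; have [ap|an|/eqP] := ltrgtP a 0%R; last by rewrite (negbTE a0).
  rewrite ltr0_norm//.
  have mf' : measurable_fun setT (fun x : R => f (- x)%R).
    by apply: measurableT_comp => //; exact: oppr_measurable.
  have mfR : measurable_fun setT (f : measurableTypeR R -> _).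
    exact: (measurableT_comp mf (@measurable_idR R)).
  have mopp : measurable_fun setT (-%R : measurableTypeR R -> measurableTypeR R).
    move=> _ A mA; have := measurable_affineR (-1) 0 measurableT mA.
    rewrite (_ : (fun t => _) = (-%R : measurableTypeR R -> measurableTypeR R))//.
    by apply/funext => t; rewrite mulN1r addr0.
  transitivity (\int[mu]_x f (- (x : R))%R).
    rewrite -(@ge0_integral_pushforward _ _ _ _ _ _ mopp mu setT)//.
    by apply: eq_measure_integral => A mA _; rewrite -[LHS]lebesgue_measureN.
  rewrite (@integral_affine_gt0 (- a) (- b)%R _ _ mf')// ?oppr_gt0//.
  congr (_ * _); apply: eq_integral => t _; congr f.
  by rewrite opprD opprK mulNr opprK.
by rewrite gtr0_norm//; exact: integral_affine_gt0.
Qed.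

(** Fubini and two affine substitutions, one variable at a time; the second
    divides by s, hence the separate treatment of s = 0. *)
Lemma integral_lebesgue_reflection (c s : R) (k : R * R -> \bar R) :
  (c ^+ 2 + s ^+ 2 = 1)%R -> measurable_fun setT k -> (forall z, 0 <= k z) ->
  \int[mu]_x \int[mu]_y k (c * x + s * y, s * x - c * y)%R =
  \int[mu]_x \int[mu]_y k (x, y).
Proof.
move=> cs mk k0.
pose mT := measurableTypeR R.
have mfst : measurable_fun setT (fun z : mT * mT => z.1 : R).
  exact: (measurableT_comp (@measurable_idR R) measurable_fst).
have msnd : measurable_fun setT (fun z : mT * mT => z.2 : R).
  exact: (measurableT_comp (@measurable_idR R) measurable_snd).
have mpair (a1 a2 b1 b2 : R) : measurable_fun setT (fun z : mT * mT =>
    k (a1 * z.1 + a2 * z.2, b1 * z.1 + b2 * z.2)%R).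
  apply: (measurableT_comp mk); apply: measurable_fun_pair;
  by apply: measurable_funD; apply: measurable_funM.
have mkx (x : R) : measurable_fun setT (fun y : R => k (x, y)).
  exact: (measurableT_comp mk (@pair1_measurable _ _ _ _ x)).
have [s0|s0] := eqVneq s 0%R.
  have c2 : (c ^+ 2 = 1)%R by rewrite -cs s0; ring.
  have c0 : (c != 0)%R by apply/eqP => c0; move: c2; rewrite c0 expr0n/= => /eqP; rewrite eq_sym oner_eq0.
  have c1 : (`|c| = 1)%R.
    by apply/eqP; rewrite -sqrp_eq1// real_normK ?num_real// c2.
  transitivity (\int[mu]_x \int[mu]_y k (c * x + 0, y)%R).
    apply: eq_integral => x _.
    rewrite [RHS](@integral_affine (- c) 0)%R ?oppr_eq0// normrN c1 mul1e.
    by apply: eq_integral => y _; congr (k (_, _)); rewrite s0; ring.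
  have := @integral_affine c 0 (fun x => \int[mu]_y k (x, y)) c0.
  rewrite c1 mul1e => -> //; last by move=> x; exact: integral_ge0.
  have msnd' : measurable_fun setT (fun z : R * mT => z.2 : R).
    exact: (measurableT_comp (@measurable_idR R) measurable_snd).
  have mk' : measurable_fun setT (fun z : R * mT => k (z.1, z.2)).
    apply: (measurableT_comp mk); apply: measurable_fun_pair => //.
  exact: (@measurable_fun_fubini_tonelli_F _ _ R mT R mu (fun z : R * mT => k (z.1, z.2))).
have s0' : (s^-1 != 0)%R by rewrite invr_eq0.
transitivity (\int[mu]_x (`|s^-1|%:E * \int[mu]_u k (u, s^-1 * x + (- c / s) * u)%R)).
  apply: eq_integral => x _.
  rewrite (@integral_affine s (c * x) (fun u => k (u, s^-1 * x + - c / s * u)%R))//; last first.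
    apply: (measurableT_comp mk); apply: measurable_fun_pair => //.
    by apply: measurable_funD => //; apply: measurable_funM.
  rewrite muleA -EFinM -normrM mulVf// normr1 mul1e.
  apply: eq_integral => y _; congr (k (_, _)); first by rewrite addrC.
  have -> : (s^-1 * x + - c / s * (s * y + c * x) = s^-1 * (1 - c ^+ 2) * x - c * y)%R by field.
  by rewrite -cs (_ : (c ^+ 2 + s ^+ 2 - c ^+ 2 = s ^+ 2)%R); [congr (_ - _)%R; field|ring].
have mu1 (x : R) : measurable_fun setT
    (fun u : mT => k (u : R, s^-1 * x + - c / s * u)%R).
  apply: (eq_measurable_fun _ _
    (measurableT_comp (mpair 0 1 s^-1 (- c / s))%R (@pair1_measurable _ _ mT mT x))) => z _.
  by congr (k (_, _)); rewrite /=; ring.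
transitivity (\int[mu]_x \int[mu]_u
    (`|s^-1|%:E * k (u, s^-1 * x + - c / s * u)%R)).
  by apply: eq_integral => x _; rewrite ge0_integralZl_EFin.
pose F (z : mT * mT) := `|s^-1|%:E * k (z.2, s^-1 * z.1 + - c / s * z.2)%R.
have mF : measurable_fun setT F.
  apply: measurable_funeM.
  apply: (eq_measurable_fun _ _ (mpair 0 1 s^-1 (- c / s))%R) => z _.
  by congr (k (_, _)); ring.
have F0 z : 0 <= F z by rewrite mule_ge0// lee_fin.
have := @fubini_tonelli _ _ mT mT R mu mu F mF F0; rewrite /F/= => ->.
apply: eq_integral => u _.
rewrite ge0_integralZl_EFin//; last first.
  apply: (eq_measurable_fun _ _ (measurableT_comp (mpair 0 1 s^-1 (- c / s))%R (@pair2_measurable _ _ mT mT u))) => z _.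
  by congr (k (_, _)); rewrite /=; ring.
rewrite [RHS](@integral_affine s^-1 (- c / s * u)%R)//.
Qed.

End Lebesgue.

(** * The one-dimensional normal law *)

Section DensityIntegrable.
Local Open Scope ereal_scope.
Context (d : measure_display) (T : measurableType d) (R : realType).
Context (mu nu : {measure set T -> \bar R}) (g : T -> R).
Hypothesis mg : measurable_fun setT g.
Hypothesis g0 : forall x, (0 <= g x)%R.
Hypothesis nuE : forall A, measurable A -> nu A = \int[mu]_(x in A) (g x)%:E.

Lemma integrable_density (f : T -> R) : measurable_fun setT f ->
  nu.-integrable setT (EFin \o f) <->
  mu.-integrable setT (EFin \o (fun x => f x * g x)%R).
Proof.
move=> mf.
have E : \int[nu]_x `|(EFin \o f) x| =
         \int[mu]_x `|(EFin \o (fun x => f x * g x)%R) x|.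
  rewrite (integral_density mg g0 nuE)//; last first.
    by apply: measurableT_comp => //; exact/measurable_EFinP.
  by apply: eq_integral => x _ /=; rewrite normrM EFinM (ger0_norm (g0 x)).
split=> /integrableP[_ h]; apply/integrableP; split.
- by apply/measurable_EFinP; exact: measurable_funM.
- by rewrite -E.
- exact/measurable_EFinP.
- by rewrite E.
Qed.

Lemma integral_density_L1 (f : T -> R) :
  nu.-integrable setT (EFin \o f) ->
  \int[nu]_x (f x)%:E = \int[mu]_x (f x * g x)%:E.
Proof.
move=> lf.
have mf : measurable_fun setT f by case/integrableP: lf => /measurable_EFinP.
have lfg := (integrable_density mf).1 lf.
rewrite [LHS]integralE [RHS]integralE; congr (_ - _).
  rewrite (integral_density mg g0 nuE)//; last first.
    by apply: measurable_funepos; exact/measurable_EFinP.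
  apply: eq_integral => x _; rewrite !funeposE -!EFin_max -EFinM.
  by congr EFin; rewrite maxr_pMl// mul0r.
rewrite (integral_density mg g0 nuE)//; last first.
  by apply: measurable_funeneg; exact/measurable_EFinP.
apply: eq_integral => x _; rewrite !funenegE -!EFinN -!EFin_max -EFinM.
by congr EFin; rewrite maxr_pMl// mul0r mulNr.
Qed.

End DensityIntegrable.

Section StdNormal.
Context (R : realType).
Local Notation mu := (@lebesgue_measure R).
Local Notation N := (stdnormal R).

Definition phi (x : R) : R := normal_peak 1 * expR (- (x ^+ 2 / 2)).

Lemma phiE : normal_pdf 0 1 = phi.
Proof.
apply/funext => x; rewrite normal_pdfE ?oner_eq0// /phi /normal_fun.
by rewrite subr0 expr1n mulNr.
Qed.

Lemma phi_ge0 x : 0 <= phi x.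
Proof. by rewrite mulr_ge0 ?expR_ge0 ?normal_peak_ge0. Qed.

Lemma measurable_phi : measurable_fun setT (phi : measurableTypeR R -> R).
Proof.
rewrite -phiE; exact: (measurableT_comp (measurable_normal_pdf 0 1) (@measurable_idR R)).
Qed.

Lemma normal_probE (A : set (measurableTypeR R)) : measurable A ->
  (normal_prob 0 1 A = \int[mu]_(x in A) (phi x)%:E)%E.
Proof. by rewrite -phiE. Qed.

Lemma integral_stdnormal (f : R -> \bar R) : measurable_fun setT f ->
  (forall x, (0 <= f x)%E) ->
  (\int[N]_x f x = \int[mu]_x (f x * (phi x)%:E))%E.
Proof.
move=> mf f0; rewrite /stdnormal integral_law//.
apply: (integral_density measurable_phi phi_ge0 normal_probE) => //.
Qed.

Lemma L1_stdnormal (f : R -> R) : measurable_fun setT f ->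
  L1 N f <-> mu.-integrable setT (EFin \o (fun x => f x * phi x)).
Proof.
move=> mf; rewrite /stdnormal L1_law//.
apply: (integrable_density measurable_phi phi_ge0 normal_probE).
exact: (measurableT_comp mf (@measurable_idR R)).
Qed.

Lemma Ex_stdnormal (f : R -> R) : L1 N f ->
  ((Ex N f)%:E = \int[mu]_x (f x * phi x)%:E)%E.
Proof.
move=> lf; have mf := L1_measurable lf.
have lf' := (L1_law (normal_prob 0 1 : probability (measurableTypeR R) R)
  (@measurable_idR R) mf).1 lf.
rewrite /stdnormal Ex_law// Ex_EFin//.
exact: (integral_density_L1 measurable_phi phi_ge0 normal_probE).
Qed.

Lemma phiM x y : phi x * phi y =
  normal_peak 1 ^+ 2 * expR (- ((x ^+ 2 + y ^+ 2) / 2)).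
Proof.
by rewrite /phi [LHS]mulrACA -expRD expr2; congr (_ * expR _); field.
Qed.

(** The standard normal law in the plane is invariant under reflections: its
    density depends on the norm only, and a reflection preserves the Lebesgue
    measure. *)
Lemma integral_stdnormal_reflection (c s : R) (h : R * R -> \bar R) :
  c ^+ 2 + s ^+ 2 = 1 -> measurable_fun setT h -> (forall z, (0 <= h z)%E) ->
  (\int[N]_x \int[N]_y h (c * x + s * y, s * x - c * y)%R =
   \int[N]_x \int[N]_y h (x, y))%E.
Proof.
move=> cs mh h0.
pose k z := (h z * (phi z.1 * phi z.2)%R%:E)%E.
have mphi : measurable_fun setT (phi : R -> R).
  by rewrite -phiE; exact: measurable_normal_pdf.
have mk : measurable_fun setT k.
  apply: emeasurable_funM => //; apply/measurable_EFinP.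
  by apply: measurable_funM;
    [exact: (measurableT_comp mphi measurable_fst)
    |exact: (measurableT_comp mphi measurable_snd)].
have k0 z : (0 <= k z)%E by rewrite mule_ge0// lee_fin mulr_ge0 ?phi_ge0.
have E (g : R * R -> R * R) : measurable_fun setT g ->
    (forall x y, phi (g (x, y)).1 * phi (g (x, y)).2 = phi x * phi y) ->
  (\int[N]_x \int[N]_y h (g (x, y)) = \int[mu]_x \int[mu]_y k (g (x, y)))%E.
  move=> mg hg.
  have mhg : measurable_fun setT (h \o g) by exact: (measurableT_comp mh mg).
  have mhx x : measurable_fun setT (fun y : R => h (g (x, y))).
    exact: (measurableT_comp mhg (@pair1_measurable _ _ _ _ x)).
  rewrite integral_stdnormal; last 2 first.
    exact: (@measurable_fun_fubini_tonelli_F _ _ R R R N (h \o g) mhg (fun z => h0 _)).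
    by move=> x; exact: integral_ge0.
  apply: eq_integral => x _; rewrite integral_stdnormal//.
  rewrite -ge0_integralZr//; last 3 first.
  - apply: emeasurable_funM; last by apply/measurable_EFinP; exact: measurable_phi.
    exact: (measurableT_comp (mhx x) (@measurable_idR R)).
  - by move=> y _; rewrite mule_ge0// lee_fin phi_ge0.
  - by rewrite lee_fin phi_ge0.
  by apply: eq_integral => y _; rewrite /k hg -muleA -EFinM [phi y * _]mulrC.
pose g z : R * R := (c * z.1 + s * z.2, s * z.1 - c * z.2)%R.
have mg : measurable_fun setT g.
  apply: measurable_fun_pair.
  - by apply: measurable_funD; apply: measurable_funM.
  - by apply: measurable_funB; apply: measurable_funM.
transitivity (\int[mu]_x \int[mu]_y k (g (x, y)))%E.
  apply: (E g mg) => x y.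
  have e : (c * x + s * y) ^+ 2 + (s * x - c * y) ^+ 2 = x ^+ 2 + y ^+ 2.
    rewrite -[RHS]mul1r -cs; ring.
  by rewrite [LHS]phiM [in LHS]/g/= e phiM.
rewrite (integral_lebesgue_reflection cs mk k0).
by have /= <- := E idfun (@measurable_id _ _ _).
Qed.

Lemma L1_stdnormal_expR : L1 N (fun t => expR (t ^+ 2 / 4)).
Proof.
have me : measurable_fun setT (fun t : R => expR (t ^+ 2 / 4)).
  apply: measurableT_comp => //; apply: measurable_funM => //; exact: measurable_funX.
apply/L1_stdnormal => //.
have h := @integrable_normal_pdf R 0 (Num.sqrt 2).
have s0 : Num.sqrt (2 : R) != 0 by rewrite gt_eqF// sqrtr_gt0.
rewrite (_ : EFin \o _ = (fun x => (normal_peak 1 / normal_peak (Num.sqrt 2))%:E *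
  (normal_pdf 0 (Num.sqrt 2) x)%:E)%E); first exact: (integrableZl measurableT _ h).
apply/funext => x /=.
rewrite -EFinM; congr EFin; rewrite normal_pdfE// /phi /normal_fun.
rewrite subr0 sqr_sqrtr//.
have p0 : normal_peak (Num.sqrt (2 : R)) != 0 by rewrite gt_eqF// normal_peak_gt0.
rewrite [RHS]mulrA divfK// [LHS]mulrCA -expRD; congr (_ * expR _).
by rewrite -[2 *+ 2]mulr_natr; field.
Qed.

Lemma poly_le_expR (t : R) : (1 + t ^+ 2) ^+ 4 <= 16 ^+ 4 * expR (t ^+ 2 / 4).
Proof.
have -> : t ^+ 2 / 4 = 4%:R * (t ^+ 2 / 16) by field.
rewrite expRM_natl -exprMn; apply: lerXn2r; rewrite ?nnegrE.
- by rewrite addr_ge0// sqr_ge0.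
- by rewrite mulr_ge0// expR_ge0.
have := expR_ge1Dx (t ^+ 2 / 16); have := sqr_ge0 t; lra.
Qed.

(** Polynomial growth of degree eight is harmless for all integrands below. *)
Lemma L1_stdnormal_poly (C : R) (f : R -> R) : measurable_fun setT f ->
  (forall t, `|f t| <= C * (1 + t ^+ 2) ^+ 4) -> L1 N f.
Proof.
move=> mf hf.
apply: (@L1_le _ _ _ N f (fun t => (`|C| * 16 ^+ 4) * expR (t ^+ 2 / 4)) mf); last first.
  exact: (L1Z _ L1_stdnormal_expR).
move=> t; apply: le_trans (hf t) _; rewrite -mulrA.
apply: le_trans (_ : `|C| * (1 + t ^+ 2) ^+ 4 <= _).
  by rewrite ler_wpM2r ?ler_norm// exprn_ge0// addr_ge0// sqr_ge0.
by rewrite ler_wpM2l// poly_le_expR.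
Qed.

End StdNormal.

(** * Stein's identity *)

Section Stein.
Context (R : realType).
Local Notation mu := (@lebesgue_measure R).
Local Notation N := (stdnormal R).

Lemma is_derive_phi (x : R) : is_derive x 1 (@phi R) (- x * phi x).
Proof.
have h1 : is_derive x 1 (fun y : R => - (y ^+ 2 / 2)) (- x).
  rewrite (_ : (fun y : R => - (y ^+ 2 / 2)) = - ((2^-1 : R) \*: (id ^+ 2))); last first.
    by apply/funext => y; rewrite !fctE /GRing.scale /= mulrC.
  by apply: is_derive_eq; rewrite /GRing.scale /=; field.
have h2 := @is_derive1_comp _ expR (fun y : R => - (y ^+ 2 / 2)) x _ _
  (is_derive_expR _) h1.
have h3 := @is_deriveZ _ _ _ _ (normal_peak 1) _ _ _ h2.
by apply: (is_derive_eq h3); rewrite /phi /GRing.scale /=; ring.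
Qed.

(** Polynomial growth is absorbed by half of the Gaussian exponent, since
    1 + x^2 <= 16 exp (x^2 / 16). *)
Lemma phi_decay (x : R) : (1 + x ^+ 2) ^+ 4 * phi x <= 16 ^+ 4 * normal_peak 1.
Proof.
rewrite /phi mulrCA mulrC; apply: ler_wpM2r; first exact: normal_peak_ge0.
apply: le_trans (_ : 16 ^+ 4 * expR (x ^+ 2 / 4) * expR (- (x ^+ 2 / 2)) <= _).
  by rewrite ler_wpM2r ?expR_ge0// poly_le_expR.
rewrite -mulrA -expRD ler_piMr// -[leRHS]expR0 ler_expR.
have := sqr_ge0 x; lra.
Qed.

(** Integration by parts against the density: (f phi)' = (f' - x f) phi, and
    f phi vanishes at infinity. *)
Lemma stein (C : R) (f f' : R -> R) :
  (forall x : R, is_derive x 1 f (f' x)) -> continuous f' ->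
  (forall t, `|f t| <= C * (1 + t ^+ 2) ^+ 3) ->
  (forall t, `|f' t| <= C * (1 + t ^+ 2) ^+ 3) ->
  [/\ L1 N (fun t => t * f t), L1 N f' &
      Ex N (fun t => t * f t) = Ex N f'].
Proof.
move=> df cf' bf bf'.
have cf : continuous f.
  move=> x; apply: differentiable_continuous; apply/derivable1_diffP.
  by have [] := df x.
have C0 : 0 <= C.
  have := le_trans (normr_ge0 _) (bf 0).
  by rewrite expr0n/= addr0 expr1n mulr1.
have mf := continuous_measurable_fun cf.
have mf' := continuous_measurable_fun cf'.
have q1 (t : R) : 1 <= 1 + t ^+ 2 by rewrite lerDl sqr_ge0.
have q0 (t : R) : 0 <= 1 + t ^+ 2 by exact: le_trans (q1 t).
have lf' : L1 N f'.
  apply: (L1_stdnormal_poly (C := C)) => // t; apply: le_trans (bf' t) _.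
  by rewrite ler_wpM2l// ler_weXn2l.
have ltf : L1 N (fun t => t * f t).
  apply: (L1_stdnormal_poly (C := C)).
    by apply: measurable_funM.
  move=> t; rewrite normrM exprS mulrCA.
  apply: ler_pM => //; rewrite -subr_ge0; have := sqr_ge0 (`|t| - 1).
  rewrite sqrrB real_normK ?num_real//; have := sqr_ge0 t; have := normr_ge0 t.
  by rewrite mulr1 expr1n -mulr_natr; lra.
split=> //.
pose g t := f' t - t * f t.
have lg : L1 N g by exact: L1B.
suff h : Ex N g = 0.
  by move: h; rewrite /g ExB// => /eqP; rewrite subr_eq0 eq_sym => /eqP.
have mg := L1_measurable lg.
pose k x := g x * phi x.
have lk : mu.-integrable setT (EFin \o k) by apply/L1_stdnormal.
pose F x := f x * phi x.
have dF (x : R) : is_derive x 1 F (k x).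
  apply: is_derive_eq (is_deriveM (df x) (is_derive_phi x)) _.
  by rewrite /k /g /GRing.scale /=; ring.
have ck : continuous k.
  move=> x; apply: cvgM; last first.
    apply: differentiable_continuous; apply/derivable1_diffP.
    by have [] := is_derive_phi x.
  apply: cvgB; first exact: cf'.
  apply: cvgM; [exact: cvg_id|exact: cf].
have cF : continuous F.
  move=> x; apply: differentiable_continuous; apply/derivable1_diffP.
  by have [] := dF x.
pose kn (n : nat) := (EFin \o k) \_ (`[- n.+1%:R, n.+1%:R]%classic : set (measurableTypeR R)).
have mk : measurable_fun setT (EFin \o k : measurableTypeR R -> _).
  by case/integrableP: lk.
have [_ _ dct] : [/\ mu.-integrable setT (EFin \o k),
   [sequence \int[mu]_x `|kn n x - (EFin \o k) x|%E]_n @ \oo --> 0%E &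
   [sequence \int[mu]_x (kn n x)]_n @ \oo --> \int[mu]_x (EFin \o k) x]%E.
  apply: (@dominated_convergence _ _ _ mu setT measurableT kn (EFin \o k)
            (fun x => `|(EFin \o k) x|%E)) => //.
  - move=> n; rewrite /kn.
    apply: (measurable_restrictT _ (measurable_itv _)).1.
    exact: (measurable_funTS mk).
  - apply: nearW => x _.
    apply: cvg_near_cst; near=> n.
    rewrite /kn patchE ifT// inE/= in_itv/=.
    rewrite -ler_norml; apply: ltW; near: n.
    exists (Num.truncn `|x|) => // n /= hn.
    by rewrite (lt_le_trans (truncnS_gt _))// ler_nat ltnS.
  - exact: integrable_abse.
  - apply: nearW => x n _; rewrite /kn patchE; case: ifP => // _.
    by rewrite abse0.
have E n : (\int[mu]_x (kn n x) = (F n.+1%:R - F (- n.+1%:R))%:E)%E.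
  rewrite /kn -integral_mkcond (@continuous_FTC2 _ k F).
  - by rewrite EFinB.
  - by rewrite gtrN.
  - exact: continuous_subspaceT.
  - split.
    + by move=> x _; have [] := dF x.
    + exact/cvg_at_right_filter/cF.
    + exact/cvg_at_left_filter/cF.
  - by move=> x _; rewrite derive1E; have [] := dF x.
have dec x : `|F x| <= (C * (16 ^+ 4 * normal_peak 1)) / (1 + x ^+ 2).
  rewrite ler_pdivlMr; last exact: lt_le_trans (q1 x).
  rewrite /F normrM (ger0_norm (phi_ge0 x)).
  apply: le_trans (_ : C * (1 + x ^+ 2) ^+ 3 * phi x * (1 + x ^+ 2) <= _).
    by rewrite ler_wpM2r// ler_wpM2r// phi_ge0.
  rewrite (_ : _ * _ * _ * _ = C * ((1 + x ^+ 2) ^+ 4 * phi x)); last by ring.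
  by rewrite ler_wpM2l// phi_decay.
pose D := C * (16 ^+ 4 * normal_peak 1) : R.
have D0 : 0 <= D by rewrite !mulr_ge0// normal_peak_ge0.
have lim0 : (F n.+1%:R - F (- n.+1%:R)) @[n --> \oo] --> (0 : R).
  apply: (@squeeze_cvgr _ _ _ _ (fun n => - (2 * D) * n.+1%:R^-1)
     (fun n => (2 * D) * n.+1%:R^-1)).
  - near=> n; rewrite mulNr -ler_norml; apply: le_trans (ler_normB _ _) _.
    have hD (y : R) : y ^+ 2 = n.+1%:R ^+ 2 -> `|F y| <= D * n.+1%:R^-1.
      move=> hy; apply: le_trans (dec y) _; rewrite hy ler_wpM2l// lef_pV2 ?posrE//.
        have : 1 <= n.+1%:R :> R by rewrite ler1n.
        by rewrite expr2; nra.
    rewrite (_ : 2 * D * _ = D * n.+1%:R^-1 + D * n.+1%:R^-1); last by ring.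
    by apply: lerD; apply: hD; rewrite ?sqrrN.
  - rewrite -[X in _ --> X](mulr0 (- (2 * D))).
    by apply: cvgMr; exact: cvg_harmonic.
  - rewrite -[X in _ --> X](mulr0 (2 * D)).
    by apply: cvgMr; exact: cvg_harmonic.
apply: EFin_inj; rewrite Ex_stdnormal//.
rewrite -[LHS](cvg_lim (@ereal_hausdorff R) dct); apply/cvg_lim => //.
rewrite (_ : [sequence _]_n = (fun n => (F n.+1%:R - F (- n.+1%:R))%:E)).
  exact: (cvg_comp _ _ lim0).
by apply/funext => n; rewrite /= E.
Unshelve. all: by end_near. Qed.

End Stein.

(** * Reflection invariance of Gaussian matrices *)

Section ReflectionMatrix.
Context (R : realType) (p : nat) (k l : 'I_p) (c s : R).
Hypothesis kl : k != l.

(** The reflection of the plane of coordinates k and l with matrix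
    [c s; s -c].  It is symmetric and involutive, which makes conjugation by it
    simpler than by a rotation; (1, 0) flips a sign and (0, 1) swaps. *)
Definition refl_mx : 'M[R]_p := \matrix_(a, b)
  (if a == k then (if b == k then c else if b == l then s else 0)
   else if a == l then (if b == k then s else if b == l then - c else 0)
   else (a == b)%:R).

Let lk : l != k. Proof. by rewrite eq_sym. Qed.

Lemma refl_mx_sym : refl_mx^T = refl_mx.
Proof.
apply/matrixP => a b; rewrite !mxE.
have [->|ak] := eqVneq a k; have [bk|bk] := eqVneq b k; rewrite ?(negbTE kl) ?bk//.
  by case: ifP => // _; rewrite (negbTE ak).
have [->|al] := eqVneq a l; have [bl|bl] := eqVneq b l; rewrite ?bl ?eqxx//.
- by rewrite (negbTE al).
- by rewrite eq_sym.
Qed.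

Lemma mul_refl_mx n (B : 'M[R]_(p, n)) a j : (refl_mx *m B) a j =
  if a == k then c * B k j + s * B l j
  else if a == l then s * B k j - c * B l j else B a j.
Proof.
rewrite mxE; have [->|ak] := eqVneq a k.
  rewrite (bigD1 k)//= (bigD1 l)//= !mxE !eqxx (negbTE lk) big1 ?addr0//.
  by move=> i /andP[/negbTE ik /negbTE il]; rewrite mxE eqxx ik il mul0r.
have [->|al] := eqVneq a l.
  rewrite (bigD1 k)//= (bigD1 l)//= !mxE !eqxx (negbTE lk) big1 ?addr0 ?mulNr//.
  by move=> i /andP[/negbTE ik /negbTE il]; rewrite mxE (negbTE lk) eqxx ik il mul0r.
rewrite (bigD1 a)//= mxE (negbTE ak) (negbTE al) eqxx mul1r big1 ?addr0//.
by move=> i ia; rewrite mxE (negbTE ak) (negbTE al) eq_sym (negbTE ia) mul0r.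
Qed.

Lemma mul_mx_refl n (B : 'M[R]_(n, p)) i a : (B *m refl_mx) i a =
  if a == k then c * B i k + s * B i l
  else if a == l then s * B i k - c * B i l else B i a.
Proof.
have := mul_refl_mx B^T a i; rewrite -{1}refl_mx_sym -trmx_mul mxE => ->.
by rewrite !mxE.
Qed.

Hypothesis cs : c ^+ 2 + s ^+ 2 = 1.

Lemma refl_mxK : refl_mx *m refl_mx = 1%:M.
Proof.
apply/matrixP => a b; rewrite mul_refl_mx !mxE !eqxx (negbTE lk).
have [->|ak] := eqVneq a k.
  rewrite [k == b]eq_sym; have [_|bk] := eqVneq b k; first by rewrite /= mulr1n -cs; ring.
  by have [_|bl] := eqVneq b l; rewrite /=; ring.
have [->|al] := eqVneq a l.
  rewrite [l == b]eq_sym; have [->|bk] := eqVneq b k.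
    by rewrite (negbTE kl) /=; ring.
  have [_|bl] := eqVneq b l; last by rewrite /=; ring.
  by rewrite /= mulr1n -cs; ring.
by [].
Qed.

End ReflectionMatrix.

Section GaussianMatrix.
Context (R : realType) (n p : nat) (G : probability 'M[R]_(n, p) R).
Hypothesis hG : gauss_law G.
Local Notation Mx := 'M[R]_(n, p).
Local Notation N := (stdnormal R).

Lemma gauss_marginal i j (B : set R) : measurable B ->
  G [set M | B (M i j)] = N B.
Proof.
move=> mB.
pose A k l := if (k == i) && (l == j) then B else setT.
transitivity (G (mx_rect A)).
  congr (G _); apply/seteqP; split=> M /=.
    by move=> hM k l; rewrite /A; case: ifP => // /andP[/eqP-> /eqP->].
  by move=> /(_ i j); rewrite /A !eqxx.
rewrite hG; last by move=> k l; rewrite /A; case: ifP.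
rewrite (bigD1 (i, j))//= /A !eqxx/= big1 ?mule1//.
move=> [k l] /negPf; rewrite xpair_eqE /= => ->.
exact: probability_setT.
Qed.

Let marginal_law i j : forall B, measurable B ->
  law G (@measurable_entry R n p i j) B = N B.
Proof. by move=> B mB; rewrite lawE; exact: gauss_marginal. Qed.

Lemma gauss_entry_L1 i j (g : R -> R) : L1 N g -> L1 G (fun M => g (M i j)).
Proof.
move=> lg; have mg := L1_measurable lg.
apply/(L1_law G (@measurable_entry R n p i j) mg).
move: lg => /integrableP[h1 h2]; apply/integrableP; split=> //.
rewrite (eq_measure_integral N)// => B mB _; exact: marginal_law.
Qed.

Lemma Ex_gauss_entry i j (g : R -> R) : L1 N g ->
  Ex G (fun M => g (M i j)) = Ex N g.
Proof.
move=> lg; have mg := L1_measurable lg.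
have := @Ex_law _ _ _ _ _ G _ (@measurable_entry R n p i j) g mg (gauss_entry_L1 i j lg).
rewrite /comp => <-; rewrite /Ex; congr fine; apply: eq_measure_integral => B mB _.
exact: marginal_law.
Qed.

(** An integrable function that dominates all products of two entries, so that
    one integrability proof serves every quadratic integrand. *)
Definition gauss_dom (M : Mx) : R := 1 + \sum_i \sum_j (M i j) ^+ 4.

Lemma gauss_dom_L1 : L1 G gauss_dom.
Proof.
apply: L1D; first exact: L1_cst.
apply: L1_sum => i _; apply: L1_sum => j _.
apply: (@gauss_entry_L1 i j (fun t => t ^+ 4)).
apply: (L1_stdnormal_poly (C := 1)) => [|t]; first exact: measurable_funX.
rewrite mul1r ger0_norm ?exprn_even_ge0//.
have h := sqr_ge0 t; rewrite (_ : t ^+ 4 = (t ^+ 2) ^+ 2); last by ring.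
apply: le_trans (_ : (1 + t ^+ 2) ^+ 2 <= _).
  by rewrite ler_sqr ?nnegrE//; lra.
by rewrite ler_weXn2l//; lra.
Qed.

Lemma sqr_le_gauss_dom i j (M : Mx) : M i j ^+ 2 <= gauss_dom M.
Proof.
rewrite /gauss_dom (bigD1 i)//= (bigD1 j)//=.
have h1 : 0 <= \sum_(j0 < p | j0 != j) M i j0 ^+ 4.
  by apply: sumr_ge0 => a _; rewrite exprn_even_ge0.
have h2 : 0 <= \sum_(i0 < n | i0 != i) \sum_(j0 < p) M i0 j0 ^+ 4.
  by apply: sumr_ge0 => a _; apply: sumr_ge0 => b _; rewrite exprn_even_ge0.
have : 0 <= (M i j ^+ 2 - 1) ^+ 2 by exact: sqr_ge0.
have := sqr_ge0 (M i j); rewrite (_ : M i j ^+ 4 = (M i j ^+ 2) ^+ 2); last by ring.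
rewrite sqrrB1; set a := M i j ^+ 2; rewrite -mulr_natr; lra.
Qed.

Lemma prod_le_gauss_dom i j k l (M : Mx) : `|M i j * M k l| <= gauss_dom M.
Proof.
rewrite normrM; have h1 := sqr_le_gauss_dom i j M; have h2 := sqr_le_gauss_dom k l M.
rewrite -[M i j ^+ 2]real_normK ?num_real// in h1.
rewrite -[M k l ^+ 2]real_normK ?num_real// in h2.
have := sqr_ge0 (`|M i j| - `|M k l|); rewrite sqrrB -mulr_natr; lra.
Qed.

Lemma gauss_dom_ge1 (M : Mx) : 1 <= gauss_dom M.
Proof.
by rewrite lerDl; apply: sumr_ge0 => a _; apply: sumr_ge0 => b _; rewrite exprn_even_ge0.
Qed.

Lemma gauss_L1_dom (C : R) (F : Mx -> R) : measurable_fun setT F ->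
  (forall M, `|F M| <= C * gauss_dom M) -> L1 G F.
Proof. by move=> mF hF; apply: L1_le mF hF _; apply: L1Z; exact: gauss_dom_L1. Qed.

Section Reflection.
Context (k l : 'I_p) (c s : R).
Hypothesis kl : k != l.
Hypothesis cs : c ^+ 2 + s ^+ 2 = 1.
Local Notation H := (refl_mx k l c s).

Let refl_rows (A : pred 'I_n) (M : Mx) : Mx :=
  \matrix_(i, j) (if A i then (M *m H) i j else M i j).

Let measurable_refl_rows A : measurable_fun setT (refl_rows A).
Proof.
have mM : mxm (fun M : Mx => M *m H).
  by apply: mxm_mul; [exact: measurable_entry|exact: mxm_cst].
apply/measurable_mxP => i j.
apply: (meas_eq (f := fun M : Mx => if A i then (M *m H) i j else M i j)).
  by move=> M; rewrite [RHS]mxE.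
by case: (A i); [exact: mM|exact: measurable_entry].
Qed.

Let refl_row1 i (F : Mx -> \bar R) : measurable_fun setT F ->
  (forall M, (0 <= F M)%E) ->
  (\int[G]_M F (refl_rows (pred1 i) M) = \int[G]_M F M)%E.
Proof.
move=> mF F0.
have two (F' : Mx -> \bar R) : measurable_fun setT F' -> (forall M, (0 <= F' M)%E) ->
    (\int[G]_M F' M = \int[G]_M \int[N]_t \int[N]_t'
       F' (set_entry i l t' (set_entry i k t M)))%E.
  move=> mF' F'0; rewrite (integral_set_entry i l hG mF' F'0).
  rewrite (integral_set_entry i k hG (F := fun M => \int[N]_t F' (set_entry i l t M))%E)//.
    have := @measurable_fun_fubini_tonelli_F _ _ _ _ _ N
      (fun z : Mx * R => F' (set_entry i l z.2 z.1)).
    apply=> //; exact: (measurableT_comp mF' (measurable_set_entry i l)).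
  by move=> M; exact: integral_ge0.
have mF1 : measurable_fun setT (fun M => F (refl_rows (pred1 i) M)).
  exact: (measurableT_comp mF (measurable_refl_rows (pred1 i))).
rewrite (two _ mF1 (fun M => F0 _)) (two _ mF F0); apply: eq_integral => M _.
have m2 : measurable_fun setT (fun z : R * R => F (set_entry i l z.2 (set_entry i k z.1 M))).
  apply: (measurableT_comp mF); apply/measurable_mxP => a b.
  apply: (meas_eq (f := fun z : R * R => if (a == i) && (b == l) then z.2 else
    if (a == i) && (b == k) then z.1 else M a b)).
    by move=> z; rewrite !mxE.
  case: (_ && _); first exact: measurable_snd.
  by case: (_ && _); first exact: measurable_fst.
rewrite -(integral_stdnormal_reflection cs m2 (fun z => F0 _)).
apply: eq_integral => t _; apply: eq_integral => t' _; congr F.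
apply/matrixP => a b; rewrite !mxE /= -/((_ *m H) a b).
have [->|ai] := eqVneq a i => //=.
have -> : \sum_j set_entry i l t' (set_entry i k t M) i j * H j b =
   (set_entry i l t' (set_entry i k t M) *m H) i b by rewrite mxE.
rewrite mul_mx_refl// !mxE !eqxx/= (negbTE kl).
have [->|bk] := eqVneq b k; first by rewrite (negbTE kl).
by case: (b == l).
Qed.

Let refl_rows_ord (r : nat) : (r <= n)%N -> forall F : Mx -> \bar R,
  measurable_fun setT F -> (forall M, (0 <= F M)%E) ->
  (\int[G]_M F (refl_rows (fun i => (i < r)%N) M) = \int[G]_M F M)%E.
Proof.
elim: r => [_ F mF F0|r IH rn F mF F0].
  apply: eq_integral => M _; congr F; apply/matrixP => i j; rewrite mxE //.
pose i := Ordinal rn.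
have mF1 : measurable_fun setT (fun M => F (refl_rows (pred1 i) M)).
  exact: (measurableT_comp mF (measurable_refl_rows (pred1 i))).
rewrite -(refl_row1 i mF F0) -(IH (ltnW rn) _ mF1)//.
apply: eq_integral => M _; congr F; apply/matrixP => a b.
rewrite [LHS]mxE [RHS]mxE /= ltnS leq_eqVlt.
have -> : (a == i) = ((a : nat) == r) by [].
have [ar|ar] := eqVneq (a : nat) r => /=; last by rewrite [RHS]mxE.
rewrite [LHS]mxE [RHS]mxE; apply: eq_bigr => j _; congr (_ * _).
by rewrite [RHS]mxE /= ar ltnn.
Qed.

Lemma integral_col_reflection (F : Mx -> \bar R) : measurable_fun setT F ->
  (forall M, (0 <= F M)%E) -> (\int[G]_M F (M *m H) = \int[G]_M F M)%E.
Proof.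
move=> mF F0; rewrite -[RHS](refl_rows_ord (leqnn n))//.
by apply: eq_integral => M _; congr F; apply/matrixP => i j; rewrite [RHS]mxE ltn_ord.
Qed.

Lemma measurable_col_reflection : measurable_fun setT (fun M : Mx => M *m H).
Proof.
by apply/measurable_mxP; apply: mxm_mul; [exact: measurable_entry|exact: mxm_cst].
Qed.

Let law_col_reflection B : measurable B ->
  law G measurable_col_reflection B = G B.
Proof.
move=> mB; rewrite lawE.
have m1 : measurable_fun setT (fun M : Mx => (\1_B M : R)%:E).
  by apply/measurable_EFinP; exact: measurable_indic.
have mB' : measurable ((fun M : Mx => M *m H) @^-1` B).
  by rewrite -[X in measurable X]setTI; exact: measurable_col_reflection.
have e1 : (G B = \int[G]_M (\1_B M : R)%:E)%E by rewrite integral_indic// setIT.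
have e2 : (G ((fun M : Mx => M *m H) @^-1` B) =
    \int[G]_M (\1_((fun M : Mx => M *m H) @^-1` B) M : R)%:E)%E.
  by rewrite integral_indic// setIT.
rewrite [RHS]e1 [LHS]e2 -(integral_col_reflection m1); last by move=> M; rewrite lee_fin.
by apply: eq_integral => M _; rewrite !indicE.
Qed.

Lemma L1_col_reflection (F : Mx -> R) : L1 G F -> L1 G (fun M => F (M *m H)).
Proof.
move=> lF; apply/(L1_law G measurable_col_reflection (L1_measurable lF)).
by apply: L1_eq_law lF => B mB; rewrite law_col_reflection.
Qed.

(** The law of a Gaussian matrix is invariant under reflecting all its rows in
    a coordinate plane. *)
Lemma Ex_col_reflection (F : Mx -> R) : L1 G F ->
  Ex G (fun M => F (M *m H)) = Ex G F.
Proof.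
move=> lF; rewrite -(Ex_eq_law F law_col_reflection) Ex_law//.
- exact: L1_measurable lF.
- exact: L1_col_reflection.
Qed.

End Reflection.

End GaussianMatrix.

Section Transpose.
Context (R : realType) (n p : nat) (G : probability 'M[R]_(n, p) R).
Hypothesis hG : gauss_law G.

Lemma measurable_tr : measurable_fun setT (fun M : 'M[R]_(n, p) => M^T).
Proof. by apply/measurable_mxP; apply: mxm_tr => i j; exact: measurable_entry. Qed.

Lemma gauss_tr : gauss_law (law G measurable_tr).
Proof.
move=> A mA; rewrite lawE (_ : _ @^-1` _ = mx_rect (fun i j => A j i)).
  rewrite hG// (reindex (fun ij : 'I_p * 'I_n => (ij.2, ij.1)))//=.
  by exists (fun ij => (ij.2, ij.1)) => -[].
by apply/seteqP; split=> M /= h i j; have := h j i; rewrite mxE.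
Qed.

Lemma Ex_row_reflection (k l : 'I_n) (c s : R) (F : 'M[R]_(n, p) -> R) :
  k != l -> c ^+ 2 + s ^+ 2 = 1 -> L1 G F ->
  Ex G (fun M => F (refl_mx k l c s *m M)) = Ex G F.
Proof.
move=> kl cs lF; have mF := L1_measurable lF.
pose F' (M : 'M[R]_(p, n)) := F M^T.
have mF' : measurable_fun setT F'.
  apply: (measurableT_comp mF); apply/measurable_mxP.
  by apply: mxm_tr => i j; exact: measurable_entry.
have lF' : L1 (law G measurable_tr) F'.
  by apply/(L1_law G measurable_tr mF'); apply: L1_eq lF => M; rewrite /F' /= trmxK.
have := Ex_col_reflection gauss_tr kl cs lF'.
rewrite Ex_law//; last first.
- apply/(L1_law G measurable_tr).
    exact: (measurableT_comp mF' (measurable_col_reflection _ _ _ _)).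
  exact: (L1_col_reflection gauss_tr kl cs lF').
- exact: (measurableT_comp mF' (measurable_col_reflection _ _ _ _)).
rewrite Ex_law//; last by apply: L1_eq lF => M; rewrite /F' /= trmxK.
rewrite /comp /F' => h.
transitivity (Ex G (fun M => F (M^T *m refl_mx k l c s)^T)).
  by apply: Ex_eq => M; rewrite trmx_mul trmxK refl_mx_sym.
by rewrite h; apply: Ex_eq => M; rewrite trmxK.
Qed.

End Transpose.

Section RowSelection.
Context (R : realType) (n p q : nat) (G : probability 'M[R]_(n, p) R).
Hypothesis hG : gauss_law G.
Context (f : 'I_q -> 'I_n).
Hypothesis finj : injective f.

Lemma measurable_rowsub : measurable_fun setT (fun M : 'M[R]_(n, p) => rowsub f M).
Proof. by apply/measurable_mxP; apply: mxm_rowsub => i j; exact: measurable_entry. Qed.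

Lemma gauss_rowsub : gauss_law (law G measurable_rowsub).
Proof.
move=> A mA; rewrite lawE.
pose A' i j := if [pick a | f a == i] is Some a then A a j else setT.
have A'f a j : A' (f a) j = A a j.
  rewrite /A'; case: pickP => [b /eqP/finj->//|/(_ a)]; by rewrite eqxx.
rewrite (_ : _ @^-1` _ = mx_rect A').
  rewrite hG; last by move=> i j; rewrite /A'; case: pickP.
  rewrite (bigID (fun ij : 'I_n * 'I_p => ij.1 \in codom f))/=.
  rewrite [X in (_ * X)%E]big1 ?mule1; last first.
    move=> [i j] /= hi; rewrite /A'; case: pickP => [a /eqP fa|_].
      by move: hi; rewrite -fa codom_f.
    exact: probability_setT.
  pose h (kj : 'I_q * 'I_p) := (f kj.1, kj.2).
  have hinj : injective h by move=> [a b] [a' b'] [] /finj -> ->.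
  rewrite (eq_bigl (fun ij => ij \in [set h x | x in [set: 'I_q * 'I_p]%SET]%SET)).
    rewrite big_imset/=; last by move=> x y _ _; exact: hinj.
    by apply: eq_big => [x|[a b] _]; rewrite ?inE// /h /= A'f.
  move=> [i j] /=; apply/codomP/imsetP => [[a ->]|[[a b] _ [-> _]]].
    by exists (a, j); rewrite ?inE.
  by exists a.
apply/seteqP; split=> M /= hM i j.
  rewrite /A'; case: pickP => // a /eqP <-; by have := hM a j; rewrite mxE.
by have := hM (f i) j; rewrite A'f mxE.
Qed.

End RowSelection.

(** * Ridge resolvents *)

Section QuadraticForms.
Context (R : realFieldType).

Definition quad (p : nat) (A : 'M[R]_p) (v : 'cV[R]_p) : R := (v^T *m A *m v) 0 0.

Definition sqn (p : nat) (v : 'cV[R]_p) : R := \sum_i v i 0 ^+ 2.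

Lemma sqn_ge0 p (v : 'cV[R]_p) : 0 <= sqn v.
Proof. by apply: sumr_ge0 => i _; exact: sqr_ge0. Qed.

Lemma sqnE p (v : 'cV[R]_p) : (v^T *m v) 0 0 = sqn v.
Proof. by rewrite mxE; apply: eq_bigr => i _; rewrite mxE expr2. Qed.

Lemma sqn_eq0 p (v : 'cV[R]_p) : sqn v = 0 -> v = 0.
Proof.
move=> /eqP; rewrite psumr_eq0 => [/allP h|i _]; last exact: sqr_ge0.
apply/colP => i; have := h i (mem_index_enum _).
by rewrite /= sqrf_eq0 mxE => /eqP.
Qed.

Lemma quadE p (A : 'M[R]_p) v : quad A v = \sum_i \sum_j v i 0 * v j 0 * A i j.
Proof.
rewrite /quad mxE exchange_big /=; apply: eq_bigr => j _.
rewrite mxE mulr_suml; apply: eq_bigr => i _; rewrite mxE; ring.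
Qed.

Lemma quadD p (A B : 'M[R]_p) v : quad (A + B) v = quad A v + quad B v.
Proof. by rewrite /quad mulmxDr mulmxDl mxE. Qed.

Lemma quadB p (A B : 'M[R]_p) v : quad (A - B) v = quad A v - quad B v.
Proof. by rewrite /quad mulmxBr mulmxBl !mxE. Qed.

Lemma quadZ p a (A : 'M[R]_p) v : quad (a *: A) v = a * quad A v.
Proof. by rewrite /quad -scalemxAr -scalemxAl mxE. Qed.

Lemma quad_scalar p a (v : 'cV[R]_p) : quad a%:M v = a * sqn v.
Proof. by rewrite /quad mul_mx_scalar -scalemxAl mxE sqnE. Qed.

Lemma quad_gram n p (X : 'M[R]_(n, p)) v : quad (X^T *m X) v = sqn (X *m v).
Proof. by rewrite /quad -sqnE trmx_mul !mulmxA. Qed.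

Lemma quad_delta p (A : 'M[R]_p) i : quad A (delta_mx i 0) = A i i.
Proof. by rewrite /quad trmx_delta -rowE -colE !mxE. Qed.

Lemma sqn_delta p (i : 'I_p) : sqn (delta_mx i 0 : 'cV[R]_p) = 1.
Proof. by rewrite -[sqn _]mul1r -quad_scalar quad_delta mxE eqxx. Qed.

Lemma sqn_mul_delta n p (X : 'M[R]_(n, p)) i : sqn (X *m delta_mx i 0) = \sum_a X a i ^+ 2.
Proof. by rewrite -colE; apply: eq_bigr => a _; rewrite mxE. Qed.

Lemma trace_quad n p (A : 'M[R]_p) (X : 'M[R]_(p, n)) :
  \tr (X^T *m A *m X) = \sum_j quad A (col j X).
Proof.
apply: eq_bigr => j _.
by rewrite -quad_delta /quad colE trmx_mul !mulmxA.
Qed.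

Lemma frob_trace n p (X : 'M[R]_(n, p)) : \tr (X^T *m X) = \sum_i \sum_j X i j ^+ 2.
Proof.
rewrite exchange_big; apply: eq_bigr => j _; rewrite mxE; apply: eq_bigr => i _.
by rewrite mxE expr2.
Qed.

Lemma inj_unitmx p (A : 'M[R]_p) : (forall v : 'cV_p, A *m v = 0 -> v = 0) ->
  A \in unitmx.
Proof.
move=> h; rewrite -unitmx_tr -row_free_unit; apply/row_freeP.
suff : row_free A^T by move/row_freeP.
rewrite -kermx_eq0; apply/eqP/row_matrixP => i; rewrite row0.
apply: (can_inj (@trmxK _ _ _)); rewrite trmx0; apply: h.
by rewrite -{1}[A]trmxK -trmx_mul -row_mul mulmx_ker row0 trmx0.
Qed.

Lemma sym_invmx p (A : 'M[R]_p) : A^T = A -> (invmx A)^T = invmx A.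
Proof. by move=> h; rewrite trmx_inv h. Qed.

End QuadraticForms.

Section Resolvent.
Context (R : realFieldType) (n p : nat).
Implicit Types (X : 'M[R]_(n, p)) (mu : R).

(** Scaling by mu puts the spectrum in [0, 1] and makes all bounds uniform.
    Locked because unification would otherwise unfold the matrix inverse. *)
Definition ridge : R -> 'M[R]_(n, p) -> 'M[R]_p :=
  locked (fun mu X => mu *: invmx (X^T *m X + mu%:M)).

Lemma ridgeE mu X : ridge mu X = mu *: invmx (X^T *m X + mu%:M).
Proof. by rewrite /ridge -lock. Qed.

Lemma ridge_unit mu X : 0 < mu -> X^T *m X + mu%:M \in unitmx.
Proof.
move=> mu0; apply: inj_unitmx => v hv; apply: sqn_eq0.
have : quad (X^T *m X + mu%:M) v = 0 by rewrite /quad -mulmxA hv mulmx0 mxE.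
rewrite quadD quad_gram quad_scalar => h.
have h1 := sqn_ge0 (X *m v); have h2 := sqn_ge0 v; nra.
Qed.

Lemma ridge_sym mu X : (ridge mu X)^T = ridge mu X.
Proof.
rewrite ridgeE linearZ/= sym_invmx// linearD/= tr_scalar_mx.
by rewrite trmx_mul trmxK.
Qed.

Lemma ridge_mul mu X : 0 < mu -> (X^T *m X + mu%:M) *m ridge mu X = mu%:M.
Proof. by move=> mu0; rewrite ridgeE -scalemxAr mulmxV ?ridge_unit// scalemx1. Qed.

Lemma ridge_solve q mu X (v w : 'M[R]_(p, q)) : 0 < mu ->
  (X^T *m X + mu%:M) *m v = w -> v = mu^-1 *: (ridge mu X *m w).
Proof.
move=> mu0 <-; rewrite ridgeE -scalemxAl scalerA mulVf ?scale1r ?gt_eqF//.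
by rewrite [RHS]mulmxA mulVmx ?ridge_unit// mul1mx.
Qed.

Lemma ridge_unique mu X (B : 'M[R]_p) : 0 < mu ->
  (X^T *m X + mu%:M) *m B = mu%:M -> B = ridge mu X.
Proof.
move=> mu0 h; rewrite [LHS](ridge_solve mu0 h) mul_mx_scalar scalerA mulVf ?scale1r//.
by rewrite gt_eqF.
Qed.

Lemma gram_ridge mu X : 0 < mu -> X^T *m X *m ridge mu X = mu *: (1%:M - ridge mu X).
Proof.
move=> mu0; have := ridge_mul X mu0; rewrite mulmxDl mul_scalar_mx => h.
by rewrite scalerBr scalemx1 -h addrK.
Qed.

Lemma ridge_gram mu X : 0 < mu -> ridge mu X *m (X^T *m X) = mu *: (1%:M - ridge mu X).
Proof.
move=> mu0; have := congr1 (@trmx _ _ _) (gram_ridge X mu0).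
by rewrite trmx_mul ridge_sym trmx_mul trmxK linearZ/= linearB/= trmx1 ridge_sym.
Qed.

(** The basic identity: K (1 - K) is a Gram matrix, whence 0 <= K^2 <= K <= 1. *)
Lemma ridge_ridge mu X : 0 < mu ->
  mu *: (ridge mu X - ridge mu X *m ridge mu X) = (X *m ridge mu X)^T *m (X *m ridge mu X).
Proof.
move=> mu0; rewrite trmx_mul ridge_sym -mulmxA [X^T *m _]mulmxA gram_ridge//.
by rewrite -[in RHS]scalemxAr mulmxBr mulmx1.
Qed.

Lemma sqn_ridge mu X v : 0 < mu -> sqn (ridge mu X *m v) <= quad (ridge mu X) v.
Proof.
move=> mu0; rewrite -quad_gram ridge_sym -subr_ge0 -quadB -(pmulr_rge0 _ mu0).
by rewrite -quadZ ridge_ridge// quad_gram sqn_ge0.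
Qed.

Lemma quad_ridge_ge0 mu X v : 0 < mu -> 0 <= quad (ridge mu X) v.
Proof. by move=> mu0; apply: le_trans (sqn_ge0 _) (sqn_ridge X v mu0). Qed.

Lemma quad_ridge_le mu X v : 0 < mu -> quad (ridge mu X) v <= sqn v.
Proof.
move=> mu0; have h1 := sqn_ridge X v mu0.
have h2 := sqn_ge0 ((1%:M - ridge mu X) *m v).
have e : sqn ((1%:M - ridge mu X) *m v) =
    sqn v - 2 * quad (ridge mu X) v + sqn (ridge mu X *m v).
  have hT : (1%:M - ridge mu X)^T = 1%:M - ridge mu X.
    by rewrite linearB/= trmx1 ridge_sym.
  rewrite -[LHS]quad_gram -[sqn (ridge mu X *m v)]quad_gram hT ridge_sym.
  rewrite mulmxBl mul1mx mulmxBr mulmx1 !quadB -[sqn v]mul1r -quad_scalar; ring.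
rewrite e in h2; lra.
Qed.

Lemma sqn_ridge_le mu X v : 0 < mu -> sqn (ridge mu X *m v) <= sqn v.
Proof. by move=> mu0; apply: le_trans (sqn_ridge X v mu0) (quad_ridge_le X v mu0). Qed.

Lemma ridge_diag_ge0 mu X i : 0 < mu -> 0 <= ridge mu X i i.
Proof. by move=> mu0; rewrite -quad_delta quad_ridge_ge0. Qed.

Lemma ridge_diag_le1 mu X i : 0 < mu -> ridge mu X i i <= 1.
Proof. by move=> mu0; rewrite -quad_delta -(sqn_delta _ i) quad_ridge_le. Qed.

Lemma ridge_row_sqr mu X i : 0 < mu -> \sum_j ridge mu X i j ^+ 2 <= 1.
Proof.
move=> mu0; have := sqn_ridge_le X (delta_mx i 0) mu0.
rewrite sqn_delta sqn_mul_delta => h; apply: le_trans h; rewrite le_eqVlt.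
by apply/orP; left; apply/eqP; apply: eq_bigr => j _; rewrite -{1}ridge_sym mxE.
Qed.

Lemma ridge2_sym mu X : (ridge mu X *m ridge mu X)^T = ridge mu X *m ridge mu X.
Proof. by rewrite trmx_mul ridge_sym. Qed.

Lemma quad_ridge2 mu X v : quad (ridge mu X *m ridge mu X) v = sqn (ridge mu X *m v).
Proof. by rewrite -quad_gram ridge_sym. Qed.

Lemma ridge2_row_sqr mu X i : 0 < mu ->
  \sum_j (ridge mu X *m ridge mu X) i j ^+ 2 <= 1.
Proof.
move=> mu0; have := sqn_ridge_le X (ridge mu X *m delta_mx i 0) mu0.
move=> h; have := le_trans h (sqn_ridge_le X (delta_mx i 0) mu0).
rewrite sqn_delta mulmxA sqn_mul_delta => h'; apply: le_trans h'; rewrite le_eqVlt.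
by apply/orP; left; apply/eqP; apply: eq_bigr => j _; rewrite -{1}ridge2_sym mxE.
Qed.

Lemma trace_ridge_ge0 mu X : 0 < mu -> 0 <= \tr (ridge mu X).
Proof. by move=> mu0; apply: sumr_ge0 => i _; exact: ridge_diag_ge0. Qed.

Lemma trace_ridge_le mu X : 0 < mu -> \tr (ridge mu X) <= p%:R.
Proof.
move=> mu0; rewrite -[leRHS]mulr1 -[p in p%:R]card_ord mulr_natl -sumr_const.
by apply: ler_sum => i _; exact: ridge_diag_le1.
Qed.

Lemma ridge_entry_le1 mu X i j : 0 < mu -> `|ridge mu X i j| <= 1.
Proof.
move=> mu0; rewrite -[leRHS](normr1 R) -ler_sqr ?nnegrE// ?normr1 ?real_normK ?num_real// expr1n.
apply: le_trans (ridge_row_sqr X i mu0); rewrite (bigD1 j)//= lerDl.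
by apply: sumr_ge0 => k _; exact: sqr_ge0.
Qed.

Lemma ridge_conj mu X (H : 'M[R]_p) : 0 < mu -> H^T = H -> H *m H = 1%:M ->
  ridge mu (X *m H) = H *m ridge mu X *m H.
Proof.
move=> mu0 hs hh; symmetry; apply: ridge_unique => //.
rewrite trmx_mul hs.
have -> : H *m X^T *m (X *m H) + mu%:M = H *m (X^T *m X + mu%:M) *m H.
  rewrite mulmxDr mulmxDl !mulmxA; congr (_ + _).
  by rewrite -mulmxA mul_scalar_mx -scalemxAr hh scalemx1.
rewrite -!mulmxA [H *m (H *m _)]mulmxA hh mul1mx [(_ + _) *m (ridge _ _ *m _)]mulmxA ridge_mul//.
by rewrite mul_scalar_mx -scalemxAr hh scalemx1.
Qed.

(** Take the trace of K X^T X = mu (1 - K). *)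
Lemma trace_gram_ridge mu X : 0 < mu ->
  \sum_i quad (ridge mu X) (row i X)^T = mu * (p%:R - \tr (ridge mu X)).
Proof.
move=> mu0; have := congr1 (@mxtrace _ _) (ridge_gram X mu0).
rewrite mxtraceZ linearB/= mxtrace1 => <-.
rewrite mulmxA mxtrace_mulC mulmxA -[X in X *m _ *m _]trmxK trace_quad.
by apply: eq_bigr => i _; rewrite tr_row.
Qed.

Definition zero_row (i : 'I_n) X : 'M[R]_(n, p) :=
  \matrix_(k, l) (if k == i then 0 else X k l).

Lemma gram_zero_row i X : X^T *m X =
  (zero_row i X)^T *m zero_row i X + (row i X)^T *m row i X.
Proof.
apply/matrixP => a b; rewrite !mxE (bigD1 i)//= [X in _ = X + _](bigD1 i)//= !mxE.
rewrite eqxx mul0r add0r big_ord1 !mxE addrC; congr (_ + _).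
by apply: eq_bigr => k /negbTE ki; rewrite !mxE ki.
Qed.

(** The leave-one-out quadratic form of the row i, which is independent of
    the matrix it is tested against. *)
Definition loo mu i X : R := quad (ridge mu (zero_row i X)) (row i X)^T / mu.

Lemma loo_ge0 mu i X : 0 < mu -> 0 <= loo mu i X.
Proof. by move=> mu0; rewrite divr_ge0 ?quad_ridge_ge0// ltW. Qed.

(** Sherman-Morrison: reinserting a row only rescales the image of that row. *)
Lemma ridge_mul_row mu i X : 0 < mu ->
  ridge mu X *m (row i X)^T =
  (1 + loo mu i X)^-1 *: (ridge mu (zero_row i X) *m (row i X)^T).
Proof.
move=> mu0; set x := (row i X)^T; set K' := ridge mu (zero_row i X).
have t0 := loo_ge0 i X mu0.
have t1 : 1 + loo mu i X != 0 by rewrite gt_eqF// ltr_wpDr.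
have h : (X^T *m X + mu%:M) *m (K' *m x) = (mu * (1 + loo mu i X)) *: x.
  rewrite (gram_zero_row i) -addrA [_ + mu%:M]addrC addrA mulmxDl mulmxA ridge_mul//.
  rewrite mul_scalar_mx -[row i X]trmxK -/x -mulmxA [x^T *m (K' *m x)]mx11_scalar.
  rewrite trmxK mul_mx_scalar mulmxA -/(quad K' x) -scalerDl; congr (_ *: _).
  by rewrite /loo -/x -/K'; field; rewrite gt_eqF.
have -> : K' *m x = (1 + loo mu i X) *: (ridge mu X *m x).
  rewrite [LHS](ridge_solve mu0 h) -[ridge mu X *m (_ *: x)]scalemxAr scalerA.
  by rewrite mulKf// gt_eqF.
by rewrite scalerA mulVf// scale1r.
Qed.

Lemma quad_ridge_row mu i X : 0 < mu ->
  quad (ridge mu X) (row i X)^T = mu * (loo mu i X / (1 + loo mu i X)).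
Proof.
move=> mu0; rewrite /quad -mulmxA ridge_mul_row// -scalemxAr mxE mulmxA.
rewrite -/(quad _ _) {2}/loo; field.
by rewrite !gt_eqF// ltr_wpDr// loo_ge0.
Qed.

(** The difference of the two resolvents has rank one and norm at most 1. *)
Lemma trace_zero_row mu i X : 0 < mu ->
  0 <= \tr (ridge mu (zero_row i X)) - \tr (ridge mu X) <= 1.
Proof.
move=> mu0; set x := (row i X)^T; set K' := ridge mu (zero_row i X).
have t0 := loo_ge0 i X mu0.
have e : K' - ridge mu X = mu^-1 *: (ridge mu X *m x *m (x^T *m K')).
  have h : (X^T *m X + mu%:M) *m (K' - ridge mu X) = x *m (x^T *m K').
    rewrite mulmxBr ridge_mul// (gram_zero_row i) -addrA [_ + mu%:M]addrC addrA.
    by rewrite mulmxDl ridge_mul// [mu%:M + _]addrC addrK -mulmxA /x trmxK.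
  by rewrite [LHS](ridge_solve mu0 h) [ridge mu X *m (_ *m _)]mulmxA.
have {e} -> : \tr K' - \tr (ridge mu X) =
    sqn (K' *m x) / (mu * (1 + loo mu i X)).
  have e5 : ridge mu X *m x = (1 + loo mu i X)^-1 *: (K' *m x) by exact: ridge_mul_row.
  rewrite -linearB/= e mxtraceZ mxtrace_mulC e5.
  have -> : x^T *m K' = (K' *m x)^T by rewrite trmx_mul ridge_sym.
  rewrite -[_ *m (_ *: (K' *m x))]scalemxAr mxtraceZ.
  by rewrite /mxtrace big_ord1 sqnE mulrA mulrC invfM.
have h1 := sqn_ridge (zero_row i X) x mu0.
have e : quad (ridge mu (zero_row i X)) x = mu * loo mu i X.
  by rewrite /loo mulrC divfK// gt_eqF.
rewrite divr_ge0 ?sqn_ge0//=; last by rewrite mulr_ge0 ?ltW// ltr_wpDr.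
rewrite ler_pdivrMr ?mul1r; last by rewrite mulr_gt0// ltr_wpDr.
rewrite e in h1; apply: le_trans h1 _; rewrite ler_pM2l//; lra.
Qed.

Lemma resolvent_identity mu nu X : 0 < mu -> 0 < nu ->
  mu^-1 *: ridge mu X - nu^-1 *: ridge nu X =
  (nu - mu) *: ((mu^-1 *: ridge mu X) *m (nu^-1 *: ridge nu X)).
Proof.
move=> mu0 nu0.
have Rm : (X^T *m X + mu%:M) *m (mu^-1 *: ridge mu X) = 1%:M.
  by rewrite -scalemxAr ridge_mul// scale_scalar_mx mulVf// gt_eqF.
have Rn : (X^T *m X + nu%:M) *m (nu^-1 *: ridge nu X) = 1%:M.
  by rewrite -scalemxAr ridge_mul// scale_scalar_mx mulVf// gt_eqF.
have Rm' : (mu^-1 *: ridge mu X) *m (X^T *m X + mu%:M) = 1%:M by exact: mulmx1C.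
set A := mu^-1 *: _ in Rm Rm' *; set B := nu^-1 *: _ in Rn *.
have : A *m (X^T *m X + nu%:M) *m B - A *m (X^T *m X + mu%:M) *m B = A - B.
  by rewrite Rm' mul1mx -mulmxA Rn mulmx1.
move=> <-; rewrite -mulmxBl -mulmxBr opprD addrACA subrr add0r -raddfB/=.
by rewrite mul_mx_scalar -scalemxAl.
Qed.

(** Quantitative form of: the trace of R^2 is minus the derivative of the
    trace of R = (X^T X + mu)^-1 in mu. *)
Lemma trace_ridge2_diffquot mu nu X : 0 < mu -> mu < nu ->
  `| (\tr (ridge mu X) / mu - \tr (ridge nu X) / nu) / (nu - mu)
     - \tr (ridge mu X *m ridge mu X) / mu ^+ 2 | <= (nu - mu) * p%:R / mu ^+ 3.
Proof.
move=> mu0 mn; have nu0 : 0 < nu by exact: lt_trans mn.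
have d0 : 0 < nu - mu by rewrite subr_gt0.
set A := mu^-1 *: ridge mu X; set B := nu^-1 *: ridge nu X.
have e1 : (\tr (ridge mu X) / mu - \tr (ridge nu X) / nu) / (nu - mu) = \tr (A *m B).
  have := congr1 (@mxtrace _ _) (resolvent_identity X mu0 nu0).
  rewrite linearB/= !mxtraceZ -/A -/B => h.
  rewrite -[\tr (A *m B)](mulKf (lt0r_neq0 d0)) -h; field.
  by rewrite !gt_eqF.
have e2 : \tr (ridge mu X *m ridge mu X) / mu ^+ 2 = \tr (A *m A).
  by rewrite -scalemxAl -scalemxAr scalerA mxtraceZ mulrC -expr2 exprVn.
have e3 : \tr (A *m A) - \tr (A *m B) = (nu - mu) * \tr (A^T *m B *m A).
  rewrite -linearB/= -mulmxBr resolvent_identity// -/A -/B -scalemxAr mxtraceZ.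
  have -> : A^T = A by rewrite /A linearZ/= ridge_sym.
  by congr (_ * _); rewrite [RHS]mxtrace_mulC.
have e4 : 0 <= \tr (A^T *m B *m A) <= p%:R / mu ^+ 3.
  rewrite trace_quad.
  have hq v : 0 <= quad B v <= mu^-1 * sqn v.
    have h0 := quad_ridge_ge0 X v nu0; have h1 := quad_ridge_le X v nu0.
    have n0 : 0 <= nu^-1 by rewrite invr_ge0 ltW.
    have nm : nu^-1 <= mu^-1 by rewrite lef_pV2 ?posrE// ltW.
    by rewrite quadZ mulr_ge0//=; exact: ler_pM.
  apply/andP; split; first by apply: sumr_ge0 => j _; have /andP[] := hq (col j A).
  have -> : p%:R / mu ^+ 3 = \sum_(j < p) mu^-1 ^+ 3.
    by rewrite [RHS]sumr_const card_ord -[RHS]mulr_natl exprVn.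
  apply: ler_sum => j _; have /andP[_ h] := hq (col j A); apply: le_trans h _.
  rewrite exprS ler_pM2l ?invr_gt0//.
  have -> : col j A = mu^-1 *: (ridge mu X *m delta_mx j 0) by rewrite colE scalemxAl.
  have -> : sqn (mu^-1 *: (ridge mu X *m delta_mx j 0)) =
      mu^-1 ^+ 2 * sqn (ridge mu X *m delta_mx j 0).
    by rewrite /sqn mulr_sumr; apply: eq_bigr => i _; rewrite mxE exprMn.
  rewrite ler_piMr ?sqr_ge0//; apply: le_trans (sqn_ridge_le X _ mu0) _.
  by rewrite sqn_delta.
case/andP: e4 => e4 e5; rewrite e1 e2 distrC e3 ger0_norm.
  by rewrite -mulrA ler_pM2l.
by apply: mulr_ge0 => //; exact: ltW.
Qed.

End Resolvent.

(** * Isotropy of equivariant functions of a Gaussian matrix *)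

Section MeasurableRidge.
Context (R : realType) (d : measure_display) (T : measurableType d) (n p : nat).

Lemma mxm_ridge (mu : R) (X : T -> 'M[R]_(n, p)) : mxm X -> mxm (fun w => ridge mu (X w)).
Proof.
move=> mX i j; apply: (meas_eq (f := fun w => (mu *: invmx ((X w)^T *m X w + mu%:M)) i j)).
  by move=> w; rewrite ridgeE.
apply: mxm_scale => //; apply: mxm_inv; apply: mxm_add; last exact: mxm_cst.
by apply: mxm_mul => //; exact: mxm_tr.
Qed.

Lemma mxm_zero_row i (X : T -> 'M[R]_(n, p)) : mxm X -> mxm (fun w => zero_row i (X w)).
Proof.
move=> mX k l; apply: (meas_eq (f := fun w => if k == i then 0 else X w k l)).
  by move=> w; rewrite mxE.
by case: (k == i).
Qed.

Lemma mxm_row i (X : T -> 'M[R]_(n, p)) : mxm X -> mxm (fun w => row i (X w)).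
Proof.
move=> mX k l; apply: (meas_eq (f := fun w => X w i l)) => // w; by rewrite mxE.
Qed.

Lemma meas_quad (A : T -> 'M[R]_p) (v : T -> 'cV[R]_p) : mxm A -> mxm v ->
  measurable_fun setT (fun w => quad (A w) (v w)).
Proof.
move=> mA mv; have h : mxm (fun w => (v w)^T *m A w *m v w).
  by apply: mxm_mul => //; apply: mxm_mul => //; exact: mxm_tr.
exact: h.
Qed.

Lemma meas_sqn (v : T -> 'cV[R]_p) : mxm v -> measurable_fun setT (fun w => sqn (v w)).
Proof. by move=> mv; apply: meas_sum => i; exact: measurable_funX. Qed.

End MeasurableRidge.

Lemma mxm_id (R : realType) n p : mxm (fun M : 'M[R]_(n, p) => M).
Proof. by move=> i j; exact: measurable_entry. Qed.

(** The difference of the two sides is half of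
    sum_ij w_i w_j (z_i - z_j)^2. *)
Lemma weighted_cauchy (R : realFieldType) (I : finType) (w z : I -> R) :
  (forall i, 0 <= w i) ->
  (\sum_i w i * z i) ^+ 2 <= (\sum_i w i) * \sum_i w i * z i ^+ 2.
Proof.
move=> w0; rewrite -subr_ge0.
have : 0 <= \sum_i \sum_j w i * w j * (z i - z j) ^+ 2.
  by apply: sumr_ge0 => i _; apply: sumr_ge0 => j _; rewrite mulr_ge0 ?sqr_ge0 ?mulr_ge0.
have -> : \sum_i \sum_j w i * w j * (z i - z j) ^+ 2 =
   2 * ((\sum_i w i) * (\sum_i w i * z i ^+ 2) - (\sum_i w i * z i) ^+ 2).
  have e i : \sum_j w i * w j * (z i - z j) ^+ 2 =
    w i * z i ^+ 2 * (\sum_j w j) - 2 * (w i * z i) * (\sum_j w j * z j)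
     + w i * \sum_j w j * z j ^+ 2.
    rewrite !mulr_sumr -sumrB -big_split/=; apply: eq_bigr => j _; ring.
  rewrite (eq_bigr _ (fun i _ => e i)) big_split/= sumrB -!mulr_suml -mulr_sumr.
  ring.
by rewrite pmulr_rge0.
Qed.

Section Isotropy.
Context (R : realType) (n p : nat) (G : probability 'M[R]_(n, p) R).
Hypothesis hG : gauss_law G.
Local Notation Mx := 'M[R]_(n, p).
Context (B : Mx -> 'M[R]_p).
Hypothesis mB : mxm B.
Hypothesis Bsym : forall M, (B M)^T = B M.
Hypothesis Bconj : forall (H : 'M[R]_p) M, H^T = H -> H *m H = 1%:M ->
  B (M *m H) = H *m B M *m H.
Hypothesis Brow : forall M i, \sum_j B M i j ^+ 2 <= 1.

Let BC M i j : B M i j = B M j i.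
Proof. by rewrite -{1}Bsym mxE. Qed.

Let B1 M i j : `|B M i j| <= 1.
Proof.
rewrite -[leRHS](normr1 R) -ler_sqr ?nnegrE// ?normr1 ?real_normK ?num_real// expr1n.
apply: le_trans (Brow M i); rewrite (bigD1 j)//= lerDl.
by apply: sumr_ge0 => k _; exact: sqr_ge0.
Qed.

Let L2 i j k l : L1 G (fun M => B M i j * B M k l).
Proof.
apply: (@L1_bounded _ _ _ _ 1); first by apply: measurable_funM.
by move=> M; rewrite normrM; apply: mulr_ile1.
Qed.

Let L2sqr i j : L1 G (fun M => B M i j ^+ 2).
Proof. by apply: L1_eq (L2 i j i j) => M; rewrite expr2. Qed.

Let Bconj_entry k l c s (kl : k != l) (cs : c ^+ 2 + s ^+ 2 = 1) M i j :
  B (M *m refl_mx k l c s) i j =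
  (refl_mx k l c s *m B M *m refl_mx k l c s) i j.
Proof. by rewrite Bconj// ?refl_mx_sym ?refl_mxK. Qed.

Let offdiag_small k l : k != l -> Ex G (fun M => B M k l ^+ 2) * (p%:R - 1) <= 1.
Proof.
move=> kl.
have swap l' : l' != k -> Ex G (fun M => B M k l' ^+ 2) = Ex G (fun M => B M k l ^+ 2).
  move=> l'k; have [->//|ll'] := eqVneq l' l.
  have cs : (0 : R) ^+ 2 + 1 ^+ 2 = 1 by rewrite expr1n expr0n add0r.
  rewrite -(Ex_col_reflection hG ll' cs (L2sqr k l)).
  apply: Ex_eq => M; rewrite Bconj_entry// mul_mx_refl// eq_sym (negbTE ll') eqxx.
  rewrite !mul_refl_mx// [k == l']eq_sym (negbTE l'k) (negbTE kl).
  by congr (_ ^+ 2); ring.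
have e : \sum_(l' < p | l' != k) Ex G (fun M => B M k l' ^+ 2) =
         Ex G (fun M => B M k l ^+ 2) * (p%:R - 1).
  rewrite (eq_bigr _ swap) sumr_const -[LHS]mulr_natr; congr (_ * _).
  have := cardC1 k; rewrite card_ord => hc.
  rewrite (_ : #|_| = p.-1)//; have p0 : (0 < p)%N by apply: leq_ltn_trans (ltn_ord k).
  by rewrite -subn1 natrB.
rewrite -e -Ex_sum; last by move=> l' _; exact: L2sqr.
rewrite -[leRHS](@Ex_cst _ _ _ G); apply: Ex_le.
- by apply: L1_sum => l' _; exact: L2sqr.
- exact: L1_cst.
move=> M; apply: le_trans (Brow M k); rewrite [leRHS](bigID (fun l' => l' != k))/= lerDl.
by apply: sumr_ge0 => i _; exact: sqr_ge0.
Qed.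

(** The reflection at 45 degrees turns the off-diagonal entry into half the
    difference of the two diagonal ones. *)
Let diag_diff k l : k != l ->
  Ex G (fun M => (B M k k - B M l l) ^+ 2) = 4 * Ex G (fun M => B M k l ^+ 2).
Proof.
move=> kl; pose c : R := Num.sqrt 2^-1.
have c2 : c ^+ 2 = 2^-1 by rewrite sqr_sqrtr.
have cs : c ^+ 2 + c ^+ 2 = 1 by rewrite c2; field.
rewrite -(Ex_col_reflection hG kl cs (L2sqr k l)) -ExZ; last first.
  exact: (L1_col_reflection hG kl cs (L2sqr k l)).
apply: Ex_eq => M; rewrite Bconj_entry// mul_mx_refl// eq_sym (negbTE kl) eqxx.
rewrite !mul_refl_mx// eqxx (BC M l k).
have -> : c * (c * B M k k + c * B M k l) - c * (c * B M k l + c * B M l l)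
   = c ^+ 2 * (B M k k - B M l l) by ring.
by rewrite exprMn c2; field.
Qed.

Let cross0 k l i j : k != l -> i != j -> (i, j) != (k, l) -> (i, j) != (l, k) ->
  Ex G (fun M => B M k l * B M i j) = 0.
Proof.
move=> kl ij h1 h2.
have flip a b : a != b -> a != i -> a != j ->
    Ex G (fun M => B M a b * B M i j) = 0.
  move=> ab ai aj.
  have cs : (-1 : R) ^+ 2 + 0 ^+ 2 = 1 by rewrite sqrrN expr1n expr0n addr0.
  have := Ex_col_reflection hG ab cs (L2 a b i j).
  have -> : Ex G (fun M => B (M *m refl_mx a b (-1) 0) a b *
      B (M *m refl_mx a b (-1) 0) i j) = Ex G (fun M => - (B M a b * B M i j)).
    apply: Ex_eq => M; rewrite !Bconj_entry// !mul_mx_refl// !mul_refl_mx//.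
    rewrite !eqxx [b == a]eq_sym (negbTE ab) [i == a]eq_sym (negbTE ai).
    rewrite [j == a]eq_sym (negbTE aj).
    have [->|ib] := eqVneq i b; have [->|jb] := eqVneq j b; ring.
  rewrite ExN; last exact: L2.
  move=> /eqP; rewrite -subr_eq0 -opprD oppr_eq0 -mulr2n -mulr_natr mulf_eq0.
  by rewrite pnatr_eq0 orbF => /eqP.
have [ki|ki] := eqVneq k i; last first.
  have [kj|kj] := eqVneq k j; last exact: flip.
  have [li|li] := eqVneq l i.
    by move: h2; rewrite -li -kj eqxx.
  rewrite (_ : (fun M => _) = (fun M => B M l k * B M i j)).
    by apply: flip => //; rewrite ?[l == k]eq_sym// -kj eq_sym.
  by apply/funext => M; rewrite BC.
have lj : l != j by apply: contraNneq h1 => lj; rewrite -ki -lj.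
rewrite (_ : (fun M => _) = (fun M => B M l k * B M i j)).
  by apply: flip => //; rewrite ?[l == k]eq_sym// -ki eq_sym.
by apply/funext => M; rewrite BC.
Qed.

Context (A : 'M[R]_p).
Hypothesis Asym : A^T = A.
Hypothesis Adiag : forall i, 0 <= A i i.
Hypothesis Aoff : forall i j, A i j ^+ 2 <= A i i * A j j.

Let AC i j : A i j = A j i. Proof. by rewrite -{1}Asym mxE. Qed.

Let trA2 : \sum_i \sum_j A i j ^+ 2 <= (\tr A) ^+ 2.
Proof.
rewrite expr2 /mxtrace mulr_suml; apply: ler_sum => i _.
by rewrite mulr_sumr; apply: ler_sum => j _.
Qed.

Hypothesis p1 : (1 < p)%N.

Let pm1 : 0 < p%:R - 1 :> R.
Proof. by rewrite subr_gt0 ltr1n. Qed.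

Let E2_le k l : k != l -> Ex G (fun M => B M k l ^+ 2) <= (p%:R - 1)^-1.
Proof.
by move=> kl; rewrite -[leRHS]mul1r ler_pdivlMr//; exact: offdiag_small.
Qed.

Let off M := \sum_(x : 'I_p * 'I_p | x.1 != x.2) A x.1 x.2 * B M x.1 x.2.
Let dg M := \sum_i A i i * (B M i i - \tr (B M) / p%:R).

Let off_sqr M : off M ^+ 2 =
  \sum_(x : 'I_p * 'I_p | x.1 != x.2) \sum_(y : 'I_p * 'I_p | y.1 != y.2)
   A x.1 x.2 * A y.1 y.2 * (B M x.1 x.2 * B M y.1 y.2).
Proof.
rewrite expr2 {1}/off mulr_suml; apply: eq_bigr => x _.
rewrite /off mulr_sumr; apply: eq_bigr => y _; ring.
Qed.

Let L1_off : L1 G (fun M => off M ^+ 2).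
Proof.
apply: (@L1_eq _ _ _ _ _ _ (fun M => esym (off_sqr M))).
by apply: L1_sum => x _; apply: L1_sum => y _; apply: L1Z; exact: L2.
Qed.

Let E_off : Ex G (fun M => off M ^+ 2) <= 2 * (\tr A) ^+ 2 / (p%:R - 1).
Proof.
rewrite (Ex_eq G off_sqr) Ex_sum; last first.
  by move=> x _; apply: L1_sum => y _; apply: L1Z; exact: L2.
apply: le_trans (_ : \sum_(x : 'I_p * 'I_p | x.1 != x.2)
   2 * A x.1 x.2 ^+ 2 / (p%:R - 1) <= _).
  apply: ler_sum => -[i j] /= ij; rewrite Ex_sum; last first.
    by move=> y _; apply: L1Z; exact: L2.
  rewrite (bigD1 (i, j))//= (bigD1 (j, i))/=; last first.
    by rewrite eq_sym ij /= xpair_eqE negb_and eq_sym ij.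
  rewrite big1 ?addr0; last first.
    move=> [k l] /= /andP[/andP[kl h1] h2]; rewrite ExZ; last exact: L2.
    by rewrite cross0 ?mulr0.
  rewrite !ExZ; try exact: L2.
  have -> : Ex G (fun M => B M i j * B M i j) = Ex G (fun M => B M i j ^+ 2).
    by apply: Ex_eq => M; rewrite expr2.
  have -> : Ex G (fun M => B M i j * B M j i) = Ex G (fun M => B M i j ^+ 2).
    by apply: Ex_eq => M; rewrite expr2 (BC M j i).
  rewrite (AC j i) (_ : _ + _ = 2 * A i j ^+ 2 * Ex G (fun M => B M i j ^+ 2)); last by ring.
  by apply: ler_wpM2l; [rewrite mulr_ge0// sqr_ge0|exact: E2_le].
rewrite -mulr_suml -mulr_sumr ler_pM2r ?invr_gt0// ler_pM2l//.
apply: le_trans trA2; rewrite pair_big /=.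
rewrite [leRHS](bigID (fun x : 'I_p * 'I_p => x.1 != x.2))/= lerDl.
by apply: sumr_ge0 => i _; exact: sqr_ge0.
Qed.

Let pn0 : p%:R != 0 :> R.
Proof. by rewrite pnatr_eq0 -lt0n (ltn_trans _ p1). Qed.

Let dg_sqr M : dg M ^+ 2 <=
  \tr A * \sum_i A i i * (p%:R^-1 * \sum_k (B M i i - B M k k) ^+ 2).
Proof.
apply: le_trans (weighted_cauchy (fun i => B M i i - \tr (B M) / p%:R) Adiag) _.
apply: ler_wpM2l; first exact: sumr_ge0.
apply: ler_sum => i _; apply: ler_wpM2l => //.
have -> : B M i i - \tr (B M) / p%:R = \sum_k p%:R^-1 * (B M i i - B M k k).
  rewrite -mulr_sumr sumrB sumr_const card_ord /mxtrace.
  by rewrite -[B M i i *+ _]mulr_natl mulrBr mulKf// [in LHS]mulrC.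
apply: le_trans (weighted_cauchy _ _) _; first by move=> k; rewrite invr_ge0.
by rewrite sumr_const card_ord -[X in X * _]mulr_natl divff// mul1r mulr_sumr.
Qed.

Let L1_dd i k : L1 G (fun M => (B M i i - B M k k) ^+ 2).
Proof.
apply: (@L1_bounded _ _ _ _ 4).
  by apply: measurable_funX; apply: measurable_funB.
move=> M; rewrite ger0_norm ?sqr_ge0//.
have := B1 M i i; have := B1 M k k; rewrite !ler_norml => /andP[? ?] /andP[? ?]; nra.
Qed.

Let m_tr : measurable_fun setT (fun M => \tr (B M)).
Proof. exact: meas_trace. Qed.

Let L1_dg : L1 G (fun M => dg M ^+ 2).
Proof.
apply: (@L1_le _ _ _ _ _ (fun M => \tr A * \sum_i A i i *
   (p%:R^-1 * \sum_k (B M i i - B M k k) ^+ 2))).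
- apply: measurable_funX; apply: meas_sum => i; apply: measurable_funM => //.
  by apply: measurable_funB => //; apply: measurable_funM.
- by move=> M; rewrite ger0_norm ?sqr_ge0//.
apply: L1Z; apply: L1_sum => i _; apply: L1Z; apply: L1Z; apply: L1_sum => k _.
exact: L1_dd.
Qed.

Let E_dg : Ex G (fun M => dg M ^+ 2) <= 4 * (\tr A) ^+ 2 / (p%:R - 1).
Proof.
have tr0 : 0 <= \tr A by exact: sumr_ge0.
have lsum i : L1 G (fun M => \sum_k (B M i i - B M k k) ^+ 2).
  by apply: L1_sum => k _; exact: L1_dd.
have l2 i : L1 G (fun M => A i i * (p%:R^-1 * \sum_k (B M i i - B M k k) ^+ 2)).
  by apply: L1Z; apply: L1Z.
apply: le_trans (Ex_le L1_dg _ dg_sqr) _; first by apply: L1Z; exact: L1_sum.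
rewrite ExZ; last exact: L1_sum.
rewrite Ex_sum// (_ : 4 * _ / _ = \tr A * (\tr A * (4 / (p%:R - 1)))); last by field; rewrite gt_eqF.
apply: ler_wpM2l => //; rewrite mulr_suml; apply: ler_sum => i _.
rewrite ExZ; last exact: L1Z.
apply: ler_wpM2l => //; rewrite ExZ// Ex_sum; last by move=> k _; exact: L1_dd.
rewrite mulrC ler_pdivrMr ?lt0r ?pn0 ?ler0n//.
have -> : 4 / (p%:R - 1) * p%:R = \sum_(k < p) 4 / (p%:R - 1) :> R.
  by rewrite sumr_const card_ord mulr_natr.
apply: ler_sum => k _; have [->|ik] := eqVneq k i.
  rewrite (_ : Ex _ _ = 0); first by rewrite divr_ge0// ltW.
  by rewrite -[RHS](@Ex_cst _ _ _ G); apply: Ex_eq => M; rewrite subrr expr0n.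
by rewrite diag_diff 1?eq_sym// ler_pM2l// E2_le// eq_sym.
Qed.

(** Isotropy: an equivariant random matrix acts on average like the multiple
    tr B / p of the identity. *)
Lemma isotropy :
  L1 G (fun M => (\tr (A *m B M) - \tr A * \tr (B M) / p%:R) ^+ 2) /\
  Ex G (fun M => (\tr (A *m B M) - \tr A * \tr (B M) / p%:R) ^+ 2)
   <= 12 * (\tr A) ^+ 2 / (p%:R - 1).
Proof.
have e M : \tr (A *m B M) - \tr A * \tr (B M) / p%:R = off M + dg M.
  have -> : \tr (A *m B M) = \sum_(x : 'I_p * 'I_p) A x.1 x.2 * B M x.1 x.2.
    rewrite -(pair_big xpredT xpredT (fun i j => A i j * B M i j))/=.
    by apply: eq_bigr => i _; rewrite mxE; apply: eq_bigr => j _; rewrite (BC M i j).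
  rewrite (bigID (fun x : 'I_p * 'I_p => x.1 != x.2))/= -/(off M) -addrA; congr (_ + _).
  rewrite (eq_bigl (fun x : 'I_p * 'I_p => x.2 == x.1)); last first.
    by move=> x; rewrite negbK eq_sym.
  rewrite -(pair_big_dep xpredT (fun i j => j == i) (fun i j => A i j * B M i j))/=.
  rewrite /dg {1}/mxtrace -mulrA mulr_suml -sumrB; apply: eq_bigr => i _.
  by rewrite big_pred1_eq mulrBr.
have le2 M : (off M + dg M) ^+ 2 <= 2 * off M ^+ 2 + 2 * dg M ^+ 2.
  have := sqr_ge0 (off M - dg M); nra.
have lS : L1 G (fun M => 2 * off M ^+ 2 + 2 * dg M ^+ 2).
  by apply: L1D; apply: L1Z.
have l : L1 G (fun M => (off M + dg M) ^+ 2).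
  apply: (L1_le _ _ lS).
    apply: measurable_funX; apply: measurable_funD; apply: meas_sum => i.
      by apply: measurable_funM.
    apply: measurable_funM => //; apply: measurable_funB => //.
    exact: measurable_funM.
  by move=> M; rewrite ger0_norm ?sqr_ge0.
have e2 : (fun M => (\tr (A *m B M) - \tr A * \tr (B M) / p%:R) ^+ 2) =
          (fun M => (off M + dg M) ^+ 2) by apply/funext => M; rewrite e.
rewrite e2; split=> //; apply: le_trans (Ex_le l lS le2) _.
rewrite ExD ?ExZ//; try exact: L1Z.
rewrite (_ : 12 * _ / _ = 2 * (2 * (\tr A) ^+ 2 / (p%:R - 1)) +
   2 * (4 * (\tr A) ^+ 2 / (p%:R - 1))); last by field; rewrite gt_eqF.
by apply: lerD; rewrite ler_pM2l.
Qed.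

End Isotropy.

(** * The Marchenko-Pastur equation for the ridge resolvent *)

Section Mix.
Context (R : realType) (n p : nat) (G : probability 'M[R]_(n, p) R).
Hypothesis hG : gauss_law G.
Local Notation Mx := 'M[R]_(n, p).

Lemma Ex_mix S (F : Mx -> R) : L1 G F ->
  L1 G (fun M => Ex G (fun M' => F (mix S M M'))) /\
  Ex G F = Ex G (fun M => Ex G (fun M' => F (mix S M M'))).
Proof.
move=> lF; have mF := L1_measurable lF.
have E := gauss_law_unique (gauss_mix S hG) hG.
have lF' : L1 (prodprob G G) (F \o (fun z => mix S z.1 z.2)).
  apply/(L1_law _ (measurable_mix S)) => //.
  by apply: L1_eq_law lF => B mB; rewrite -E.
rewrite -(Ex_eq_law _ E) Ex_law//.
apply: (@Ex_prod _ _ _ _ _ G G (fun z : Mx * Mx => F (mix S z.1 z.2))) => //.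
exact: (measurableT_comp mF (measurable_mix S)).
Qed.

End Mix.

Section RowNorm.
Context (R : realType) (n p : nat) (G : probability 'M[R]_(n, p) R).
Hypothesis hG : gauss_law G.
Local Notation Mx := 'M[R]_(n, p).
Local Notation N := (stdnormal R).

(** The fourth central moment of a squared coordinate; only its finiteness
    matters. *)
Definition kurt : R := Ex N (fun t => (t ^+ 2 - 1) ^+ 2).

Lemma L1N_sqr : L1 N (fun t => t ^+ 2 - 1).
Proof.
apply: (@L1_stdnormal_poly _ 1) => [|t].
  by apply: measurable_funB => //; exact: measurable_funX.
rewrite mul1r; apply: le_trans (_ : (1 + t ^+ 2) ^+ 1 <= _).
  by rewrite expr1 ler_norml; have := sqr_ge0 t; lra.
by rewrite ler_weXn2l// lerDl sqr_ge0.
Qed.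

Lemma L1N_kurt : L1 N (fun t => (t ^+ 2 - 1) ^+ 2).
Proof.
apply: (@L1_stdnormal_poly _ 1) => [|t].
  by apply: measurable_funX; apply: measurable_funB => //; exact: measurable_funX.
rewrite mul1r ger0_norm ?sqr_ge0//; apply: le_trans (_ : (1 + t ^+ 2) ^+ 2 <= _).
  by have := sqr_ge0 t; nra.
by rewrite ler_weXn2l// lerDl sqr_ge0.
Qed.

Lemma ExN_sqr : Ex N (fun t => t ^+ 2 - 1) = 0.
Proof.
have b1 (t : R) : `|id t| <= 1 * (1 + t ^+ 2) ^+ 3.
  rewrite mul1r; apply: le_trans (_ : (1 + t ^+ 2) ^+ 1 <= _); last first.
    by rewrite ler_weXn2l// lerDl sqr_ge0.
  have := sqr_ge0 (`|t| - 1); rewrite sqrrB real_normK ?num_real// expr1.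
  have := sqr_ge0 t; rewrite mulr1 expr1n -mulr_natr; have := normr_ge0 t; lra.
have b2 (t : R) : `|1 : R| <= 1 * (1 + t ^+ 2) ^+ 3.
  by rewrite mul1r normr1 exprn_ege1// lerDl sqr_ge0.
have [_ _ h] := @stein R 1 id (fun=> 1) (fun x => is_derive_id x 1)
  (fun=> cvg_cst _) b1 b2.
have l2 : L1 N (fun t => t ^+ 2).
  by apply: (L1_eq _ (L1D L1N_sqr (L1_cst _ 1))) => t; rewrite subrK.
rewrite ExB//; last exact: L1_cst.
rewrite Ex_cst (_ : (fun t : R => t ^+ 2) = (fun t => t * id t)); last first.
  by apply/funext => t; rewrite expr2.
by rewrite h Ex_cst subrr.
Qed.

Lemma kurt_ge0 : 0 <= kurt.
Proof. by apply: Ex_ge0 => t; exact: sqr_ge0. Qed.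

Let y i k (M : Mx) := M i k ^+ 2 - 1.

Let L1_yy i k l : L1 G (fun M => y i k M * y i l M).
Proof.
apply: (@L1_le _ _ _ _ _ (fun M => y i k M ^+ 2 + y i l M ^+ 2)).
- by apply: measurable_funM; apply: measurable_funB => //;
    apply: measurable_funX; exact: measurable_entry.
- move=> M; rewrite normrM; move: (y i k M) (y i l M) => a b.
  rewrite -[a ^+ 2]real_normK ?num_real// -[b ^+ 2]real_normK ?num_real//.
  have := sqr_ge0 (`|a| - `|b|); have := sqr_ge0 (`|a|); have := sqr_ge0 (`|b|); nra.
by apply: L1D; exact: (gauss_entry_L1 hG _ _ L1N_kurt).
Qed.

Lemma sqn_row_dev i (M : Mx) : sqn (row i M)^T - p%:R = \sum_k y i k M.
Proof.
rewrite /sqn sumrB sumr_const card_ord; congr (_ - _).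
by apply: eq_bigr => k _; rewrite !mxE.
Qed.

Lemma sqn_row_variance i :
  L1 G (fun M => (sqn (row i M)^T - p%:R) ^+ 2) /\
  Ex G (fun M => (sqn (row i M)^T - p%:R) ^+ 2) = p%:R * kurt.
Proof.
have e : (fun M => (sqn (row i M)^T - p%:R) ^+ 2) =
    (fun M => \sum_k \sum_l y i k M * y i l M).
  apply/funext => M; rewrite sqn_row_dev expr2 mulr_suml; apply: eq_bigr => k _.
  by rewrite mulr_sumr.
rewrite e; split.
  by apply: L1_sum => k _; apply: L1_sum => l _; exact: L1_yy.
rewrite Ex_sum; last by move=> k _; apply: L1_sum => l _; exact: L1_yy.
have -> : p%:R * kurt = \sum_(k < p) kurt.
  by rewrite sumr_const card_ord mulr_natl.
apply: eq_bigr => k _; rewrite Ex_sum; last by move=> l _; exact: L1_yy.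
rewrite (bigD1 k)//= big1 ?addr0.
  rewrite /kurt -(Ex_gauss_entry hG i k L1N_kurt); apply: Ex_eq => M.
  by rewrite /y expr2.
move=> l lk; have [_ ->] := Ex_set_entry i l hG (L1_yy i k l).
rewrite -[RHS](@Ex_cst _ _ _ G 0); apply: Ex_eq => M.
transitivity (Ex N (fun t => y i k M * (t ^+ 2 - 1))).
  by apply: Ex_eq => t; rewrite /y !mxE !eqxx/= [k == l]eq_sym (negbTE lk).
by rewrite ExZ ?ExN_sqr ?mulr0//; exact: L1N_sqr.
Qed.

Lemma sqn_row_moment2 i : (0 < p)%N ->
  L1 G (fun M => sqn (row i M)^T ^+ 2) /\
  Ex G (fun M => sqn (row i M)^T ^+ 2) <= 2 * (1 + kurt) * p%:R ^+ 2.
Proof.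
move=> p0; have [l1 e1] := sqn_row_variance i.
have le (M : Mx) : sqn (row i M)^T ^+ 2 <= 2 * p%:R ^+ 2 + 2 * (sqn (row i M)^T - p%:R) ^+ 2.
  by move: (sqn _) => a; have := sqr_ge0 (a - 2 * p%:R); nra.
have lS : L1 G (fun M : Mx => 2 * p%:R ^+ 2 + 2 * (sqn (row i M)^T - p%:R) ^+ 2).
  by apply: L1D; [exact: L1_cst|exact: L1Z].
have l : L1 G (fun M => sqn (row i M)^T ^+ 2).
  apply: (L1_le _ _ lS).
    apply: measurable_funX; apply: meas_sqn; apply: mxm_tr; apply: mxm_row.
    exact: mxm_id.
  by move=> M; rewrite ger0_norm ?sqr_ge0.
split=> //; apply: le_trans (Ex_le l lS le) _.
rewrite ExD ?Ex_cst ?ExZ// ?e1; [|exact: L1_cst|exact: L1Z].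
have p1 : 1 <= p%:R :> R by rewrite ler1n.
have : 0 <= kurt * (p%:R * (p%:R - 1)).
  by rewrite !mulr_ge0 ?kurt_ge0// subr_ge0.
by rewrite expr2; lra.
Qed.

End RowNorm.

(** Lipschitz dependence transfers the concentration of the leave-one-out
    forms to the summands t / (1 + t) of the trace identity. *)
Lemma frac1_lip (R : realFieldType) (t g : R) : 0 <= t -> 0 <= g ->
  `|t / (1 + t) - g / (1 + g)| <= `|t - g|.
Proof.
move=> t0 g0.
have e : t / (1 + t) - g / (1 + g) = (t - g) / ((1 + t) * (1 + g)).
  by field; rewrite !gt_eqF// ltr_wpDr.
rewrite e normrM ler_piMr// ger0_norm; last by rewrite invr_ge0 mulr_ge0 ?addr_ge0.
rewrite invf_le1; last by rewrite mulr_gt0// ltr_wpDr.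
nra.
Qed.

Section MarchenkoPastur.
Context (R : realType) (n p : nat) (G : probability 'M[R]_(n, p) R).
Hypothesis hG : gauss_law G.
Hypothesis p1 : (1 < p)%N.
Local Notation Mx := 'M[R]_(n, p).
Context (mu : R) (mu0 : 0 < mu).

Definition mp_const : R := 48 * (1 + kurt R).

Lemma mp_const_ge0 : 0 <= mp_const.
Proof. by rewrite mulr_ge0// addr_ge0// kurt_ge0. Qed.

Lemma zero_row_mul i (M : Mx) (H : 'M[R]_p) : zero_row i (M *m H) = zero_row i M *m H.
Proof.
apply/matrixP => k l; rewrite !mxE; case: eqP => ki.
  by rewrite big1// => j _; rewrite mxE ki eqxx mul0r.
by apply: eq_bigr => j _; rewrite mxE; case: eqP.
Qed.

Let K i M := ridge mu (zero_row i M : Mx).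
Let x i (M : Mx) := (row i M)^T.
Let p0 : 0 < p%:R :> R. Proof. by rewrite ltr0n ltnW. Qed.
Let pm1 : 0 < p%:R - 1 :> R. Proof. by rewrite subr_gt0 ltr1n. Qed.

Let mK i : mxm (K i).
Proof. by apply: mxm_ridge; apply: mxm_zero_row; exact: mxm_id. Qed.

Let mx i : mxm (x i).
Proof. by apply: mxm_tr; apply: mxm_row; exact: mxm_id. Qed.

Let dev i M := quad (K i M) (x i M) - sqn (x i M) * \tr (K i M) / p%:R.

Let m_dev i : measurable_fun setT (dev i).
Proof.
apply: measurable_funB; first exact: meas_quad.
apply: measurable_funM => //; apply: measurable_funM.
  exact: meas_sqn.
exact: meas_trace.
Qed.

Let trK_le i M : 0 <= \tr (K i M) / p%:R <= 1.
Proof.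
apply/andP; split; first by apply: divr_ge0; [exact: trace_ridge_ge0|exact: ltW].
by rewrite ler_pdivrMr// mul1r; exact: trace_ridge_le.
Qed.

Let dev_le i M : `|dev i M| <= sqn (x i M).
Proof.
have h1 := quad_ridge_ge0 (zero_row i M) (x i M) mu0.
have h2 := quad_ridge_le (zero_row i M) (x i M) mu0.
have /andP[h3 h4] := trK_le i M; have h5 := sqn_ge0 (x i M).
rewrite /dev -mulrA -/(K i M) ler_norml; rewrite -/(K i M) in h1 h2.
by apply/andP; split; nra.
Qed.

Let L1_dev2 i : L1 G (fun M => dev i M ^+ 2).
Proof.
apply: (@L1_le _ _ _ _ _ (fun M => sqn (x i M) ^+ 2)).
- exact: measurable_funX.
- move=> M; rewrite normrX; have := dev_le i M; have := sqn_ge0 (x i M).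
  by move=> h1 h2; rewrite ler_sqr ?nnegrE.
by have [] := sqn_row_moment2 hG i (ltnW p1).
Qed.

(** Conditionally on row i, which is independent of the other rows, isotropy
    replaces the quadratic form by a trace. *)
Let E_dev2 i : Ex G (fun M => dev i M ^+ 2) <= mp_const * p%:R.
Proof.
pose S (k : 'I_n) (l : 'I_p) := k == i.
have [l1 ->] := Ex_mix hG S (L1_dev2 i).
have inner M : Ex G (fun M' => dev i (mix S M M') ^+ 2) <=
    12 / (p%:R - 1) * sqn (x i M) ^+ 2.
  pose A := x i M *m (x i M)^T.
  have trA : \tr A = sqn (x i M).
    by rewrite mxtrace_mulC /mxtrace big_ord1 sqnE.
  have eA k l : A k l = x i M k 0 * x i M l 0.
    by rewrite /A mxE big_ord1 [(x i M)^T _ _]mxE.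
  have e M' : dev i (mix S M M') = \tr (A *m K i M') - \tr A * \tr (K i M') / p%:R.
    have ex : x i (mix S M M') = x i M.
      by apply/matrixP => a b; rewrite !mxE /S eqxx.
    have eK : K i (mix S M M') = K i M'.
      rewrite /K; congr (ridge mu _); apply/matrixP => a b; rewrite !mxE /S.
      by case: (a == i).
    rewrite /dev ex eK trA; congr (_ - _).
    by rewrite /A mxtrace_mulC mulmxA mxtrace_mulC mulmxA /mxtrace big_ord1.
  rewrite (_ : (fun M' => _) = fun M' =>
    (\tr (A *m K i M') - \tr A * \tr (K i M') / p%:R) ^+ 2); last first.
    by apply/funext => M'; rewrite e.
  have [||||||_ h] := @isotropy R n p G hG (K i) (mK i) _ _ _ A _ _ _ p1.
  - by move=> M'; exact: ridge_sym.
  - by move=> H M' hs hh; rewrite /K zero_row_mul ridge_conj.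
  - by move=> M' a; exact: ridge_row_sqr.
  - by rewrite trmx_mul trmxK.
  - by move=> a; rewrite eA -expr2 sqr_ge0.
  - by move=> a b; rewrite !eA; rewrite le_eqVlt (_ : _ == _)//; apply/eqP; ring.
  by apply: le_trans h _; rewrite trA mulrAC.
have [l2 e2] := sqn_row_moment2 hG i (ltnW p1).
apply: le_trans (Ex_le l1 (L1Z _ l2) inner) _; rewrite ExZ//.
apply: le_trans (_ : 12 / (p%:R - 1) * (2 * (1 + kurt R) * p%:R ^+ 2) <= _).
  by apply: ler_wpM2l => //; rewrite divr_ge0// ltW.
rewrite mulrAC ler_pdivrMr// /mp_const.
have : 2 <= p%:R :> R by rewrite ler_nat.
move=> p2; rewrite -subr_ge0.
have -> : 48 * (1 + kurt R) * p%:R * (p%:R - 1) - 12 * (2 * (1 + kurt R) * p%:R ^+ 2)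
  = 24 * (1 + kurt R) * p%:R * (p%:R - 2) by ring.
apply: mulr_ge0; last by rewrite subr_ge0.
by rewrite mulr_ge0// mulr_ge0// addr_ge0// kurt_ge0.
Qed.

Let c : R := Num.sqrt (mp_const * p%:R).

Let c0 : 0 < c.
Proof. by rewrite sqrtr_gt0 mulr_gt0// mulr_gt0// ltr_wpDr ?kurt_ge0. Qed.

Let E_dev i : L1 G (dev i) /\ Ex G (fun M => `|dev i M|) <= c.
Proof.
apply: (Ex_norm_le_sqr c0 (m_dev i)) => //; rewrite sqr_sqrtr; first exact: E_dev2.
by rewrite mulr_ge0 ?mp_const_ge0.
Qed.

Let E_sqn i : L1 G (fun M => sqn (x i M) - p%:R) /\
  Ex G (fun M => `|sqn (x i M) - p%:R|) <= c.
Proof.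
have [l e] := sqn_row_variance hG i.
apply: (Ex_norm_le_sqr c0).
- by apply: measurable_funB => //; exact: meas_sqn.
- exact: l.
- have -> : c ^+ 2 = mp_const * p%:R by rewrite sqr_sqrtr// mulr_ge0// mp_const_ge0.
  rewrite e mulrC ler_pM2r//.
  have := kurt_ge0 R; rewrite /mp_const; lra.
Qed.

(** With g = tr K / mu, this is the error in p - tr K = n g / (1 + g). *)
Definition mp_defect (M : Mx) : R :=
  p%:R - \tr (ridge mu M) -
  n%:R * (\tr (ridge mu M) / mu / (1 + \tr (ridge mu M) / mu)).

Lemma measurable_mp_defect : measurable_fun setT mp_defect.
Proof.
have mt : measurable_fun setT (fun M : Mx => \tr (ridge mu M)).
  by apply: meas_trace; apply: mxm_ridge; exact: mxm_id.
apply: measurable_funB; first by apply: measurable_funB.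
apply: measurable_funM => //; apply: measurable_funM.
  by apply: measurable_funM.
by apply: meas_inv; apply: measurable_funD => //; apply: measurable_funM.
Qed.

Let defect_le M : `|mp_defect M| <=
  \sum_(i < n) mu^-1 * ((`|dev i M| + `|sqn (x i M) - p%:R|) + 1).
Proof.
have mun0 : mu != 0 by rewrite gt_eqF.
have e : p%:R - \tr (ridge mu M) = \sum_i loo mu i M / (1 + loo mu i M).
  have := trace_gram_ridge M mu0.
  rewrite (eq_bigr _ (fun i _ => quad_ridge_row i M mu0)) -mulr_sumr => /mulfI -> //.
have g0 : 0 <= \tr (ridge mu M) / mu by rewrite divr_ge0 ?trace_ridge_ge0// ltW.
rewrite /mp_defect e; set g := \tr (ridge mu M) / mu.
have -> : n%:R * (g / (1 + g)) = \sum_(i < n) g / (1 + g).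
  by rewrite sumr_const card_ord mulr_natl.
rewrite -sumrB; apply: le_trans (ler_norm_sum _ _ _) _; apply: ler_sum => i _.
apply: le_trans (frac1_lip (loo_ge0 i M mu0) g0) _.
have -> : loo mu i M - g = mu^-1 * (dev i M +
    (sqn (x i M) - p%:R) * (\tr (K i M) / p%:R) +
    (\tr (K i M) - \tr (ridge mu M))).
  rewrite /loo /g /dev -/(K i M) -/(x i M); field; rewrite mun0.
  by rewrite gt_eqF.
have mui : 0 <= mu^-1 by rewrite invr_ge0 ltW.
rewrite normrM (ger0_norm mui) ler_pM2l ?invr_gt0//.
apply: le_trans (ler_normD _ _) _; apply: lerD; last first.
  by have /andP[h1 h2] := trace_zero_row i M mu0; rewrite ger0_norm.
apply: le_trans (ler_normD _ _) _; apply: lerD => //.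
by rewrite normrM ler_piMr//; have /andP[h1 h2] := trK_le i M; rewrite ger0_norm.
Qed.

(** Marchenko-Pastur equation, in mean: sum the leave-one-out identities over
    the rows. *)
Theorem mp_equation : L1 G mp_defect /\
  Ex G (fun M => `|mp_defect M|) <=
    n%:R / mu * (2 * Num.sqrt (mp_const * p%:R) + 1).
Proof.
have lr i : L1 G (fun M => mu^-1 * ((`|dev i M| + `|sqn (x i M) - p%:R|) + 1)).
  apply: L1Z; apply: L1D; last exact: L1_cst.
  by apply: L1D; apply: L1_norm; [have [] := E_dev i|have [] := E_sqn i].
have lS := L1_sum (index_enum 'I_n) (fun i (_ : xpredT i) => lr i).
have l := L1_le measurable_mp_defect defect_le lS.
split=> //; apply: le_trans (Ex_le (L1_norm l) lS defect_le) _.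
rewrite Ex_sum//.
have -> : n%:R / mu * (2 * Num.sqrt (mp_const * p%:R) + 1) =
    \sum_(i < n) mu^-1 * (2 * c + 1).
  by rewrite sumr_const card_ord -[RHS]mulr_natl mulrA.
apply: ler_sum => i _.
have [l1 h1] := E_dev i; have [l2 h2] := E_sqn i.
rewrite ExZ; last by apply: L1D; [apply: L1D; exact: L1_norm|exact: L1_cst].
rewrite ler_pM2l ?invr_gt0// ExD; [|by apply: L1D; exact: L1_norm|exact: L1_cst].
rewrite Ex_cst ExD; [|exact: L1_norm|exact: L1_norm].
by rewrite lerD2r mulr_natl mulr2n lerD.
Qed.

End MarchenkoPastur.

(** * The limiting slope and noise coefficients *)

Section ScalarEquation.
Context (R : realType) (gamma lambda m : R).
Hypothesis gamma0 : 0 < gamma.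
Hypothesis lambda0 : 0 < lambda.
Hypothesis hm : is_mn gamma lambda m.

Let m0 : 0 < m. Proof. by case: hm. Qed.
Let s := gamma * m.
Let s0 : 0 < s. Proof. exact: mulr_gt0. Qed.
Let s1 : 1 + s != 0. Proof. by rewrite gt_eqF// ltr_wpDl// ltW. Qed.

Let mn_eq : 1 + s = m * (lambda * (1 + s) + 1).
Proof. by case: hm => _ h; apply/eqP; rewrite -subr_eq0 -[X in _ == X]oppr0 -[in X in _ == X]h /s; apply/eqP; ring. Qed.

(** The limit equation reads mp_fun lambda g = gamma; its root is gamma * m. *)
Definition mp_fun (l g : R) : R := l * g + g / (1 + g).

Lemma mp_fun_mn : mp_fun lambda s = gamma.
Proof.
rewrite /mp_fun.
have h : lambda * m + m / (1 + s) = 1.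
  rewrite (_ : _ + _ = m * (lambda * (1 + s) + 1) / (1 + s)); last by field.
  by rewrite -mn_eq divff.
rewrite (_ : _ + _ = gamma * (lambda * m + m / (1 + s))); first by rewrite h mulr1.
by rewrite {1 2}/s; field.
Qed.

(** mp_fun lambda has derivative at least lambda on the half-line. *)
Lemma mp_fun_inj (g t : R) : 0 <= g -> 0 <= t ->
  lambda * `|g - t| <= `|mp_fun lambda g - mp_fun lambda t|.
Proof.
move=> g0 t0.
have e : mp_fun lambda g - mp_fun lambda t =
    (g - t) * (lambda + ((1 + g) * (1 + t))^-1).
  by rewrite /mp_fun; field; rewrite !gt_eqF// ltr_wpDr.
have h : 0 <= ((1 + g) * (1 + t))^-1 by rewrite invr_ge0 mulr_ge0// addr_ge0.
rewrite e normrM mulrC ler_wpM2l// ger0_norm ?lerDl//.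
by rewrite addr_ge0// ltW.
Qed.

Lemma mn_lt : lambda * s <= gamma.
Proof. by rewrite -mp_fun_mn /mp_fun lerDl divr_ge0 ?ltW// ltr_wpDl// ltW. Qed.

(** Divide the quadratic equation for m by m. *)
Lemma mn_denominator : lambda + 1 - gamma + gamma * lambda * m = m^-1.
Proof.
apply: (mulfI (lt0r_neq0 m0)); rewrite mulfV ?gt_eqF//.
case: hm => _ h; apply/eqP; rewrite -subr_eq0 -[X in _ == X]h; apply/eqP; ring.
Qed.

Let D := lambda + 1 - gamma + gamma * lambda * m.

Definition risk_slope : R := lambda ^+ 2 * (1 + gamma * mn1 gamma lambda m) / D ^+ 2.

(** The slope is (lambda / gamma) times minus lambda times the derivative in
    lambda of the root gamma * m, which implicit differentiation of
    mp_fun lambda (gamma * m) = gamma expresses as below. *)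
Lemma risk_slopeE : risk_slope =
  lambda / gamma * (lambda * s / (lambda + ((1 + s) * (1 + s))^-1)).
Proof.
rewrite /risk_slope /D mn_denominator /mn1.
have d0 : 1 + gamma * lambda * m ^+ 2 != 0.
  by rewrite gt_eqF// ltr_wpDr// !mulr_ge0 ?sqr_ge0 ?ltW.
have k0 : lambda * ((1 + s) * (1 + s)) + 1 != 0.
  by rewrite gt_eqF// ltr_wpDl// !mulr_ge0 ?addr_ge0 ?ltW.
have key : (1 + s) * (1 + lambda * s * m) = m * (1 + lambda * (1 + s) ^+ 2).
  rewrite {1}mn_eq; move: mn_eq; set u := 1 + s => e.
  have -> : s = u - 1 by rewrite /u; ring.
  rewrite (_ : _ * _ = m * (lambda * u + 1 + lambda * (u - 1) * (m * (lambda * u + 1)))); last by ring.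
  by rewrite -e; ring.
have -> : lambda + ((1 + s) * (1 + s))^-1 =
    (lambda * ((1 + s) * (1 + s)) + 1) / ((1 + s) * (1 + s)).
  by field.
rewrite -exprVn invrK /s.
have k1 : lambda * ((1 + gamma * m) * (1 + gamma * m)) + 1 != 0 by [].
have e1 : m * (1 + lambda * (1 + gamma * m) ^+ 2) = (1 + gamma * m) * (1 + gamma * lambda * m ^+ 2).
  by rewrite -key /s; ring.
apply: (mulIf k1); rewrite (_ : lambda * _ + 1 = 1 + lambda * (1 + gamma * m) ^+ 2); last by ring.
rewrite (_ : _ * (1 + lambda * (1 + gamma * m) ^+ 2) =
   lambda ^+ 2 * (1 + gamma * m) * m * (m * (1 + lambda * (1 + gamma * m) ^+ 2)) / (1 + gamma * lambda * m ^+ 2)); last by field.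
have hs : 1 + lambda * (1 + gamma * m) ^+ 2 != 0.
  by rewrite (_ : 1 + _ = lambda * ((1 + gamma * m) * (1 + gamma * m)) + 1)//; ring.
have s1' : 1 + gamma * m != 0 := s1.
have g1 : gamma != 0 by rewrite gt_eqF.
by rewrite e1; field; rewrite ?d0 ?hs ?g1 ?s1'.
Qed.

Lemma noise_coefE :
  gamma * ((D - lambda * (1 + gamma * mn1 gamma lambda m)) / D ^+ 2) =
  gamma / lambda * (lambda * m - risk_slope).
Proof.
have h : D = m^-1 by exact: mn_denominator.
rewrite /risk_slope h; field; rewrite !gt_eqF//.
Qed.

(** The derivative of the Stieltjes transform is recovered from two values of
    the penalty, at relative distance eta. *)
Lemma risk_slope_diffquot (eta Gam g g' d d' : R) :
  0 < eta -> 1 <= gamma -> gamma <= Gam -> 0 <= g -> 0 <= g' -> lambda * g' <= gamma ->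
  mp_fun lambda g = gamma - d -> mp_fun (lambda * (1 + eta)) g' = gamma - d' ->
  `|lambda / gamma * ((g - g') / eta) - risk_slope| <=
  eta * ((lambda + lambda^-1) * Gam / lambda) +
  (`|d| + `|d'|) * (eta^-1 + (lambda + lambda^-1) / lambda + lambda^-1 ^+ 2).
Proof.
move=> eta0 g1 gG g0 g0' lg' hg hg'.
set w := (g - g') / eta.
set k := lambda + ((1 + g) * (1 + g'))^-1.
set k0 := lambda + ((1 + s) * (1 + s))^-1.
have gp : 0 < 1 + g by rewrite ltr_wpDr.
have gp' : 0 < 1 + g' by rewrite ltr_wpDr.
have sp : 0 < 1 + s by rewrite ltr_wpDr// ltW.
have kl : lambda <= k by rewrite lerDl invr_ge0 mulr_ge0// ltW.
have k0l : lambda <= k0 by rewrite lerDl invr_ge0 mulr_ge0// ltW.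
have kp : 0 < k by exact: lt_le_trans kl.
have k0p : 0 < k0 by exact: lt_le_trans k0l.
pose w0 := lambda * s / k0.
have w00 : 0 <= w0 by rewrite divr_ge0 ?mulr_ge0 ?ltW.
have w0s : w0 <= s by rewrite ler_pdivrMr// mulrC ler_pM2l.
have e1 : w * k = lambda * g' + (d' - d) / eta.
  have -> : d' = gamma - mp_fun (lambda * (1 + eta)) g' by rewrite hg'; ring.
  have -> : d = gamma - mp_fun lambda g by rewrite hg; ring.
  by rewrite /w /k /mp_fun; field; rewrite !gt_eqF.
have e0 : w0 * k0 = lambda * s by rewrite /w0 divfK// gt_eqF.
have hgs : lambda * `|g - s| <= `|d|.
  apply: le_trans (mp_fun_inj g0 (ltW s0)) _; rewrite mp_fun_mn hg.
  by rewrite (_ : _ - _ = - d) ?normrN//; ring.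
have hgs' : lambda * `|g' - s| <= `|d'| + eta * gamma.
  apply: le_trans (mp_fun_inj g0' (ltW s0)) _; rewrite mp_fun_mn.
  have -> : mp_fun lambda g' - gamma = - d' - eta * (lambda * g').
    have -> : d' = gamma - mp_fun (lambda * (1 + eta)) g' by rewrite hg'; ring.
    by rewrite /mp_fun; ring.
  apply: le_trans (ler_normB _ _) _; rewrite normrN lerD2l normrM (gtr0_norm eta0).
  by rewrite ler_pM2l// ger0_norm// mulr_ge0// ltW.
have hk : `|k0 - k| <= `|g - s| + `|g' - s|.
  have -> : k0 - k = (g - s) / ((1 + s) * (1 + s) * (1 + g)) +
     (g' - s) / ((1 + s) * (1 + g) * (1 + g')).
    by rewrite /k0 /k; field; rewrite !gt_eqF.
  have inv1 (x y z : R) : 1 <= x -> 1 <= y -> 1 <= z -> `|(x * y * z)^-1| <= 1.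
    move=> x1 y1 z1; have h : 1 <= x * y * z.
      by rewrite -[leLHS]mulr1; apply: ler_pM => //; rewrite -[leLHS]mulr1; apply: ler_pM.
    by rewrite ger0_norm ?invr_ge0 ?(le_trans _ h)// invf_le1// (lt_le_trans _ h).
  apply: le_trans (ler_normD _ _) _; apply: lerD; rewrite normrM ler_piMr//; apply: inv1;
  by rewrite lerDl// ltW.
have e2 : w - w0 = (lambda * (g' - s) + (d' - d) / eta) / k + w0 * (k0 - k) / k.
  have -> : w = (lambda * g' + (d' - d) / eta) / k.
    by rewrite -e1 mulfK// gt_eqF.
  have -> : w0 * (k0 - k) = lambda * s - w0 * k by rewrite -e0; ring.
  by field; rewrite !gt_eqF.
have li0 : 0 < lambda^-1 by rewrite invr_gt0.
have ki : k^-1 <= lambda^-1 by rewrite lef_pV2 ?posrE.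
have ki0 : 0 <= k^-1 by rewrite invr_ge0 ltW.
have bw : `|w - w0| <= (lambda * `|g' - s| + (`|d| + `|d'|) / eta) / lambda +
    s * (`|g - s| + `|g' - s|) / lambda.
  rewrite e2; apply: le_trans (ler_normD _ _) _; apply: lerD; rewrite normrM (ger0_norm ki0).
    apply: ler_pM => //.
    apply: le_trans (ler_normD _ _) _; rewrite normrM (gtr0_norm lambda0) lerD2l.
    rewrite normrM [`|eta^-1|]ger0_norm ?invr_ge0 ?(ltW eta0)//.
    rewrite ler_pM2r ?invr_gt0// [leRHS]addrC; exact: ler_normB.
  apply: ler_pM => //; rewrite normrM (ger0_norm w00); exact: ler_pM.
have sl : s <= gamma / lambda by rewrite ler_pdivlMr// mulrC mn_lt.
have lg0 : 0 <= lambda / gamma by rewrite divr_ge0 ?ltW.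
rewrite risk_slopeE -/k0 -mulrBr -/w0 normrM (ger0_norm lg0).
apply: le_trans (_ : lambda / gamma * ((lambda * `|g' - s| + (`|d| + `|d'|) / eta) / lambda +
    gamma / lambda * (`|g - s| + `|g' - s|) / lambda) <= _).
  apply: ler_wpM2l => //; apply: le_trans bw _; rewrite lerD2l ler_pM2r// ler_wpM2r//.
have gi : gamma^-1 <= 1 by rewrite invf_le1.
have gi0 : 0 <= gamma^-1 by rewrite invr_ge0 ltW.
set x := `|g' - s| in hgs' *; set y := `|g - s| in hgs *.
set a := `|d| in hgs *; set b := `|d'| in hgs' *.
have a0 : 0 <= a by exact: normr_ge0.
have b0 : 0 <= b by exact: normr_ge0.
have x0 : 0 <= x by exact: normr_ge0.
have y0 : 0 <= y by exact: normr_ge0.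
have xl : x <= (b + eta * Gam) / lambda.
  rewrite ler_pdivlMr// mulrC; apply: le_trans hgs' _; rewrite lerD2l ler_pM2l//.
have yl : y <= a / lambda by rewrite ler_pdivlMr// mulrC.
have -> : lambda / gamma * ((lambda * x + (a + b) / eta) / lambda + gamma / lambda * (y + x) / lambda) =
   (lambda * gamma^-1 + lambda^-1) * x + gamma^-1 * ((a + b) / eta) + lambda^-1 * y.
  by field; rewrite !gt_eqF.
have ab : 0 <= (a + b) / eta by rewrite divr_ge0 ?addr_ge0// ltW.
have t1 : (lambda * gamma^-1 + lambda^-1) * x <= (lambda + lambda^-1) * ((b + eta * Gam) / lambda).
  apply: ler_pM => //; first by rewrite addr_ge0// ltW.
  by rewrite lerD2r -[leRHS]mulr1 ler_pM2l.
have t2 : gamma^-1 * ((a + b) / eta) <= (a + b) / eta by rewrite ler_piMl.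
have t3 : lambda^-1 * y <= lambda^-1 * (a / lambda) by rewrite ler_pM2l.
apply: le_trans (lerD (lerD t1 t2) t3) _.
have -> : eta * ((lambda + lambda^-1) * Gam / lambda) +
  (a + b) * (eta^-1 + (lambda + lambda^-1) / lambda + lambda^-1 ^+ 2) =
  (lambda + lambda^-1) * ((b + eta * Gam) / lambda) + (a + b) / eta + lambda^-1 * (a / lambda)
  + ((lambda + lambda^-1) / lambda * a + lambda^-1 ^+ 2 * b).
  by field; rewrite !gt_eqF.
have l0 := ltW lambda0; have l1 := ltW li0.
by rewrite lerDl; apply: addr_ge0; apply: mulr_ge0 => //; apply: divr_ge0 => //; apply: addr_ge0.
Qed.

End ScalarEquation.

(** * Stein's identity for one row *)

Section SteinRational.
Context (R : realType) (u v a b c s : R).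
Hypothesis s0 : 0 < s.
Hypothesis q0 : forall t, 0 <= a + 2 * b * t + c * t ^+ 2.
Local Notation N := (stdnormal R).

Let D t := s + (a + 2 * b * t + c * t ^+ 2).
Let f t := (u + v * t) / D t.
Let f' t := v / D t - (u + v * t) * (2 * b + 2 * c * t) / D t ^+ 2.

Let D0 t : 0 < D t.
Proof. by rewrite ltr_wpDr. Qed.

Let Ds t : (D t)^-1 <= s^-1.
Proof. by rewrite lef_pV2 ?posrE// lerDl. Qed.

Let is_derive_lin (x y t : R) : is_derive t 1 (fun t : R => x + y * t) y.
Proof.
rewrite (_ : (fun t : R => x + y * t) = cst x + (y \*: id)); last first.
  by apply/funext => z; rewrite !fctE.
by apply: is_derive_eq; rewrite add0r /GRing.scale /= mulr1.
Qed.

Let is_derive_D (t : R) : is_derive t 1 D (2 * b + 2 * c * t).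
Proof.
have hs : is_derive t 1 (fun t : R => c * t ^+ 2) (2 * c * t).
  have h := is_deriveZ c (is_deriveX 2 (is_derive_id t (1 : R))).
  rewrite (_ : (fun t : R => c * t ^+ 2) = c \*: (id ^+ 2)).
    by apply: (is_derive_eq h); rewrite /GRing.scale /= expr1; ring.
  by apply/funext => z; rewrite !fctE.
have h2 := is_deriveD (is_derive_lin (s + a) (2 * b) t) hs.
rewrite (_ : D = (fun t => (s + a) + 2 * b * t) + (fun t => c * t ^+ 2)).
  exact: h2.
by apply/funext => z; rewrite !fctE /D; ring.
Qed.

Let is_derive_f (t : R) : is_derive t 1 f (f' t).
Proof.
have h1 := is_deriveV (lt0r_neq0 (D0 t)) (is_derive_D t).
have := is_deriveM (is_derive_lin u v t) h1.
move=> h; apply: (is_derive_eq h); rewrite /f' /GRing.scale /=.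
by field; apply: lt0r_neq0 (D0 t).
Qed.

Let continuousD : continuous D.
Proof.
move=> t; apply: differentiable_continuous; apply/derivable1_diffP.
by have [] := is_derive_D t.
Qed.

Let continuous_lin (x y : R) : continuous (fun t : R => x + y * t).
Proof.
move=> t; apply: differentiable_continuous; apply/derivable1_diffP.
by have [] := is_derive_lin x y t.
Qed.

Let continuous_f' : continuous f'.
Proof.
move=> t; apply: cvgB.
  apply: cvgM; first exact: cvg_cst.
  by apply: cvgV; [rewrite gt_eqF|exact: continuousD].
apply: cvgM.
  by apply: cvgM; exact: continuous_lin.
apply: cvgV; first by rewrite expf_neq0// gt_eqF.
by rewrite expr2; apply: cvgM; exact: continuousD.
Qed.

Let lin_le (x y t : R) : `|x + y * t| <= (`|x| + `|y|) * (1 + t ^+ 2).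
Proof.
apply: le_trans (ler_normD _ _) _; rewrite normrM.
have h : `|t| <= 1 + t ^+ 2.
  have := sqr_ge0 (`|t| - 1); rewrite sqrrB real_normK ?num_real// mulr1 expr1n.
  have := sqr_ge0 t; rewrite -mulr_natr; lra.
have h1 : 1 <= 1 + t ^+ 2 by rewrite lerDl sqr_ge0.
have := normr_ge0 x; have := normr_ge0 y; have := normr_ge0 t.
rewrite mulrDl; move=> ? ? ?; apply: lerD; first by rewrite ler_peMr.
by rewrite ler_wpM2l.
Qed.

Let C := `|v| / s + (`|u| + `|v|) * (`|2 * b| + `|2 * c|) / s ^+ 2 + (`|u| + `|v|) / s.

Let growth_le (x t : R) (k : nat) : (k <= 3)%N -> 0 <= x ->
  x * (1 + t ^+ 2) ^+ k <= x * (1 + t ^+ 2) ^+ 3.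
Proof. by move=> k3 x0; rewrite ler_wpM2l// ler_weXn2l// lerDl sqr_ge0. Qed.

Let Dn t : `|(D t)^-1| <= s^-1.
Proof. by rewrite ger0_norm// invr_ge0 ltW. Qed.

Let si0 : 0 <= s^-1. Proof. by rewrite invr_ge0 ltW. Qed.

Let c1 : 0 <= `|v| / s. Proof. by rewrite divr_ge0// ltW. Qed.
Let c2 : 0 <= (`|u| + `|v|) * (`|2 * b| + `|2 * c|) / s ^+ 2.
Proof. by apply: divr_ge0; [rewrite mulr_ge0 ?addr_ge0|exact: exprn_ge0 (ltW s0)]. Qed.
Let c3 : 0 <= (`|u| + `|v|) / s. Proof. by apply: divr_ge0; [rewrite addr_ge0|exact: ltW]. Qed.

Let f_le t : `|f t| <= C * (1 + t ^+ 2) ^+ 3.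
Proof.
apply: le_trans (_ : (`|u| + `|v|) / s * (1 + t ^+ 2) ^+ 1 <= _).
  rewrite /f normrM expr1 mulrAC; exact: ler_pM.
apply: le_trans (growth_le t (isT : (1 <= 3)%N) c3) _.
apply: ler_wpM2r; first by rewrite exprn_ge0// addr_ge0 ?sqr_ge0.
by rewrite /C lerDr addr_ge0.
Qed.

Let f'_le t : `|f' t| <= C * (1 + t ^+ 2) ^+ 3.
Proof.
have t0 : 0 <= 1 + t ^+ 2 by rewrite addr_ge0 ?sqr_ge0.
apply: le_trans (_ : `|v| / s * (1 + t ^+ 2) ^+ 0 +
   (`|u| + `|v|) * (`|2 * b| + `|2 * c|) / s ^+ 2 * (1 + t ^+ 2) ^+ 2 <= _).
  rewrite /f'; apply: le_trans (ler_normB _ _) _; apply: lerD.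
    by rewrite normrM expr0 mulr1; apply: ler_pM.
  rewrite (_ : _ / D t ^+ 2 = (u + v * t) * (2 * b + 2 * c * t) * ((D t)^-1 * (D t)^-1)); last first.
    by rewrite expr2 invfM.
  rewrite (_ : _ / s ^+ 2 * (1 + t ^+ 2) ^+ 2 = ((`|u| + `|v|) * (1 + t ^+ 2)) *
     ((`|2 * b| + `|2 * c|) * (1 + t ^+ 2)) * (s^-1 * s^-1)); last first.
    by rewrite expr2 invfM expr2; ring.
  rewrite normrM; apply: ler_pM => //.
    by rewrite normrM; apply: ler_pM => //; exact: lin_le.
  by rewrite normrM; apply: ler_pM.
apply: le_trans (lerD (growth_le t (isT : (0 <= 3)%N) c1) (growth_le t (isT : (2 <= 3)%N) c2)) _.
rewrite -mulrDl; apply: ler_wpM2r; first exact: exprn_ge0.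
by rewrite /C lerDl.
Qed.

(** Along a single coordinate t, the numerator of a resolvent quotient is
    affine and its denominator is a positive quadratic polynomial. *)
Lemma stein_rational :
  [/\ L1 N (fun t => t * ((u + v * t) / (s + (a + 2 * b * t + c * t ^+ 2)))),
      L1 N (fun t => v / (s + (a + 2 * b * t + c * t ^+ 2)) -
         (u + v * t) * (2 * b + 2 * c * t) / (s + (a + 2 * b * t + c * t ^+ 2)) ^+ 2) &
      Ex N (fun t => t * ((u + v * t) / (s + (a + 2 * b * t + c * t ^+ 2)))) =
      Ex N (fun t => v / (s + (a + 2 * b * t + c * t ^+ 2)) -
         (u + v * t) * (2 * b + 2 * c * t) / (s + (a + 2 * b * t + c * t ^+ 2)) ^+ 2)].
Proof. exact: (stein is_derive_f continuous_f' f_le f'_le). Qed.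

End SteinRational.

Lemma quad_addv (R : realFieldType) p (A : 'M[R]_p) v w : A^T = A ->
  quad A (v + w) = quad A v + 2 * (w^T *m (A *m v)) 0 0 + quad A w.
Proof.
move=> As; have e : v^T *m A *m w = (w^T *m (A *m v))^T.
  by rewrite !trmx_mul trmxK As.
have et : (v + w)^T = v^T + w^T by rewrite linearD.
have m4 (a b c d : 'M[R]_1) : (a + b + (c + d)) 0 0 = a 0 0 + b 0 0 + (c 0 0 + d 0 0).
  by rewrite !mxE.
have m1 (a : 'M[R]_1) : a^T 0 0 = a 0 0 by rewrite mxE.
rewrite /quad et !mulmxDl !mulmxDr m4 e m1 [w^T *m (A *m v)]mulmxA; ring.
Qed.

Lemma mul_scale_delta (R : realFieldType) p (A : 'M[R]_p) j i t :
  (A *m (t *: delta_mx j 0) : 'cV[R]_p) i 0 = t * A i j.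
Proof. by rewrite -scalemxAr -colE !mxE. Qed.

Lemma quad_add_delta (R : realFieldType) p (A : 'M[R]_p) v t j : A^T = A ->
  quad A (v + t *: delta_mx j 0) =
  quad A v + 2 * (A *m v) j 0 * t + A j j * t ^+ 2.
Proof.
move=> As; rewrite quad_addv//.
have d (u : 'cV[R]_p) : ((t *: delta_mx j 0 : 'cV_p)^T *m u) 0 0 = t * u j 0.
  by rewrite linearZ /= -scalemxAl mxE trmx_delta -rowE mxE.
have -> : quad A (t *: delta_mx j 0) = t ^+ 2 * A j j.
  by rewrite /quad -mulmxA d mul_scale_delta expr2 mulrA.
by rewrite d; ring.
Qed.

Section RowStein.
Context (R : realType) (n p : nat) (G : probability 'M[R]_(n, p) R).
Hypothesis hG : gauss_law G.
Local Notation Mx := 'M[R]_(n, p).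
Context (s : R) (s0 : 0 < s) (i : 'I_n).
Local Notation N := (stdnormal R).

Let K (M : Mx) := ridge s (zero_row i M).
Let x (M : Mx) := (row i M)^T.
Let q M := quad (K M) (x M).

Context (A : Mx -> 'M[R]_p).
Hypothesis mA : mxm A.
Hypothesis A_entry : forall j t M, A (set_entry i j t M) = A M.
Hypothesis A1 : forall M k l, `|A M k l| <= 1.

Let mK : mxm K.
Proof. by apply: mxm_ridge; apply: mxm_zero_row; exact: mxm_id. Qed.
Let mx : mxm x.
Proof. by apply: mxm_tr; apply: mxm_row; exact: mxm_id. Qed.
Let mq : measurable_fun setT q. Proof. exact: meas_quad. Qed.
Let mAx : mxm (fun M => A M *m x M). Proof. exact: mxm_mul. Qed.
Let mKx : mxm (fun M => K M *m x M). Proof. exact: mxm_mul. Qed.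
Let q_ge0 M : 0 <= q M. Proof. exact: quad_ridge_ge0. Qed.
Let mDi : measurable_fun setT (fun M => (s + q M)^-1).
Proof. by apply: meas_inv; apply: measurable_funD. Qed.

Let K_entry j t M : K (set_entry i j t M) = K M.
Proof.
rewrite /K; congr (ridge s _); apply/matrixP => a b; rewrite !mxE.
by case: (a == i).
Qed.

Let x_entry j t M : x (set_entry i j t M) = x (set_entry i j 0 M) + t *: delta_mx j 0.
Proof.
apply/matrixP => a b; rewrite !mxE !eqxx /= ord1 eqxx andbT.
by case: eqP => _ /=; [rewrite mulr1 add0r|rewrite mulr0 addr0].
Qed.

Let Dinv_le M : (s + q M)^-1 <= s^-1.
Proof. by rewrite lef_pV2 ?posrE ?lerDl// ltr_wpDr. Qed.

Let Dinv_ge0 M : 0 <= (s + q M)^-1.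
Proof. by rewrite invr_ge0 addr_ge0// ltW. Qed.

Let mulx_le (B : 'M[R]_p) M j : (forall k l, `|B k l| <= 1) ->
  `|(B *m x M) j 0| <= \sum_k `|M i k|.
Proof.
move=> B1; rewrite mxE; apply: le_trans (ler_norm_sum _ _ _) _.
apply: ler_sum => k _; rewrite normrM !mxE ler_piMl//.
Qed.

Let K1 M k l : `|K M k l| <= 1. Proof. exact: ridge_entry_le1. Qed.

Let sum_le (M : Mx) j : `|M i j| * \sum_k `|M i k| <= p%:R * gauss_dom M.
Proof.
rewrite mulr_sumr; apply: le_trans (_ : \sum_(k < p) gauss_dom M <= _).
  by apply: ler_sum => k _; rewrite -normrM; exact: prod_le_gauss_dom.
by rewrite sumr_const card_ord mulr_natl.
Qed.

Let sum2_le (M : Mx) : (\sum_k `|M i k|) * (\sum_k `|M i k|) <= p%:R * p%:R * gauss_dom M.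
Proof.
rewrite mulr_suml; apply: le_trans (_ : \sum_(k < p) p%:R * gauss_dom M <= _).
  by apply: ler_sum => k _; exact: sum_le.
by rewrite sumr_const card_ord -mulrA [leRHS]mulr_natl.
Qed.

Let F j (M : Mx) := M i j * ((A M *m x M) j 0 / (s + q M)).
Let dF j (M : Mx) := A M j j / (s + q M) -
   2 * ((A M *m x M) j 0 * (K M *m x M) j 0) / (s + q M) ^+ 2.

Let L1F j : L1 G (F j).
Proof.
apply: (@gauss_L1_dom _ _ _ G hG (p%:R / s)).
  by apply: measurable_funM; [exact: measurable_entry|apply: measurable_funM].
move=> M; rewrite /F !normrM (ger0_norm (Dinv_ge0 M)) mulrA [leRHS]mulrAC.
apply: ler_pM => //.
by apply: le_trans (sum_le M j); apply: ler_wpM2l => //; exact: mulx_le.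
Qed.

Let L1dF j : L1 G (dF j).
Proof.
apply: (@gauss_L1_dom _ _ _ G hG (s^-1 + 2 * (p%:R * p%:R) * (s^-1 * s^-1))).
  apply: measurable_funB; first exact: measurable_funM.
  apply: measurable_funM.
    by apply: measurable_funM => //; apply: measurable_funM.
  apply: (meas_eq (f := fun M => (s + q M)^-1 ^+ 2)); first by move=> M; rewrite exprVn.
  exact: measurable_funX.
move=> M; rewrite /dF; apply: le_trans (ler_normB _ _) _; rewrite [leRHS]mulrDl.
have si : 0 <= s^-1 by rewrite invr_ge0 ltW.
apply: lerD.
  rewrite normrM (ger0_norm (Dinv_ge0 M)); apply: le_trans (_ : 1 * s^-1 <= _).
    by apply: ler_pM => //; exact: A1.
  by rewrite mul1r ler_peMr// gauss_dom_ge1.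
rewrite expr2 invfM !normrM (ger0_norm (Dinv_ge0 M)) normr_nat [leRHS]mulrAC.
apply: ler_pM; [by rewrite !mulr_ge0|exact: mulr_ge0| |exact: ler_pM].
rewrite -!mulrA; apply: ler_wpM2l => //.
apply: le_trans (_ : (\sum_k `|M i k|) * (\sum_k `|M i k|) <= _).
  by apply: ler_pM => //; apply: mulx_le => *; [exact: A1|exact: K1].
by rewrite mulrA; exact: sum2_le.
Qed.

Let F_entry j M t : F j (set_entry i j t M) =
  t * (((A M *m x (set_entry i j 0 M)) j 0 + A M j j * t) /
       (s + (quad (K M) (x (set_entry i j 0 M)) +
         2 * (K M *m x (set_entry i j 0 M)) j 0 * t + K M j j * t ^+ 2))).
Proof.
rewrite /F /q K_entry A_entry x_entry quad_add_delta; last exact: ridge_sym.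
have e : (A M *m (x (set_entry i j 0 M) + t *: delta_mx j 0)) j 0 =
    (A M *m x (set_entry i j 0 M)) j 0 + A M j j * t.
  by rewrite mulmxDr [LHS]mxE mul_scale_delta [t * _]mulrC.
by rewrite e {1}/set_entry mxE !eqxx.
Qed.

Let dF_entry j M t : dF j (set_entry i j t M) =
  A M j j / (s + (quad (K M) (x (set_entry i j 0 M)) +
         2 * (K M *m x (set_entry i j 0 M)) j 0 * t + K M j j * t ^+ 2)) -
  ((A M *m x (set_entry i j 0 M)) j 0 + A M j j * t) *
  (2 * (K M *m x (set_entry i j 0 M)) j 0 + 2 * K M j j * t) /
  (s + (quad (K M) (x (set_entry i j 0 M)) +
         2 * (K M *m x (set_entry i j 0 M)) j 0 * t + K M j j * t ^+ 2)) ^+ 2.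
Proof.
rewrite /dF /q K_entry A_entry x_entry quad_add_delta; last exact: ridge_sym.
have e (B : 'M[R]_p) : (B *m (x (set_entry i j 0 M) + t *: delta_mx j 0)) j 0 =
    (B *m x (set_entry i j 0 M)) j 0 + B j j * t.
  by rewrite mulmxDr [LHS]mxE mul_scale_delta [t * _]mulrC.
rewrite !e; congr (_ - _ / _); ring.
Qed.

Let Ex_entry j : Ex G (F j) = Ex G (dF j).
Proof.
have [_ ->] := Ex_set_entry i j hG (L1F j).
have [_ ->] := Ex_set_entry i j hG (L1dF j).
apply: Ex_eq => M.
rewrite (Ex_eq _ (F_entry j M)) (Ex_eq _ (dF_entry j M)).
have q0 t : 0 <= quad (K M) (x (set_entry i j 0 M)) +
    2 * (K M *m x (set_entry i j 0 M)) j 0 * t + K M j j * t ^+ 2.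
  by rewrite -quad_add_delta ?ridge_sym// quad_ridge_ge0.
by have [_ _ ->] := stein_rational ((A M *m x (set_entry i j 0 M)) j 0) (A M j j) s0 q0.
Qed.

(** Sum the one-dimensional identity over the coordinates of row i; the matrix
    A may depend on the other rows only. *)
Lemma row_stein :
  [/\ L1 G (fun M => quad (A M) (x M) / (s + q M)),
      L1 G (fun M => \tr (A M) / (s + q M) -
        2 * ((A M *m x M)^T *m (K M *m x M)) 0 0 / (s + q M) ^+ 2) &
      Ex G (fun M => quad (A M) (x M) / (s + q M)) =
      Ex G (fun M => \tr (A M) / (s + q M) -
        2 * ((A M *m x M)^T *m (K M *m x M)) 0 0 / (s + q M) ^+ 2)].
Proof.
have e1 M : \sum_j F j M = quad (A M) (x M) / (s + q M).
  rewrite /quad -mulmxA [in RHS]mxE mulr_suml; apply: eq_bigr => j _.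
  have -> : (x M)^T 0 j = M i j by rewrite !mxE.
  by rewrite /F mulrA.
have e2 M : \sum_j dF j M = \tr (A M) / (s + q M) -
        2 * ((A M *m x M)^T *m (K M *m x M)) 0 0 / (s + q M) ^+ 2.
  rewrite sumrB -mulr_suml; congr (_ - _).
  rewrite [X in 2 * X]mxE mulr_sumr mulr_suml; apply: eq_bigr => j _.
  have -> : (A M *m x M)^T 0 j = (A M *m x M) j 0 by rewrite mxE.
  by [].
have l1 : L1 G (fun M => \sum_j F j M) by apply: L1_sum => j _; exact: L1F.
have l2 : L1 G (fun M => \sum_j dF j M) by apply: L1_sum => j _; exact: L1dF.
split; [exact: L1_eq l1|exact: L1_eq l2|].
rewrite -(Ex_eq _ e1) -(Ex_eq _ e2) !Ex_sum//.
by apply: eq_bigr => j _; exact: Ex_entry.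
Qed.

End RowStein.

(** * The resolvent of the dual Gram matrix *)

Section GramInverse.
Context (R : realFieldType) (n p : nat).
Implicit Types (M : 'M[R]_(n, p)) (s : R).

(** (M M^T + s)^-1, expressed through the resolvent of the transpose. *)
Definition gram_inv s M : 'M[R]_n := s^-1 *: ridge s M^T.

Lemma gram_inv_sym s M : (gram_inv s M)^T = gram_inv s M.
Proof. by rewrite linearZ /= ridge_sym. Qed.

Lemma gram_inv_mul s M : 0 < s -> (M *m M^T + s%:M) *m gram_inv s M = 1%:M.
Proof.
move=> s0; rewrite /gram_inv -scalemxAr -{1}[M]trmxK ridge_mul//.
by rewrite scale_scalar_mx mulVf// gt_eqF.
Qed.

Lemma gram_inv_unique s M (B : 'M[R]_n) : 0 < s ->
  (M *m M^T + s%:M) *m B = 1%:M -> B = gram_inv s M.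
Proof.
move=> s0 h.
have u : M *m M^T + s%:M \in unitmx.
  by have := ridge_unit (M^T) s0; rewrite trmxK.
by rewrite -[LHS](mulKmx u) h -[RHS](mulKmx u) gram_inv_mul.
Qed.

Lemma gram_inv_mulr s M : 0 < s -> gram_inv s M *m (M *m M^T) = 1%:M - s *: gram_inv s M.
Proof.
move=> s0; have := congr1 (@trmx _ _ _) (gram_inv_mul M s0).
rewrite trmx_mul gram_inv_sym linearD /= tr_scalar_mx trmx1 trmx_mul trmxK.
by rewrite mulmxDr mul_mx_scalar => <-; rewrite addrK.
Qed.

Lemma quad_gram_inv_ge0 s M v : 0 < s -> 0 <= quad (gram_inv s M) v.
Proof.
by move=> s0; rewrite quadZ mulr_ge0 ?quad_ridge_ge0// invr_ge0 ltW.
Qed.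

Lemma gram_inv_entry_le s M i j : 0 < s -> `|gram_inv s M i j| <= s^-1.
Proof.
move=> s0; have si : 0 <= s^-1 by rewrite invr_ge0 ltW.
by rewrite mxE normrM ger0_norm// ler_piMr// ridge_entry_le1.
Qed.

(** By the push-through identity the n by n resolvent is
    1 - s^-1 M K M^T, whose diagonal is known from Sherman-Morrison. *)
Lemma ridge_tr_diag s M i : 0 < s -> ridge s M^T i i = (1 + loo s i M)^-1.
Proof.
move=> s0; have sn : s != 0 by rewrite gt_eqF.
have <- : 1%:M - s^-1 *: (M *m ridge s M *m M^T) = ridge s M^T.
  apply: ridge_unique => //; rewrite trmxK mulmxBr mulmx1 -scalemxAr.
  have -> : (M *m M^T + s%:M) *m (M *m ridge s M *m M^T) =
     M *m ((M^T *m M + s%:M) *m ridge s M) *m M^T.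
    by rewrite !mulmxDl !mulmxDr !mulmxDl mul_scalar_mx mul_scalar_mx -scalemxAr -scalemxAl !mulmxA.
  rewrite ridge_mul// mul_mx_scalar -scalemxAl scalerA mulVf// scale1r.
  by rewrite addrAC subrr add0r.
have e : (M *m ridge s M *m M^T) i i = quad (ridge s M) (row i M)^T.
  rewrite /quad trmxK -row_mul [LHS]mxE [RHS]mxE; apply: eq_bigr => j _.
  by rewrite [row i _ 0 j]mxE [(row i M)^T j 0]mxE [row i M 0 j]mxE [M^T j i]mxE.
have hb (A B : 'M[R]_n) c : (A - c *: B) i i = A i i - c * B i i by rewrite !mxE.
rewrite hb e mxE eqxx quad_ridge_row//= mulr1n mulKf//.
have := loo_ge0 i M s0; move=> t0.
by field; rewrite gt_eqF// ltr_wpDr.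
Qed.

Lemma gram_inv_diag s M i : 0 < s ->
  gram_inv s M i i = (s + quad (ridge s (zero_row i M)) (row i M)^T)^-1.
Proof.
move=> s0; rewrite mxE ridge_tr_diag// -invfM; congr (_^-1).
by rewrite /loo mulrDr mulr1 [_ / s]mulrC mulrA mulfV ?mul1r// gt_eqF.
Qed.

Lemma gram_inv_conj s M (H : 'M[R]_n) : 0 < s -> H^T = H -> H *m H = 1%:M ->
  gram_inv s (H *m M) = H *m gram_inv s M *m H.
Proof.
move=> s0 hs hh; rewrite /gram_inv trmx_mul hs ridge_conj// -scalemxAr.
by rewrite -scalemxAl.
Qed.

Lemma gram_inv_orth s M (H : 'M[R]_p) : 0 < s -> H^T = H -> H *m H = 1%:M ->
  gram_inv s (M *m H) = gram_inv s M.
Proof.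
move=> s0 hs hh; symmetry; apply: gram_inv_unique => //.
by rewrite trmx_mul hs mulmxA -[M *m H *m H]mulmxA hh mulmx1 gram_inv_mul.
Qed.

(** The complementary trace is a sum of n terms t / (1 + t). *)
Lemma trace_ridge_ge s M : 0 < s -> p%:R - n%:R <= \tr (ridge s M).
Proof.
move=> s0; have h := trace_gram_ridge M s0.
have : \sum_i quad (ridge s M) (row i M)^T <= \sum_(i < n) s.
  apply: ler_sum => i _; rewrite quad_ridge_row// ler_piMr ?(ltW s0)//.
  have t0 := loo_ge0 i M s0.
  by rewrite ler_pdivrMr ?ltr_wpDr// mul1r lerDr.
rewrite h sumr_const card_ord -[s *+ n]mulr_natr ler_pM2l//; lra.
Qed.

(** The unregularised inverse exceeds the regularised one by at most a
    multiple of the penalty. *)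
Lemma gram_inv_limit s M v : 0 < s -> M *m M^T \in unitmx ->
  quad (invmx (M *m M^T)) v <=
  quad (gram_inv s M) v + s * sqn (invmx (M *m M^T) *m v).
Proof.
move=> s0 u; set S := M *m M^T; set A := invmx S; set B := gram_inv s M.
have As : A^T = A by apply: sym_invmx; rewrite trmx_mul trmxK.
have Bs : B^T = B by exact: gram_inv_sym.
have e1 : A - B = s *: (A *m B).
  have h : A *m (S + s%:M) *m B = A by rewrite -mulmxA gram_inv_mul// mulmx1.
  by rewrite -{1}h mulmxDr mulVmx// mul_mx_scalar mulmxDl mul1mx addrAC subrr add0r scalemxAl.
have e2 : A *m B = B *m A.
  have t1 : (A - B)^T = A - B by rewrite linearB /= As Bs.
  have t2 (C : 'M[R]_n) : (s *: C)^T = s *: C^T by rewrite linearZ.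
  have t3 : (A *m B)^T = B *m A by rewrite trmx_mul As Bs.
  by apply: (scalerI (lt0r_neq0 s0)); rewrite -e1 -t3 -t2 -e1 t1.
have e3 : A - B = s *: (A *m A) - s ^+ 2 *: (A *m B *m A).
  have eB : B = A - s *: (B *m A) by rewrite -e2 -e1 subKr.
  rewrite e1 {1}eB.
  by rewrite mulmxBr scalerBr -scalemxAr scalerA -expr2 mulmxA.
have q1 : quad (A *m A) v = sqn (A *m v).
  by rewrite -sqnE trmx_mul As /quad !mulmxA.
have q2 : quad (A *m B *m A) v = quad B (A *m v).
  by rewrite /quad trmx_mul As !mulmxA.
have := quad_gram_inv_ge0 M (A *m v) s0; rewrite -/B.
have : quad A v - quad B v = s * sqn (A *m v) - s ^+ 2 * quad B (A *m v).
  by have := congr1 (fun X => quad X v) e3; rewrite /= !quadB (quadZ s) (quadZ (s ^+ 2)) q1 q2.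
have : 0 < s ^+ 2 by rewrite exprn_gt0.
nra.
Qed.

(** A kernel vector of M M^T is fixed by K = s (M M^T + s)^-1.  Comparing K
    with the projection Q onto it in Frobenius norm gives
    tr K >= tr K^2 >= 1. *)
Lemma gram_inv_singular s M : 0 < s -> M *m M^T \notin unitmx ->
  s^-1 <= \tr (gram_inv s M).
Proof.
move=> s0 u.
have [v v0 Sv] : exists2 v : 'cV[R]_n, v != 0 & M *m M^T *m v = 0.
  apply/not_exists2P => h; move/negP: u; apply; apply: inj_unitmx => v Sv.
  by have [/negP|//] := h v; rewrite negbK => /eqP.
set K := ridge s M^T.
have Kv : K *m v = v.
  have h : (M *m M^T + s%:M) *m v = s *: v by rewrite mulmxDl Sv add0r mul_scalar_mx.
  rewrite -{1}[M]trmxK in h; have := ridge_solve s0 h.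
  by rewrite -scalemxAr scalerA mulVf ?gt_eqF// scale1r.
have q0 : 0 < sqn v.
  rewrite lt_def sqn_ge0 andbT; apply: contra v0 => /eqP /sqn_eq0 ->//.
pose Q := (sqn v)^-1 *: (v *m v^T).
have KQ : K *m Q = Q by rewrite /Q -scalemxAr mulmxA Kv.
have QQ : Q *m Q = Q.
  rewrite /Q -scalemxAl -scalemxAr mulmxA -[v *m v^T *m v]mulmxA [v^T *m v]mx11_scalar.
  by rewrite sqnE mul_mx_scalar -scalemxAl scalerA mulVf ?scale1r// gt_eqF.
have Qs : Q^T = Q by rewrite linearZ /= trmx_mul trmxK.
have trQ : \tr Q = 1.
  by rewrite /Q mxtraceZ mxtrace_mulC [v^T *m v]mx11_scalar mxtrace_scalar sqnE mulr1n mulVf// gt_eqF.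
have h0 : 0 <= \tr ((K - Q)^T *m (K - Q)).
  by rewrite frob_trace; apply: sumr_ge0 => i _; apply: sumr_ge0 => j _; exact: sqr_ge0.
have QK : Q *m K = Q by have := congr1 (@trmx _ _ _) KQ; rewrite trmx_mul Qs ridge_sym.
have KQs : (K - Q)^T = K - Q by rewrite linearB /= ridge_sym Qs.
rewrite KQs mulmxBl !mulmxBr KQ QK QQ subrr subr0 linearB /= trQ in h0.
have h1 : \tr (K *m K) <= \tr K.
  apply: ler_sum => i _; have := sqn_ridge (M^T) (delta_mx i 0) s0.
  by rewrite quad_delta -quad_ridge2 quad_delta.
have si : 0 <= s^-1 by rewrite invr_ge0 ltW.
rewrite /gram_inv mxtraceZ ler_peMr// -/K; lra.
Qed.

End GramInverse.

(** * Moments of the regularised pooled estimator *)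

Definition selector (R : nzRingType) n (D : {set 'I_n}) : 'M[R]_n :=
  diag_mx (\row_i (i \in D)%:R).

Section PooledMoments.
Context (R : realType) (n p : nat) (G : probability 'M[R]_(n, p) R).
Hypothesis hG : gauss_law G.
Local Notation Mx := 'M[R]_(n, p).
Hypothesis np : (n + 2 < p)%N.
Context (s : R) (s0 : 0 < s).

Let K i (M : Mx) := ridge s (zero_row i M).
Let x i (M : Mx) := (row i M)^T.
Let Di i (M : Mx) := (s + quad (K i M) (x i M))^-1.

Let mK i : mxm (K i).
Proof. by apply: mxm_ridge; apply: mxm_zero_row; exact: mxm_id. Qed.
Let mx i : mxm (x i).
Proof. by apply: mxm_tr; apply: mxm_row; exact: mxm_id. Qed.
Let q_ge0 i M : 0 <= quad (K i M) (x i M). Proof. exact: quad_ridge_ge0. Qed.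
Let mDi i : measurable_fun setT (Di i).
Proof. by apply: meas_inv; apply: measurable_funD => //; exact: meas_quad. Qed.
Let sq_gt0 i M : 0 < s + quad (K i M) (x i M). Proof. by rewrite ltr_wpDr. Qed.
Let Di_gt0 i M : 0 < Di i M. Proof. by rewrite invr_gt0. Qed.
Let Di_le i M : Di i M <= s^-1.
Proof. by rewrite lef_pV2 ?posrE// lerDl. Qed.
Let L1Di i : L1 G (Di i).
Proof.
by apply: (@L1_bounded _ _ _ G s^-1) => // M; rewrite ger0_norm// ltW.
Qed.

Let K_entry i j t M : K i (set_entry i j t M) = K i M.
Proof.
rewrite /K; congr (ridge s _); apply/matrixP => a b; rewrite !mxE.
by case: (a == i).
Qed.

Let pn : 0 < (p%:R - n%:R - 2 : R).
Proof. by move: np; rewrite -(ltr_nat R) natrD; lra. Qed.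

(** Stein's identity with A = K: the left side is the mean of q / (s + q) <= 1,
    and on the right tr K >= p - n while |K x|^2 <= q costs at most 2. *)
Let inverse_moment i : Ex G (Di i) <= (p%:R - n%:R - 2)^-1.
Proof.
have [l1 l2 e] := row_stein hG s0 (i := i) (mK i) (fun j t M => K_entry i j t M)
  (fun M k l => ridge_entry_le1 _ k l s0).
rewrite -[leRHS]mul1r ler_pdivlMr// mulrC -ExZ//.
apply: le_trans (_ : Ex G (fun M => quad (K i M) (x i M) / (s + quad (K i M) (x i M))) <= _); last first.
  rewrite -[leRHS](Ex_cst G); apply: Ex_le => //; first exact: L1_cst.
  by move=> M; rewrite ler_pdivrMr// mul1r lerDr ltW.
rewrite e; apply: Ex_le => //; first exact: L1Z.
move=> M.
have h1 : ((K i M *m x i M)^T *m (K i M *m x i M)) 0 0 <= quad (K i M) (x i M).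
  by rewrite sqnE; exact: sqn_ridge.
have h2 := trace_ridge_ge (zero_row i M) s0; rewrite -/(K i M) in h2.
have h3 : ((K i M *m x i M)^T *m (K i M *m x i M)) 0 0 * Di i M <= 1.
  by rewrite ler_pdivrMr// mul1r; apply: le_trans h1 _; rewrite lerDr ltW.
have d0 := Di_gt0 i M.
rewrite -/(K i M) -/(x i M) expr2 invfM -/(Di i M).
move: h2 h3 d0; move: (\tr _) (_ 0 0) (Di i M) => t a D; nra.
Qed.

(** Stein's identity with A = 1; the subtracted term is nonnegative. *)
Let row_moment i : L1 G (fun M => sqn (x i M) * Di i M) /\
  Ex G (fun M => sqn (x i M) * Di i M) <= p%:R / (p%:R - n%:R - 2).
Proof.
have one_le (M : Mx) (k l : 'I_p) : `|(1%:M : 'M[R]_p) k l| <= 1.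
  by rewrite mxE normr_nat; case: (k == l).
have [l1 l2 e] := row_stein hG s0 (i := i) (mxm_cst 1%:M) (fun j t M => erefl) one_le.
have q1 M : quad 1%:M (x i M) * Di i M = sqn (x i M) * Di i M.
  by rewrite quad_scalar mul1r.
split; first exact: (L1_eq q1 l1).
rewrite -(Ex_eq _ q1) [leLHS]e.
apply: le_trans (_ : Ex G (fun M => p%:R * Di i M) <= _); last first.
  by rewrite ExZ// ler_wpM2l// inverse_moment.
apply: Ex_le => //; first exact: L1Z.
move=> M; rewrite mxtrace1 mul1mx lerBlDr lerDl.
have -> : ((row i M)^T^T *m (ridge s (zero_row i M) *m (row i M)^T)) 0 0 =
  quad (K i M) (x i M) by rewrite mulmxA.
by apply: divr_ge0; [rewrite mulr_ge0|rewrite exprn_ge0// ltW// sq_gt0].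
Qed.

Local Notation GI := (gram_inv s).
Let S (M : Mx) := M *m M^T.

Let Di_diag i M : Di i M = GI M i i.
Proof. by rewrite gram_inv_diag. Qed.

Let S_diag i M : S M i i = sqn (x i M).
Proof. by rewrite mxE; apply: eq_bigr => j _; rewrite !mxE expr2. Qed.

(** The bound is uniform in s, which is what allows s to tend to 0. *)
Lemma trace_gram_inv_moment : L1 G (fun M => \tr (GI M)) /\
  Ex G (fun M => \tr (GI M)) <= n%:R / (p%:R - n%:R - 2).
Proof.
have e M : \sum_i Di i M = \tr (GI M) by apply: eq_bigr => i _; exact: Di_diag.
have l : L1 G (fun M => \sum_i Di i M) by apply: L1_sum.
split; first exact: L1_eq e l.
rewrite -(Ex_eq _ e) Ex_sum//.
apply: le_trans (_ : \sum_(i < n) (p%:R - n%:R - 2)^-1 <= _).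
  by apply: ler_sum => i _; exact: inverse_moment.
by rewrite sumr_const card_ord -[leLHS]mulr_natl.
Qed.

Lemma mxm_gram_inv : mxm (fun M : Mx => GI M).
Proof.
by apply: mxm_scale => //; apply: mxm_ridge; apply: mxm_tr; exact: mxm_id.
Qed.

Let mS : mxm S.
Proof. by apply: mxm_mul; [exact: mxm_id|apply: mxm_tr; exact: mxm_id]. Qed.

Let S_le i j M : `|S M i j| <= p%:R * gauss_dom M.
Proof.
rewrite mxE; apply: le_trans (ler_norm_sum _ _ _) _.
apply: le_trans (_ : \sum_(k < p) gauss_dom M <= _); last first.
  by rewrite sumr_const card_ord [leRHS]mulr_natl.
by apply: ler_sum => k _; rewrite mxE; exact: prod_le_gauss_dom.
Qed.

Let si : 0 <= s^-1. Proof. by rewrite invr_ge0 ltW. Qed.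

Let L1GS i j k l : L1 G (fun M => GI M i j * S M k l).
Proof.
apply: (@gauss_L1_dom _ _ _ G hG (s^-1 * p%:R)).
  by apply: measurable_funM; [exact: mxm_gram_inv|exact: mS].
by move=> M; rewrite normrM -mulrA; apply: ler_pM => //; exact: gram_inv_entry_le.
Qed.

Let e i j := Ex G (fun M => GI M i j * S M i j).

Let e_swap (i j k : 'I_n) : i != j -> i != k -> e i j = e i k.
Proof.
move=> ij ik; have [->//|jk] := eqVneq j k.
have h01 : (0 : R) ^+ 2 + 1 ^+ 2 = 1 by rewrite expr0n expr1n add0r.
rewrite /e -(Ex_row_reflection hG jk h01 (L1GS i j i j)).
apply: Ex_eq => M; set H := refl_mx j k 0 1.
have Hs : H^T = H by exact: refl_mx_sym.
have HH : H *m H = 1%:M by exact: refl_mxK.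
have -> : S (H *m M) = H *m S M *m H by rewrite /S trmx_mul Hs !mulmxA.
rewrite gram_inv_conj//.
have hh (B : 'M[R]_n) : (H *m B *m H) i j = B i k.
  by rewrite /H mul_mx_refl// eqxx mul0r mul1r add0r mul_refl_mx// (negbTE ij) (negbTE ik).
by rewrite !hh.
Qed.

(** By exchangeability the n - 1 off-diagonal terms of row i have equal means,
    and by (M M^T) G = 1 - s G their sum is at most 1. *)
Let e_off (i j : 'I_n) : i != j -> (n%:R - 1) * e i j <= 1.
Proof.
move=> ij.
have n0 : (0 < n)%N by apply: leq_ltn_trans (ltn_ord i).
have E : \sum_(k | k != i) e i k = (n%:R - 1) * e i j.
  rewrite (eq_bigr (fun=> e i j)); last by move=> k ki; apply: e_swap => //; rewrite eq_sym.
  rewrite sumr_const -[LHS]mulr_natl; congr (_ * _).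
  have -> : #|[pred k | k != i]| = n.-1.
    by have := cardC1 i; rewrite card_ord => <-; apply: eq_card => k; rewrite !inE.
  by rewrite -subn1 natrB.
rewrite -E /e -Ex_sum; last by move=> k _; exact: L1GS.
rewrite -[leRHS](Ex_cst G); apply: Ex_le; [by apply: L1_sum => k _; exact: L1GS|exact: L1_cst|].
move=> M.
have h : \sum_k GI M i k * S M i k = 1 - s * GI M i i.
  have := congr1 (fun X : 'M[R]_n => X i i) (gram_inv_mulr M s0); rewrite /= [in LHS]mxE.
  have -> : (1%:M - s *: GI M) i i = 1 - s * GI M i i by rewrite !mxE eqxx.
  move=> <-; apply: eq_bigr => k _; congr (_ * _).
  by rewrite /S !mxE; apply: eq_bigr => l _; rewrite !mxE mulrC.
rewrite (bigD1 i)//= in h.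
have h1 : 0 <= GI M i i * S M i i.
  by rewrite S_diag -Di_diag mulr_ge0 ?sqn_ge0// ltW.
have h2 : 0 <= s * GI M i i by rewrite -Di_diag mulr_ge0// ltW.
lra.
Qed.

Context (D : {set 'I_n}).
Let A (M : Mx) : 'M[R]_p :=
  (selector R D *m M)^T *m GI M *m (selector R D *m M).

Let selected_entry (M : Mx) i k : (selector R D *m M) i k = (i \in D)%:R * M i k.
Proof. by rewrite mul_diag_mx !mxE. Qed.

Let trace_selected M : \tr (A M) =
  \sum_(i in D) \sum_(j in D) GI M i j * S M i j.
Proof.
have -> : \tr (A M) = \sum_i \sum_j (GI M i j) * ((i \in D)%:R * (j \in D)%:R * S M i j).
  rewrite /A -mulmxA mxtrace_mulC -mulmxA.
  apply: eq_bigr => i _; rewrite mxE; apply: eq_bigr => j _; congr (_ * _).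
  rewrite !mxE mulr_sumr; apply: eq_bigr => k _.
  by rewrite [_^T k i]mxE !selected_entry [M^T k j]mxE; ring.
rewrite [RHS]big_mkcond; apply: eq_bigr => i _.
case: (i \in D); last by apply: big1 => j _; rewrite !mul0r mulr0.
rewrite [RHS]big_mkcond; apply: eq_bigr => j _.
by case: (j \in D); rewrite ?mul1r// mul0r mulr0.
Qed.

Let trace_selected_moment : L1 G (fun M => \tr (A M)) /\
  Ex G (fun M => \tr (A M)) <= n%:R * (p%:R / (p%:R - n%:R - 2) + 1).
Proof.
have l : L1 G (fun M => \sum_(i in D) \sum_(j in D) GI M i j * S M i j).
  by apply: L1_sum => i _; apply: L1_sum => j _; exact: L1GS.
split; first by apply: (L1_eq _ l) => M; rewrite trace_selected.
rewrite (Ex_eq _ trace_selected) Ex_sum; last first.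
  by move=> i _; apply: L1_sum => j _; exact: L1GS.
have c0 : 0 <= p%:R / (p%:R - n%:R - 2 : R) + 1 by rewrite addr_ge0// divr_ge0// ltW.
apply: le_trans (_ : \sum_(i in D) (p%:R / (p%:R - n%:R - 2) + 1) <= _); last first.
  rewrite sumr_const -[leLHS]mulr_natl ler_wpM2r// ler_nat.
  by rewrite -[leqRHS]card_ord max_card.
apply: ler_sum => i iD; rewrite Ex_sum; last by move=> j _; exact: L1GS.
rewrite (bigD1 i)//=; apply: lerD.
  have [l1 h1] := row_moment i; apply: le_trans h1.
  by rewrite le_eqVlt; apply/orP; left; apply/eqP; apply: Ex_eq => M; rewrite S_diag Di_diag mulrC.
have [j ij|h] := pickP (fun j : 'I_n => (j \in D) && (j != i)); last by rewrite big1// => j; rewrite h.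
have [jD ji] := andP ij.
rewrite (eq_bigr (fun=> e i j)); last first.
  by move=> k /andP[_ ki]; rewrite -/(e i k); apply: e_swap; rewrite eq_sym.
rewrite sumr_const -[leLHS]mulr_natl; have [e0|e0] := leP (e i j) 0.
  by apply: le_trans (_ : 0 <= _) => //; rewrite mulr_ge0_le0.
have ij' : i != j by rewrite eq_sym.
apply: le_trans (e_off ij'); rewrite ler_wpM2r ?(ltW e0)//.
have n0 : (0 < n)%N by apply: leq_ltn_trans (ltn_ord i).
rewrite -(natrB _ n0) ler_nat subn1.
have := cardC1 i; rewrite card_ord => <-; apply: subset_leq_card.
by apply/fintype.subsetP => k; rewrite !inE => /andP[].
Qed.

Let A_conj (H : 'M[R]_p) M : H^T = H -> H *m H = 1%:M -> A (M *m H) = H *m A M *m H.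
Proof.
move=> hs hh; rewrite /A gram_inv_orth//.
have -> : selector R D *m (M *m H) = selector R D *m M *m H by rewrite mulmxA.
by rewrite [(_ *m H)^T]trmx_mul hs !mulmxA.
Qed.

Let A_le M k l : `|A M k l| <= s^-1 * n%:R ^+ 2 * gauss_dom M.
Proof.
have h : A M k l = \sum_j (\sum_i (selector R D *m M) i k * GI M i j) * (selector R D *m M) j l.
  rewrite mxE; apply: eq_bigr => j _; rewrite mxE; congr (_ * _).
  by apply: eq_bigr => i _; rewrite mxE.
rewrite h; apply: le_trans (ler_norm_sum _ _ _) _.
apply: le_trans (_ : \sum_(j < n) s^-1 * n%:R * gauss_dom M <= _); last first.
  by rewrite sumr_const card_ord -[leLHS]mulr_natl; rewrite le_eqVlt; apply/orP; left; apply/eqP; ring.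
apply: ler_sum => j _; rewrite mulr_suml; apply: le_trans (ler_norm_sum _ _ _) _.
apply: le_trans (_ : \sum_(i < n) s^-1 * gauss_dom M <= _); last first.
  by rewrite sumr_const card_ord -[leLHS]mulr_natl; rewrite le_eqVlt; apply/orP; left; apply/eqP; ring.
apply: ler_sum => i _; rewrite !selected_entry.
have -> : (i \in D)%:R * M i k * GI M i j * ((j \in D)%:R * M j l) =
  ((i \in D)%:R * (j \in D)%:R) * (GI M i j * (M i k * M j l)) by ring.
rewrite normrM; apply: le_trans (_ : 1 * `|GI M i j * (M i k * M j l)| <= _).
  apply: ler_wpM2r => //; rewrite -natrM normr_nat.
  by case: (i \in D); case: (j \in D).
rewrite mul1r normrM; apply: ler_pM => //; first exact: gram_inv_entry_le.
exact: prod_le_gauss_dom.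
Qed.

Let mA : mxm A.
Proof.
have h : mxm (fun M : Mx => selector R D *m M) by apply: mxm_mul; [exact: mxm_cst|exact: mxm_id].
by apply: mxm_mul => //; apply: mxm_mul; [exact: mxm_tr|exact: mxm_gram_inv].
Qed.

Let L1A k l : L1 G (fun M => A M k l).
Proof. by apply: (gauss_L1_dom hG (mA k l)) => M; exact: A_le. Qed.

(** Flipping the sign of one column changes the sign of this entry. *)
Let A_off (k l : 'I_p) : k != l -> Ex G (fun M => A M k l) = 0.
Proof.
move=> kl; have h10 : (1 : R) ^+ 2 + 0 ^+ 2 = 1 by rewrite expr0n expr1n addr0.
have h := Ex_col_reflection hG kl h10 (L1A k l); move: h; set H := refl_mx k l 1 0.
have Hs : H^T = H by exact: refl_mx_sym.
have HH : H *m H = 1%:M by exact: refl_mxK.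
have hh (B : 'M[R]_p) : (H *m B *m H) k l = - B k l.
  rewrite /H mul_mx_refl// [l == k]eq_sym (negbTE kl) eqxx mul0r add0r mul1r.
  by rewrite mul_refl_mx// eqxx mul1r mul0r addr0.
have e2 M : A (M *m H) k l = - A M k l by rewrite A_conj.
rewrite (Ex_eq _ e2).
rewrite ExN//; lra.
Qed.

Let A_diag (k l : 'I_p) : Ex G (fun M => A M k k) = Ex G (fun M => A M l l).
Proof.
have [->//|kl] := eqVneq k l.
have h01 : (0 : R) ^+ 2 + 1 ^+ 2 = 1 by rewrite expr0n expr1n add0r.
rewrite -(Ex_col_reflection hG kl h01 (L1A k k)).
apply: Ex_eq => M; set H := refl_mx k l 0 1.
have Hs : H^T = H by exact: refl_mx_sym.
have HH : H *m H = 1%:M by exact: refl_mxK.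
rewrite A_conj// /H mul_mx_refl// eqxx mul0r add0r mul1r.
by rewrite mul_refl_mx// eqxx mul0r mul1r add0r.
Qed.

(** The mean of the p by p form is a multiple of the identity, so only its
    trace matters. *)
Lemma selected_quad_moment (b : 'cV[R]_p) :
  L1 G (fun M => quad (GI M) (selector R D *m M *m b)) /\
  Ex G (fun M => quad (GI M) (selector R D *m M *m b)) <=
  sqn b * (n%:R / p%:R * (p%:R / (p%:R - n%:R - 2) + 1)).
Proof.
have p0 : (0 < p)%N by apply: leq_ltn_trans np.
have p0' : 0 < (p%:R : R) by rewrite ltr0n.
have eq1 M : quad (GI M) (selector R D *m M *m b) = \sum_i \sum_j b i 0 * b j 0 * A M i j.
  by rewrite -quadE /quad /A trmx_mul !mulmxA.
have l2 i j : L1 G (fun M => b i 0 * b j 0 * A M i j) by apply: L1Z; exact: L1A.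
have l1 i : L1 G (fun M => \sum_j b i 0 * b j 0 * A M i j) by apply: L1_sum => j _; exact: l2.
have l0 : L1 G (fun M => \sum_i \sum_j b i 0 * b j 0 * A M i j) by apply: L1_sum => i _; exact: l1.
split; first by apply: L1_eq l0 => M; rewrite eq1.
rewrite (Ex_eq _ eq1) Ex_sum//.
have [k0 _|h] := pickP (fun k : 'I_p => true); last first.
  by have := h (Ordinal p0).
have E i : Ex G (fun M => \sum_j b i 0 * b j 0 * A M i j) = b i 0 ^+ 2 * Ex G (fun M => A M k0 k0).
  rewrite Ex_sum// (bigD1 i)//= big1 ?addr0; last first.
    by move=> j ji; rewrite ExZ ?A_off ?mulr0// eq_sym.
  by rewrite ExZ// (A_diag i k0) expr2.
rewrite (eq_bigr _ (fun i _ => E i)) -mulr_suml -/(sqn b) ler_wpM2l ?sqn_ge0//.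
have [lt ht] := trace_selected_moment.
have Et : Ex G (fun M => \tr (A M)) = p%:R * Ex G (fun M => A M k0 k0).
  rewrite Ex_sum// (eq_bigr _ (fun k _ => A_diag k k0)) sumr_const card_ord.
  by rewrite -[LHS]mulr_natl.
by rewrite Et mulrC -ler_pdivlMr// in ht; rewrite mulrAC.
Qed.

End PooledMoments.

(** * Tightness of the pooled risk *)

Section FiniteTail.
Context (d : measure_display) (T : measurableType d) (R : realType).
Context (P : probability T R).

Lemma finite_tail (h : T -> R) (eps : R) : measurable_fun setT h -> 0 < eps ->
  exists k : nat, (P [set w | (k%:R <= h w)%R] <= eps%:E)%E.
Proof.
move=> mh e0; pose E k := [set w | k%:R <= h w].
have mE k : measurable (E k).
  rewrite -[E k]setTI (_ : E k = h @^-1` `[k%:R, +oo[%classic); first exact: mh.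
  by apply/seteqP; split => w /=; rewrite in_itv/= andbT.
have h1 : P (E k) @[k --> \oo] --> P (\bigcap_k E k).
  apply: nonincreasing_cvg_mu => //; first by rewrite ltey_eq fin_num_measure.
    exact: bigcapT_measurable.
  apply/nonincreasing_seqP => k; apply/subsetPset => w; rewrite /E /=.
  by apply: le_trans; rewrite ler_nat.
have e1 : \bigcap_k E k = set0.
  apply/seteqP; split => // w hw.
  have := hw (Num.truncn (`|h w|)).+1 I; rewrite /E /= => h2.
  have := truncnS_gt (`|h w|); have := ler_norm (h w) => h3 h4.
  by have := lt_le_trans h4 h2; rewrite ltNge h3.
rewrite e1 measure0 in h1.
have h2 : \forall k \near \oo, (P (E k) < eps%:E)%E.
  have n0 : ereal_nbhs (0%E : \bar R) (fun u => (u < eps%:E)%E).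
    by apply: open_ereal_lt'; rewrite lte_fin.
  exact: (h1 _ n0).
have [k _ hk] := h2; exists k; apply: ltW; exact: hk (leqnn k).
Qed.

End FiniteTail.

Section PooledTight.
Context (R : realType) (n p : nat) (G : probability 'M[R]_(n, p) R).
Hypothesis hG : gauss_law G.
Local Notation Mx := 'M[R]_(n, p).
Hypothesis np : (n + 2 < p)%N.

Let pn : 0 < (p%:R - n%:R - 2 : R).
Proof. by move: np; rewrite -(ltr_nat R) natrD; lra. Qed.

Let S (M : Mx) := M *m M^T.
Let mS : mxm S.
Proof. by apply: mxm_mul; [exact: mxm_id|apply: mxm_tr; exact: mxm_id]. Qed.

Lemma measurable_singular : measurable [set M : Mx | M *m M^T \notin unitmx].
Proof.
rewrite (_ : [set M | _] = (fun M : Mx => \det (S M)) @^-1` [set 0]).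
  by rewrite -[X in measurable X]setTI; apply: meas_det.
by apply/seteqP; split => M /=; rewrite unitmxE unitfE negbK => /eqP.
Qed.

(** On a singular matrix the trace of (M M^T + s)^-1 is at least 1 / s, whereas
    its mean is bounded uniformly in s. *)
Lemma gauss_singular0 : G [set M : Mx | M *m M^T \notin unitmx] = 0%E.
Proof.
apply/eqP; rewrite eq_le measure_ge0 andbT; apply/lee_addgt0Pr => e e0; rewrite add0e.
pose C := n%:R / (p%:R - n%:R - 2) + 1 : R.
have C0 : 0 < C by rewrite ltr_wpDl// divr_ge0// ltW.
have s0 : 0 < e / C by rewrite divr_gt0.
have [l h] := trace_gram_inv_moment hG np s0.
have tr0 (M : Mx) : 0 <= \tr (gram_inv (e / C) M).
  by apply: sumr_ge0 => i _; rewrite -quad_delta quad_gram_inv_ge0.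
have si0 : 0 < (e / C)^-1 by rewrite invr_gt0.
have Mk := Ex_markov (L1_measurable l) tr0 l si0.
apply: (@le_trans _ _ (G [set w | ((e / C)^-1 <= \tr (gram_inv (e / C) w))%R])).
  apply: le_measure; rewrite ?inE.
  - exact: measurable_singular.
  - rewrite (_ : [set w | _] = (fun M : Mx => \tr (gram_inv (e / C) M)) @^-1` `[(e / C)^-1, +oo[%classic).
      by rewrite -[X in measurable X]setTI; exact: L1_measurable l _ _ _.
    by apply/seteqP; split => w /=; rewrite in_itv/= andbT.
  - by move=> M /= u; exact: gram_inv_singular.
apply: le_trans Mk _; rewrite lee_fin invrK; apply: le_trans (_ : C * (e / C) <= _).
  by apply: ler_wpM2r; [exact: ltW|apply: le_trans h _; rewrite /C lerDl].
by rewrite mulrCA mulfV ?mulr1// gt_eqF.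
Qed.

Context (D : {set 'I_n}) (b : 'cV[R]_p) (s2 : R).
Hypothesis s20 : 0 <= s2.

(** Twice-used majorant of the pooled risk: squared norm of the transported
    signal shift plus variance. *)
Definition pooled_bound (A : 'M[R]_n) (M : Mx) : R :=
  quad A (selector R D *m M *m b) + s2 * \tr A.

Definition pooled_const : R :=
  sqn b * (n%:R / p%:R * (p%:R / (p%:R - n%:R - 2) + 1)) +
  s2 * (n%:R / (p%:R - n%:R - 2)).

Let z (M : Mx) := selector R D *m M *m b.

Let h (M : Mx) : R := sqn (invmx (S M) *m z M) +
  s2 * \sum_i sqn (invmx (S M) *m delta_mx i 0).

Let mz : mxm z.
Proof.
apply: mxm_mul; last exact: mxm_cst.
by apply: mxm_mul; [exact: mxm_cst|exact: mxm_id].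
Qed.

Let mh : measurable_fun setT h.
Proof.
apply: measurable_funD; last apply: measurable_funM => //.
  by apply: meas_sqn; apply: mxm_mul => //; exact: mxm_inv.
apply: meas_sum => i; apply: meas_sqn; apply: mxm_mul; last exact: mxm_cst.
exact: mxm_inv.
Qed.

Let pooled_le s M : 0 < s -> M *m M^T \in unitmx ->
  pooled_bound (invmx (S M)) M <= pooled_bound (gram_inv s M) M + s * h M.
Proof.
move=> s0 u; rewrite /pooled_bound /h -/(z M).
have h1 := gram_inv_limit (z M) s0 u; rewrite -/(S M) in h1.
have h2 : \tr (invmx (S M)) <= \tr (gram_inv s M) +
    s * \sum_i sqn (invmx (S M) *m delta_mx i 0).
  rewrite mulr_sumr -big_split /=; apply: ler_sum => i _.
  by have := gram_inv_limit (delta_mx i 0) s0 u; rewrite !quad_delta.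
have h3 := ler_wpM2l s20 h2; move: h1 h3; rewrite mulrDr.
move: (\sum_i _) => t h1 h3; rewrite (mulrCA s2 s) in h3; nra.
Qed.

Lemma measurable_pooled_bound (A : Mx -> 'M[R]_n) : mxm A ->
  measurable_fun setT (fun M => pooled_bound (A M) M).
Proof.
move=> mA; apply: measurable_funD; last apply: measurable_funM => //.
  exact: meas_quad.
exact: meas_trace.
Qed.

(** The unregularised form exceeds the regularised one by s * h with h finite
    everywhere; choose s after a level that h rarely exceeds. *)
Lemma pooled_tight (c : R) : 0 < c ->
  (G [set M | (c <= pooled_bound (invmx (M *m M^T)) M)%R] <= (2 * pooled_const / c)%:E)%E.
Proof.
move=> c0; apply/lee_addgt0Pr => e e0.
have [k hk] := finite_tail G mh e0.
pose s := c / (2 * k.+1%:R).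
have s0 : 0 < s by rewrite divr_gt0// mulr_gt0.
have [l1 h1] := trace_gram_inv_moment hG np s0.
have [l2 h2] := selected_quad_moment hG np s0 D b.
have mE : mxm (fun M : Mx => gram_inv s M) by exact: mxm_gram_inv.
have mQ := measurable_pooled_bound mE.
have Q0 M : 0 <= pooled_bound (gram_inv s M) M.
  rewrite /pooled_bound addr_ge0 ?quad_gram_inv_ge0// mulr_ge0//.
  by apply: sumr_ge0 => i _; rewrite -quad_delta quad_gram_inv_ge0.
have lQ : L1 G (fun M => pooled_bound (gram_inv s M) M) by apply: L1D => //; apply: L1Z.
have EQ : Ex G (fun M => pooled_bound (gram_inv s M) M) <= pooled_const.
  rewrite /pooled_bound ExD; [|by []|by apply: L1Z].
  by rewrite ExZ// lerD// ler_wpM2l.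
have c20 : 0 < c / 2 by rewrite divr_gt0.
have Mk := Ex_markov mQ Q0 lQ c20.
pose A1 := [set M : Mx | M *m M^T \notin unitmx].
pose A2 := [set M : Mx | (k%:R <= h M)%R].
pose A3 := [set M : Mx | (c / 2 <= pooled_bound (gram_inv s M) M)%R].
have mle (f : Mx -> R) t : measurable_fun setT f -> measurable [set M | (t <= f M)%R].
  move=> mf; rewrite (_ : [set M | _] = f @^-1` `[t, +oo[%classic).
    by rewrite -[X in measurable X]setTI; exact: mf.
  by apply/seteqP; split => w /=; rewrite in_itv/= andbT.
have mA1 : measurable A1 by exact: measurable_singular.
have mA2 : measurable A2 by exact: mle.
have mA3 : measurable A3 by exact: mle.
have sub : [set M | (c <= pooled_bound (invmx (M *m M^T)) M)%R] `<=` A1 `|` (A2 `|` A3).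
  move=> M /= hM; have [u|u] := boolP (M *m M^T \in unitmx); last by left.
  right; have [kh|kh] := leP k%:R (h M); first by left.
  right; rewrite /A3 /=; have := pooled_le s0 u.
  have sh : s * h M <= c / 2.
    have h3 : s * k.+1%:R = c / 2.
      have : (k.+1%:R : R) != 0 by rewrite pnatr_eq0.
      by rewrite /s; move: (k.+1%:R : R) => t t0; field.
    rewrite -h3 ler_pM2l//; apply: le_trans (ltW kh) _.
    by rewrite ler_nat.
  lra.
have mB : measurable [set M | (c <= pooled_bound (invmx (M *m M^T)) M)%R].
  by apply: mle; apply: measurable_pooled_bound; exact: mxm_inv.
apply: le_trans (le_measure G _ _ sub) _; rewrite ?inE//; first by apply: measurableU => //; exact: measurableU.
apply: le_trans (measureU2 _ _ _) _ => //; first exact: measurableU.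
rewrite [X in (X + _)%E]gauss_singular0 add0e.
apply: le_trans (measureU2 _ _ _) _ => //.
rewrite addeC; apply: leeD => //.
apply: le_trans Mk _; rewrite lee_fin invfM invrK.
rewrite [leRHS]mulrAC; have ci : 0 <= c^-1 * 2 by rewrite mulr_ge0// invr_ge0 ltW.
apply: le_trans (ler_wpM2r ci EQ) _.
by rewrite le_eqVlt; apply/orP; left; apply/eqP; ring.
Qed.

End PooledTight.

(** * Explicit minimisers and row selections *)

Section Minimizers.
Context (R : realType).

Lemma l2norm_sqr n (v : 'cV[R]_n) : l2norm v ^+ 2 = sqn v.
Proof. by rewrite sqr_sqrtr// sqn_ge0. Qed.

Lemma l2norm_le n (u v : 'cV[R]_n) : (l2norm u <= l2norm v) = (sqn u <= sqn v).
Proof. by rewrite /l2norm ler_sqrt// sqn_ge0. Qed.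

Lemma sqn_addv n (u v : 'cV[R]_n) : sqn (u + v) = sqn u + 2 * (v^T *m u) 0 0 + sqn v.
Proof.
rewrite [(v^T *m u) 0 0]mxE /sqn mulr_sumr -!big_split /=.
by apply: eq_bigr => i _; rewrite !mxE; ring.
Qed.

(** The Moore-Penrose inverse of a matrix of full row rank. *)
Definition min_norm_map n p (W : 'M[R]_(n, p)) : 'M[R]_(p, n) :=
  W^T *m invmx (W *m W^T).

Lemma min_norm_mapK n p (W : 'M[R]_(n, p)) : W *m W^T \in unitmx ->
  W *m min_norm_map W = 1%:M.
Proof. by move=> u; rewrite mulmxA mulmxV. Qed.

(** By Pythagoras: the candidate lies in the row space, which is orthogonal to
    every difference of two interpolators. *)
Lemma pooled_interpolatorE n1 n2 p (X1 : 'M[R]_(n1, p)) y1 (X2 : 'M[R]_(n2, p)) y2 :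
  let W := col_mx X1 X2 in W *m W^T \in unitmx ->
  pooled_interpolator X1 y1 X2 y2 = min_norm_map W *m col_mx y1 y2.
Proof.
move=> W u; set b0 := _ *m _.
have W0 : W *m b0 = col_mx y1 y2 by rewrite mulmxA min_norm_mapK// mul1mx.
have int (b : 'cV[R]_p) : (y1 = X1 *m b /\ y2 = X2 *m b) <-> W *m b = col_mx y1 y2.
  rewrite mul_col_mx; split=> [[-> ->]//|/eq_col_mx[-> ->]//].
have pyth b : W *m b = col_mx y1 y2 -> sqn b = sqn b0 + sqn (b - b0).
  move=> Wb; have -> : sqn b = sqn (b0 + (b - b0)) by rewrite addrC subrK.
  rewrite sqn_addv; have Wd : W *m (b - b0) = 0 by rewrite mulmxBr Wb W0 subrr.
  have -> : (b - b0)^T *m b0 = 0.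
    by rewrite /b0 !mulmxA -trmx_mul Wd trmx0 !mul0mx.
  by rewrite mxE mulr0 addr0.
apply: xget_unique.
  split; first exact/int.
  by move=> b /int Wb; rewrite l2norm_le (pyth _ Wb) lerDl sqn_ge0.
move=> b [/int Wb hb]; have := hb b0 (proj2 (int b0) W0).
rewrite l2norm_le (pyth _ Wb) gerDl => h.
have : sqn (b - b0) = 0 by apply/eqP; rewrite eq_le h sqn_ge0.
by move/sqn_eq0/eqP; rewrite subr_eq0 => /eqP.
Qed.

(** The ridge criterion equals its value at the candidate plus a positive
    definite quadratic form of the deviation. *)
Lemma ridge_argmin n p (Y : 'M[R]_(n, p)) (r : 'cV[R]_n) (mu : R) : 0 < mu ->
  argmin_on 0 [set: 'cV[R]_p] (fun delta : 'cV[R]_p =>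
    l2norm (r - Y *m delta) ^+ 2 + mu * l2norm delta ^+ 2) =
  mu^-1 *: (ridge mu Y *m (Y^T *m r)).
Proof.
move=> mu0; set dl := _ *: _.
have normal : Y^T *m (r - Y *m dl) = mu *: dl.
  have h : (Y^T *m Y + mu%:M) *m dl = Y^T *m r.
    by rewrite /dl -scalemxAr mulmxA ridge_mul// mul_scalar_mx scalerA mulVf ?scale1r// gt_eqF.
  by rewrite mulmxBr mulmxA -h mulmxDl addrAC subrr add0r mul_scalar_mx.
have expand e : l2norm (r - Y *m (dl + e)) ^+ 2 + mu * l2norm (dl + e) ^+ 2 =
   l2norm (r - Y *m dl) ^+ 2 + mu * l2norm dl ^+ 2 + (sqn (Y *m e) + mu * sqn e).
  rewrite !l2norm_sqr mulmxDr opprD addrA !sqn_addv.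
  have -> : sqn (- (Y *m e)) = sqn (Y *m e).
    by apply: eq_bigr => i _; rewrite !mxE sqrrN.
  have -> : ((- (Y *m e))^T *m (r - Y *m dl)) 0 0 = - mu * (e^T *m dl) 0 0.
    rewrite linearN /= mulNmx trmx_mul -mulmxA normal -scalemxAr.
    by rewrite !mxE mulNr.
  ring.
have expand' b : l2norm (r - Y *m b) ^+ 2 + mu * l2norm b ^+ 2 =
   l2norm (r - Y *m dl) ^+ 2 + mu * l2norm dl ^+ 2 +
   (sqn (Y *m (b - dl)) + mu * sqn (b - dl)).
  by rewrite -expand [dl + _]addrC subrK.
apply: xget_unique.
  split=> // b _; rewrite (expand' b) lerDl.
  by rewrite addr_ge0 ?sqn_ge0// mulr_ge0 ?sqn_ge0// ltW.
move=> b [_ /(_ dl I)]; rewrite (expand' b) gerDl => h.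
have h1 := sqn_ge0 (Y *m (b - dl)); have h2 := sqn_ge0 (b - dl).
have : sqn (b - dl) = 0 by nra.
by move/sqn_eq0/eqP; rewrite subr_eq0 => /eqP.
Qed.

Lemma second_stageE n2 p (kappa lambda : R) (I : {set 'I_n2}) (X2 : 'M[R]_(n2, p))
    y2 b (mu := ceil_nb kappa n2 * lambda) (Y := restrict_rows (~: I) X2) :
  0 < mu -> second_stage kappa lambda I X2 y2 b =
  mu^-1 *: (ridge mu Y *m (Y^T *m (restrict_rows (~: I) y2 - Y *m b))).
Proof.
move=> mu0; set r := restrict_rows _ y2 - _.
transitivity (argmin_on 0 [set: 'cV[R]_p] (fun delta : 'cV[R]_p =>
    l2norm (r - Y *m delta) ^+ 2 + mu * l2norm delta ^+ 2)); last exact: ridge_argmin.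
rewrite /second_stage; congr (argmin_on _ _ _).
by apply/funext => delta; rewrite mulmxDr opprD addrA.
Qed.

End Minimizers.

Section Split.
Context (R : realType) (n1 n2 p : nat) (S : {set 'I_n2}).

(** Pooled and fresh rows are given as injections into the rows of the stacked
    design, so that both samples and their noise are selected alike. *)
Definition pool_rows (i : 'I_(n1 + #|S|)) : 'I_(n1 + n2) :=
  match fintype.split i with inl a => lshift n2 a | inr b => rshift n1 (enum_val b) end.

Definition fresh_rows (i : 'I_#|~: S|) : 'I_(n1 + n2) := rshift n1 (enum_val i).

Lemma pool_rows_inj : injective pool_rows.
Proof.
move=> i j; rewrite /pool_rows; case: split_ordP => a ->; case: split_ordP => b -> h.
- by move/lshift_inj: h => ->.
- by have := eq_lrshift a (enum_val b); rewrite h eqxx.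
- by have := eq_lrshift b (enum_val a); rewrite -h eqxx.
- by move/rshift_inj/enum_val_inj: h => ->.
Qed.

Lemma fresh_rows_inj : injective fresh_rows.
Proof. by move=> i j /rshift_inj/enum_val_inj. Qed.

Lemma pool_fresh_disjoint i j : pool_rows i != fresh_rows j.
Proof.
rewrite /pool_rows /fresh_rows; case: split_ordP => a _; first by rewrite eq_lrshift.
rewrite eq_rshift; apply/eqP => h; have := enum_valP j.
by rewrite -h inE enum_valP.
Qed.

Lemma rowsub_pool q (A : 'M[R]_(n1, q)) (B : 'M[R]_(n2, q)) :
  rowsub pool_rows (col_mx A B) = col_mx A (restrict_rows S B).
Proof.
apply/matrixP => i j; rewrite mxE /pool_rows; case: split_ordP => a ->.
  by rewrite !col_mxEu.
by rewrite !col_mxEd mxE.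
Qed.

Lemma rowsub_fresh q (A : 'M[R]_(n1, q)) (B : 'M[R]_(n2, q)) :
  rowsub fresh_rows (col_mx A B) = restrict_rows (~: S) B.
Proof. by apply/matrixP => i j; rewrite mxE col_mxEd mxE. Qed.

Lemma rowsub_mul k m q (f : 'I_k -> 'I_m) (A : 'M[R]_(m, q)) :
  rowsub f A = rowsub f 1%:M *m A.
Proof. by rewrite mul_rowsub_mx mul1mx. Qed.

Lemma rowsub1_gram k m (f : 'I_k -> 'I_m) : injective f ->
  rowsub f 1%:M *m (rowsub f 1%:M)^T = 1%:M :> 'M[R]_k.
Proof.
move=> fi; rewrite -rowsub_mul; apply/matrixP => i j; rewrite !mxE.
by rewrite (inj_eq fi) eq_sym.
Qed.

Lemma rowsub1_orth k l m (f : 'I_k -> 'I_m) (g : 'I_l -> 'I_m) :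
  (forall i j, f i != g j) -> rowsub f 1%:M *m (rowsub g 1%:M)^T = 0 :> 'M[R]_(k, l).
Proof.
move=> fg; rewrite -rowsub_mul; apply/matrixP => i j; rewrite !mxE.
by rewrite eq_sym (negbTE (fg i j)).
Qed.

End Split.

(** * Error decomposition and conditional risks *)

Section GramForm.
Context (R : realFieldType).

(** The weighted inequality with weights b_i^2 and values a_i / b_i; indices
    with b_i = 0 contribute nothing to either side of the reduction. *)
Lemma cauchy_sum (I : finType) (a b : I -> R) :
  (\sum_i a i * b i) ^+ 2 <= (\sum_i a i ^+ 2) * \sum_i b i ^+ 2.
Proof.
have e i : a i * b i = b i ^+ 2 * (a i / b i).
  by have [->|b0] := eqVneq (b i) 0; [rewrite mulr0 expr0n mul0r|field].
rewrite (eq_bigr _ (fun i _ => e i)).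
apply: le_trans (weighted_cauchy _ (fun i => sqr_ge0 (b i))) _.
rewrite mulrC ler_wpM2r//; first by apply: sumr_ge0 => i _; exact: sqr_ge0.
apply: ler_sum => i _; have [->|b0] := eqVneq (b i) 0.
  by rewrite expr0n mul0r sqr_ge0.
by rewrite le_eqVlt; apply/orP; left; apply/eqP; field.
Qed.

Lemma gram_entry p q (B : 'M[R]_(p, q)) i j : (B *m B^T) i j = \sum_k B i k * B j k.
Proof. by rewrite mxE; apply: eq_bigr => k _; rewrite mxE. Qed.

Lemma gram_diag_ge0 p q (B : 'M[R]_(p, q)) i : 0 <= (B *m B^T) i i.
Proof. by rewrite gram_entry; apply: sumr_ge0 => k _; rewrite -expr2 sqr_ge0. Qed.

Lemma gram_cauchy p q (B : 'M[R]_(p, q)) i j :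
  (B *m B^T) i j ^+ 2 <= (B *m B^T) i i * (B *m B^T) j j.
Proof.
rewrite !gram_entry; apply: le_trans (cauchy_sum _ _) _.
by apply: ler_pM; try (by apply: sumr_ge0 => k _; exact: sqr_ge0);
  apply: ler_sum => k _; rewrite expr2.
Qed.

End GramForm.

Section RiskAlgebra.
Context (R : realType) (n1 n2 p : nat) (S : {set 'I_n2}).
Local Notation Mx := 'M[R]_(n1 + n2, p).
Local Notation pool := (@pool_rows n1 n2 S).
Local Notation fresh := (@fresh_rows n1 n2 S).

Definition pool_mx (X : Mx) : 'M[R]_(n1 + #|S|, p) := rowsub pool X.
Definition fresh_mx (X : Mx) : 'M[R]_(#|~: S|, p) := rowsub fresh X.
Definition source_rows : {set 'I_(n1 + #|S|)} := [set i : 'I_(n1 + #|S|) | (i < n1)%N]%SET.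

Definition pooled_bias (b2 bt : 'cV[R]_p) (W : 'M[R]_(n1 + #|S|, p)) : 'cV[R]_p :=
  (min_norm_map W *m W - 1%:M) *m b2 +
  min_norm_map W *m (selector R source_rows *m W *m bt).

Definition pooled_noise (W : 'M[R]_(n1 + #|S|, p)) : 'M[R]_(p, n1 + n2) :=
  min_norm_map W *m rowsub pool 1%:M.

Definition corrected_noise mu (W : 'M[R]_(n1 + #|S|, p)) (Y : 'M[R]_(#|~: S|, p)) :
    'M[R]_(p, n1 + n2) :=
  ridge mu Y *m pooled_noise W + mu^-1 *: (ridge mu Y *m Y^T *m rowsub fresh 1%:M).

Lemma source_rows_selector (A : 'M[R]_(n1, p)) (B : 'M[R]_(#|S|, p)) :
  selector R source_rows *m col_mx A B = col_mx A 0.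
Proof.
apply/matrixP => i j; rewrite mul_diag_mx [LHS]mxE [in X in X * _]mxE inE.
case: (split_ordP i) => a ->.
  by rewrite !col_mxEu /= mul1r.
by rewrite !col_mxEd /= mul0r mxE.
Qed.

Section Errors.
Context (X1 : 'M[R]_(n1, p)) (X2 : 'M[R]_(n2, p)) (b1 b2 : 'cV[R]_p).
Context (e1 : 'cV[R]_n1) (e2 : 'cV[R]_n2).
Let X := col_mx X1 X2.
Let eps := col_mx e1 e2.
Hypothesis unit : pool_mx X *m (pool_mx X)^T \in unitmx.

Lemma first_stage_error :
  first_stage S X1 (response X1 b1 e1) X2 (response X2 b2 e2) - b2 =
  pooled_bias b2 (b1 - b2) (pool_mx X) + pooled_noise (pool_mx X) *m eps.
Proof.
have Wdef : pool_mx X = col_mx X1 (restrict_rows S X2) by exact: rowsub_pool.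
rewrite /first_stage pooled_interpolatorE -?Wdef// .
have -> : col_mx (response X1 b1 e1) (restrict_rows S (response X2 b2 e2)) =
    pool_mx X *m b2 + selector R source_rows *m pool_mx X *m (b1 - b2) + rowsub pool eps.
  rewrite [in selector _ _ *m _]Wdef source_rows_selector Wdef rowsub_pool.
  rewrite !mul_col_mx mul0mx !add_col_mx addr0 /response mulmxBr addrCA subrr addr0.
  congr (col_mx _ _); apply/matrixP => i j; rewrite !mxE; congr (_ + _).
  by apply: eq_bigr => k _; rewrite mxE.
rewrite rowsub_mul /pooled_bias /pooled_noise; set bt := b1 - b2.
rewrite !mulmxDr mulmxBl mul1mx !mulmxA addrAC; congr (_ + _).
by rewrite addrAC.
Qed.

Lemma corrected_error (kappa lambda : R) (mu := ceil_nb kappa n2 * lambda) : 0 < mu ->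
  bias_corrected kappa lambda S X1 (response X1 b1 e1) X2 (response X2 b2 e2) - b2 =
  ridge mu (fresh_mx X) *m pooled_bias b2 (b1 - b2) (pool_mx X) +
  corrected_noise mu (pool_mx X) (fresh_mx X) *m eps.
Proof.
move=> mu0; rewrite /bias_corrected; set b := first_stage _ _ _ _ _.
have hb : b - b2 = _ := first_stage_error.
have Ydef : fresh_mx X = restrict_rows (~: S) X2 by exact: rowsub_fresh.
rewrite second_stageE// -Ydef -/mu; set Y := fresh_mx X; set K := ridge mu Y.
have -> : restrict_rows (~: S) (response X2 b2 e2) - Y *m b =
   rowsub fresh eps - Y *m (b - b2).
  rewrite rowsub_fresh mulmxBr opprB addrA; congr (_ - _).
  rewrite /Y Ydef; apply/matrixP => i j; rewrite !mxE addrC; congr (_ + _).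
  by apply: eq_bigr => k _; rewrite mxE.
have -> : b + mu^-1 *: (K *m (Y^T *m (rowsub fresh eps - Y *m (b - b2)))) - b2 =
    K *m (b - b2) + mu^-1 *: (K *m Y^T *m rowsub fresh eps).
  rewrite addrAC; move: (b - b2) => e.
  have h : mu^-1 *: (K *m (Y^T *m (Y *m e))) = e - K *m e.
    rewrite !mulmxA -[K *m Y^T *m Y]mulmxA ridge_gram// -scalemxAl scalerA.
    by rewrite mulVf ?gt_eqF// scale1r mulmxBl mul1mx.
  rewrite !mulmxBr scalerBr h opprB addrCA [e + (_ - e)]addrC subrK addrC.
  by rewrite !mulmxA.
rewrite hb mulmxDr /corrected_noise mulmxDl -addrA mulmxA; congr (_ + (_ + _)).
by rewrite rowsub_mul -scalemxAl mulmxA.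
Qed.

End Errors.

Section Traces.
Context (s2 : R) (b2 bt : 'cV[R]_p) (W : 'M[R]_(n1 + #|S|, p)) (Y : 'M[R]_(#|~: S|, p)).
Context (sigma mu : R).
Hypothesis mu0 : 0 < mu.
Let v := pooled_bias b2 bt W.
Let L := pooled_noise W.
Let K := ridge mu Y.

Definition noisy_risk q (u : 'cV[R]_p) (N : 'M[R]_(p, q)) : R :=
  sqn u + sigma ^+ 2 * \tr (N *m N^T).

(** A factor of the error form, from which symmetry and positivity are read
    off. *)
Definition error_factor : 'M[R]_(p, 1 + (n1 + n2)) := row_mx v (sigma *: L).
Definition error_form : 'M[R]_p := error_factor *m error_factor^T.

Lemma error_formE : error_form = v *m v^T + sigma ^+ 2 *: (L *m L^T).
Proof.
rewrite /error_form tr_row_mx mul_row_col linearZ /= -scalemxAl -scalemxAr scalerA.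
by rewrite expr2.
Qed.

Lemma trace_outer (u : 'cV[R]_p) : \tr (u *m u^T) = sqn u.
Proof. by rewrite mxtrace_mulC /mxtrace big_ord1 sqnE. Qed.

Lemma pooled_riskE : noisy_risk v L = \tr error_form.
Proof. by rewrite error_formE mxtraceD mxtraceZ trace_outer. Qed.

Lemma pooled_noise_orth : L *m (rowsub fresh 1%:M)^T = 0.
Proof.
rewrite /L /pooled_noise -mulmxA rowsub1_orth ?mulmx0// => i j.
exact: pool_fresh_disjoint.
Qed.

Lemma corrected_riskE : noisy_risk (K *m v) (corrected_noise mu W Y) =
  \tr (error_form *m (K *m K)) + sigma ^+ 2 * ((\tr K - \tr (K *m K)) / mu).
Proof.
have Ks : K^T = K by exact: ridge_sym.
set E := rowsub fresh 1%:M : 'M[R]_(_, n1 + n2).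
have EE : E *m E^T = 1%:M by apply: rowsub1_gram; exact: fresh_rows_inj.
have LE : L *m E^T = 0 by exact: pooled_noise_orth.
have EL : E *m L^T = 0 by have := congr1 (@trmx _ _ _) LE; rewrite trmx_mul trmxK trmx0.
set A := K *m L; set B := K *m Y^T *m E.
have AB : A *m B^T = 0.
  by rewrite /A /B trmx_mul mulmxA -[K *m L *m E^T]mulmxA LE mulmx0 mul0mx.
have BA : B *m A^T = 0.
  by rewrite /A /B trmx_mul mulmxA -[K *m Y^T *m E *m L^T]mulmxA EL mulmx0 mul0mx.
have BB : \tr (B *m B^T) = mu * (\tr K - \tr (K *m K)).
  rewrite /B trmx_mul mulmxA -[K *m Y^T *m E *m E^T]mulmxA EE mulmx1 trmx_mul trmxK Ks.
  rewrite mulmxA -[K *m Y^T *m Y]mulmxA ridge_gram// -scalemxAl mxtraceZ mulmxBl mul1mx.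
  by rewrite linearB.
have AA : \tr (A *m A^T) = \tr (L *m L^T *m (K *m K)).
  by rewrite /A trmx_mul Ks -!mulmxA mxtrace_mulC !mulmxA.
rewrite /noisy_risk /corrected_noise -/L -/K -/E -/A -/B.
have -> : (A + mu^-1 *: B) *m (A + mu^-1 *: B)^T = A *m A^T + mu^-1 ^+ 2 *: (B *m B^T).
  rewrite linearD linearZ /= mulmxDl !mulmxDr -!scalemxAr -!scalemxAl AB BA !scaler0.
  by rewrite addr0 add0r scalerA expr2.
rewrite mxtraceD mxtraceZ AA BB error_formE.
have -> : sqn (K *m v) = \tr (v *m v^T *m (K *m K)).
  by rewrite -trace_outer trmx_mul Ks -!mulmxA mxtrace_mulC !mulmxA.
rewrite mulmxDl mxtraceD -scalemxAl mxtraceZ mulrDr addrA; congr (_ + _ * _).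
by field; rewrite gt_eqF.
Qed.

Hypothesis unit : W *m W^T \in unitmx.

Lemma pooled_noise_trace : \tr (L *m L^T) = \tr (invmx (W *m W^T)).
Proof.
have Gs : (invmx (W *m W^T))^T = invmx (W *m W^T).
  by apply: sym_invmx; rewrite trmx_mul trmxK.
rewrite /L /pooled_noise trmx_mul mulmxA -[_ *m _ *m (rowsub _ _)^T]mulmxA.
rewrite rowsub1_gram; last exact: pool_rows_inj.
rewrite mulmx1 /min_norm_map trmx_mul trmxK Gs mxtrace_mulC !mulmxA.
by rewrite -[_ *m W *m W^T]mulmxA mulVmx// mul1mx.
Qed.

(** The two parts of the bias are orthogonal: one is a projection of the signal
    onto the kernel of W, the other lies in the row space. *)
Lemma pooled_risk_le : noisy_risk v L <=
  sqn b2 + pooled_bound source_rows bt (sigma ^+ 2) (invmx (W *m W^T)) W.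
Proof.
set G := invmx (W *m W^T).
have Gs : G^T = G by apply: sym_invmx; rewrite trmx_mul trmxK.
rewrite /noisy_risk pooled_noise_trace /pooled_bound addrA lerD2r.
set z := _ *m bt.
have WM : W *m min_norm_map W = 1%:M by exact: min_norm_mapK.
have MT : (min_norm_map W)^T = G *m W by rewrite /min_norm_map trmx_mul trmxK Gs.
set u := (min_norm_map W *m W - 1%:M) *m b2.
have Wu : W *m u = 0 by rewrite /u mulmxA mulmxBr mulmxA WM mul1mx mulmx1 subrr mul0mx.
have -> : v = u + min_norm_map W *m z by [].
rewrite sqn_addv trmx_mul MT.
have -> : z^T *m (G *m W) *m u = 0 by rewrite -!mulmxA Wu !mulmx0.
rewrite mxE mulr0 addr0.
have -> : sqn (min_norm_map W *m z) = quad G z.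
  rewrite -sqnE trmx_mul MT /quad; congr ((_ : 'M[R]_1) 0 0).
  have -> : z^T *m (G *m W) *m (min_norm_map W *m z) = z^T *m G *m (W *m min_norm_map W) *m z.
    by rewrite !mulmxA.
  by rewrite WM mulmx1.
rewrite lerD2r.
have Mu : sqn b2 = sqn u + sqn (b2 + u).
  have -> : sqn b2 = sqn ((b2 + u) + (- u)) by rewrite addrK.
  rewrite sqn_addv.
  have -> : (- u)^T *m (b2 + u) = 0.
    have -> : b2 + u = W^T *m (G *m W *m b2).
      by rewrite /u mulmxBl mul1mx addrC subrK !mulmxA.
    by rewrite mulmxA -trmx_mul mulmxN Wu oppr0 trmx0 mul0mx.
  have -> : sqn (- u) = sqn u by apply: eq_bigr => i _; rewrite !mxE sqrrN.
  by rewrite mxE mulr0 addr0 addrC.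
by rewrite Mu lerDl sqn_ge0.
Qed.

End Traces.

End RiskAlgebra.

(** * Independence of sigma-algebras *)

Section Independence.
Context (d : measure_display) (T : measurableType d) (R : realType).
Context (P : probability T R).

(** Dynkin's lemma: the events independent of B form a lambda-system. *)
Lemma indep_sigma (H : set (set T)) (B : set T) :
  setI_closed H -> H `<=` measurable -> measurable B ->
  (forall A, H A -> P (A `&` B) = (P A * P B)%E) ->
  forall A, <<s H >> A -> P (A `&` B) = (P A * P B)%E.
Proof.
move=> HI Hm mB HB.
have sub : <<s H >> `<=` measurable.
  by apply: smallest_sub => //; exact: sigma_algebra_measurable.
apply: (@dynkin_induction _ (g_sigma_algebraType H) H) => //.
- by rewrite setTI probability_setT mul1e.
- move=> S /sub mS hS.
  have e1 : P B = (P (S `&` B) + P (~` S `&` B))%E.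
    rewrite -measureU//.
    + by rewrite -setIUl setUCr setTI.
    + exact: measurableI.
    + by apply: measurableI => //; exact: measurableC.
    + by rewrite setIACA setICr set0I.
  have f1 : P S \is a fin_num by rewrite fin_num_measure.
  have f2 : P B \is a fin_num by rewrite fin_num_measure.
  rewrite probability_setC// muleBl ?mul1e// ?fin_num_adde_defl//.
  by rewrite [X in (X - _)%E]e1 -hS addeAC subee ?add0e// fin_num_measure//; exact: measurableI.
- move=> F0 mF0; pose F : (set T)^nat := F0; rewrite -/F => tF hF.
  have mF' k : measurable (F k) by exact: (sub _ (mF0 k)).
  rewrite setI_bigcupl measure_bigcup//; last 2 first.
  + by move=> k _; exact: measurableI.
  + apply/trivIsetP => i j _ _ ij; rewrite setIACA setIid.
    by move/trivIsetP : tF => /(_ i j I I ij) ->; rewrite set0I.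
  have f2 : P B \is a fin_num by rewrite fin_num_measure.
  rewrite measure_bigcup// muleC -[in RHS](fineK f2) -nneseriesZl//.
  apply: eq_eseriesr => k _; transitivity (P (F k) * P B)%E; first exact: hF.
  by rewrite muleC fineK.
Qed.

End Independence.

Section JointLaw.
Context (d d1 d2 : measure_display) (T : measurableType d).
Context (T1 : measurableType d1) (T2 : measurableType d2).
Context (R : realType) (P : probability T R).
Context (f : T -> T1) (g : T -> T2).
Hypotheses (mf : measurable_fun setT f) (mg : measurable_fun setT g).
Hypothesis fg : forall A B, measurable A -> measurable B ->
  P (f @^-1` A `&` g @^-1` B) = (P (f @^-1` A) * P (g @^-1` B))%E.

Let mh : measurable_fun setT (fun w => (f w, g w)).
Proof. exact: measurable_fun_pair. Qed.

Let joint X : measurable X -> law P mh X = prodprob (law P mf) (law P mg) X.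
Proof.
move=> mX; symmetry.
apply: (product_measure_unique (m' := law P mh)) => //.
Qed.

(** The joint law is a product measure, hence Tonelli applies. *)
Lemma integral_indep (F : T1 * T2 -> \bar R) : measurable_fun setT F ->
  (forall z, (0 <= F z)%E) ->
  (\int[P]_w F (f w, g w) = \int[P]_w \int[P]_w' F (f w, g w'))%E.
Proof.
move=> mF F0; rewrite -(integral_law P mh mF F0).
rewrite (eq_integral_law F joint).
rewrite integral_prod// integral_law//; last 2 first.
- by apply: (@measurable_fun_fubini_tonelli_F _ _ _ _ _ (law P mg) F).
- by move=> x; apply: integral_ge0.
apply: eq_integral => w _; rewrite integral_law//.
by apply: (measurableT_comp mF); exact: measurable_pair1.
Qed.

Lemma Ex_indep_mul (u : T1 -> R) (v : T2 -> R) :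
  measurable_fun setT u -> measurable_fun setT v ->
  L1 P (u \o f) -> L1 P (v \o g) -> L1 P (fun w => u (f w) * v (g w)) ->
  Ex P (fun w => u (f w) * v (g w)) = Ex P (u \o f) * Ex P (v \o g).
Proof.
move=> mu mv lu lv luv.
have mF : measurable_fun setT (fun z : T1 * T2 => u z.1 * v z.2).
  by apply: measurable_funM; apply: measurableT_comp.
rewrite -[LHS](@Ex_law _ _ _ _ _ P _ mh _ mF)//.
rewrite (Ex_eq_law _ joint).
have lF : L1 (prodprob (law P mf) (law P mg)) (fun z : T1 * T2 => u z.1 * v z.2).
  apply: (@L1_eq_law _ _ _ (law P mh)); last exact/(L1_law P mh mF).
  by move=> A mA; exact: joint.
have [_ ->] := Ex_prod mF lF.
have lu' : L1 (law P mf) u by exact/(L1_law P mf mu).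
have lv' : L1 (law P mg) v by exact/(L1_law P mg mv).
have eu : Ex (law P mf) u = Ex P (u \o f) by exact: Ex_law.
have ev : Ex (law P mg) v = Ex P (v \o g) by exact: Ex_law.
have e x : Ex (law P mg) (fun y => u x * v y) = Ex P (v \o g) * u x.
  by rewrite (ExZ (u x) lv') ev mulrC.
by rewrite (Ex_eq _ e) (ExZ _ lu') eu mulrC.
Qed.

End JointLaw.

(** * Versions of a conditional expectation *)

Section Version.
Context (d : measure_display) (T : measurableType d) (R : realType).
Context (P : probability T R).

Lemma pos_integral_null (A : set T) (h : T -> \bar R) : measurable A ->
  measurable_fun A h -> (forall x, A x -> (0 < h x)%E) ->
  (\int[P]_(x in A) h x <= 0)%E -> P A = 0%E.
Proof.
move=> mA mh h0 hI.
have I0 : (\int[P]_(x in A) `|h x| = 0)%E.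
  rewrite (eq_integral h); last by move=> x /[!inE] /h0 hx; rewrite gee0_abs// ltW.
  by apply/eqP; rewrite eq_le hI/=; apply: integral_ge0 => x /h0 /ltW.
have [N [mN N0 sN]] := (ae_eq_integral_abs P mA mh).1 I0.
apply: (@subset_measure0 _ _ _ P A N) => // x Ax.
apply: sN => /= /(_ Ax) hx; have := h0 _ Ax; by rewrite hx ltxx.
Qed.

(** A uniform gap c forces the integrals to differ by c * P A. *)
Lemma gap_null (A : set T) (u v : T -> \bar R) (c : R) : measurable A ->
  measurable_fun A u -> measurable_fun A v -> 0 < c ->
  (forall x, A x -> (0 <= u x)%E) -> (forall x, A x -> (u x + c%:E <= v x)%E) ->
  (\int[P]_(x in A) u x = \int[P]_(x in A) v x)%E ->
  (\int[P]_(x in A) u x < +oo)%E -> P A = 0%E.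
Proof.
move=> mA mu mv c0 u0 uv e fin.
have v0 x : A x -> (0 <= v x)%E.
  by move=> Ax; apply: le_trans (uv _ Ax); rewrite adde_ge0 ?u0// lee_fin ltW.
have h : (\int[P]_(x in A) (u x + c%:E) <= \int[P]_(x in A) v x)%E.
  apply: ge0_le_integral => //; last exact: emeasurable_funD.
  by move=> x Ax; rewrite adde_ge0 ?u0// lee_fin ltW.
rewrite ge0_integralD// in h; last by move=> x _; rewrite lee_fin ltW.
rewrite -e integral_cst// in h.
have fu : (\int[P]_(x in A) u x)%E \is a fin_num.
  by rewrite ge0_fin_numE//; apply: integral_ge0.
have h2 : (c%:E * P A <= 0)%E.
  by move: h; rewrite -[X in (_ <= X)%E]adde0 leeD2lE.
apply/eqP; rewrite eq_le measure_ge0 andbT.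
by move: h2; rewrite pmule_rle0// lte_fin.
Qed.

Context (gen : set (set T)).
Hypothesis genm : <<s gen >> `<=` measurable.
Local Notation TG := (g_sigma_algebraType gen).
Context (r : T -> \bar R) (rho : T -> R) (E : set T).
Hypothesis mr : measurable_fun (setT : set TG) (r : TG -> \bar R).
Hypothesis mrho : measurable_fun (setT : set TG) (rho : TG -> R).
Hypothesis mE : <<s gen >> E.
Hypothesis rho0 : forall w, 0 <= rho w.
Hypothesis hE : forall A, <<s gen >> A -> A `<=` E ->
  (\int[P]_(w in A) r w = \int[P]_(w in A) (rho w)%:E)%E.

Let mrT : measurable_fun (setT : set T) r.
Proof. by move=> _ B mB; apply: genm; exact: mr. Qed.
Let mrhoT : measurable_fun (setT : set T) (fun w => (rho w)%:E).
Proof.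
apply/measurable_EFinP; by move=> _ B mB; apply: genm; exact: mrho.
Qed.
Let mrhoE : measurable_fun (setT : set TG) (fun w : TG => (rho w)%:E).
Proof. exact/measurable_EFinP. Qed.

Let neg := E `&` [set w | (r w < 0)%E].

Let mneg : <<s gen >> neg.
Proof.
apply: (@measurableI _ TG) => //.
by have := @measurable_lte _ TG R setT measurableT r (cst 0%E) mr (measurable_cst _); rewrite setTI.
Qed.

Let neg0 : P neg = 0%E.
Proof.
have mn : measurable neg by exact: genm.
apply: (@pos_integral_null _ (fun w => - r w)%E) => //.
- by apply: measurable_funTS; exact: measurableT_comp.
- by move=> x [_ /=]; rewrite oppe_gt0.
- have h := hE mneg (@subIsetl _ _ _).
  have h0 : (0 <= \int[P]_(w in neg) r w)%E.
    by rewrite h; apply: integral_ge0 => x _; rewrite lee_fin.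
  have e : (\int[P]_(w in neg) r w = - \int[P]_(w in neg) (- r w))%E.
    rewrite -integral_ge0N; last by move=> x [_ /= /ltW]; rewrite oppe_ge0.
    by apply: eq_integral => x _; rewrite oppeK.
  by move: h0; rewrite e oppe_ge0.
Qed.

Let over k := E `&` [set w | rho w <= k%:R] `&` [set w | ((rho w)%:E + k.+1%:R^-1%:E <= r w)%E].
Let under k := E `&` [set w | rho w <= k%:R] `&` [set w | (0 <= r w)%E] `&`
  [set w | (r w + k.+1%:R^-1%:E <= (rho w)%:E)%E].

Let mle (k : nat) : <<s gen >> [set w | rho w <= k%:R].
Proof.
rewrite (_ : [set w | _] = setT `&` rho @^-1` `]-oo, k%:R]); first exact: mrho.
by apply/seteqP; split => w /=; rewrite in_itv/=; [move=> h; split|case].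
Qed.

Let mlee (u v : TG -> \bar R) : measurable_fun setT u -> measurable_fun setT v ->
  <<s gen >> [set w | (u w <= v w)%E].
Proof.
by move=> mu mv; have := @measurable_lee _ TG R setT measurableT u v mu mv; rewrite setTI.
Qed.

Let mover k : <<s gen >> (over k).
Proof.
apply: (@measurableI _ TG); first by apply: (@measurableI _ TG) => //; exact: mle.
by apply: mlee => //; apply: emeasurable_funD.
Qed.

Let munder k : <<s gen >> (under k).
Proof.
apply: (@measurableI _ TG); last by apply: mlee => //; apply: emeasurable_funD.
apply: (@measurableI _ TG); last exact: mlee.
by apply: (@measurableI _ TG) => //; exact: mle.
Qed.

Let rho_fin (A : set T) (k : nat) : measurable A -> (forall w, A w -> rho w <= k%:R) ->
  (\int[P]_(w in A) (rho w)%:E < +oo)%E.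
Proof.
move=> mA hA; apply: (@le_lt_trans _ _ (\int[P]_(w in A) (k%:R)%:E)%E).
  apply: ge0_le_integral => //.
  - by move=> x _; rewrite lee_fin.
  - exact: measurable_funTS.
by rewrite integral_cst// lte_mul_pinfty// ?lee_fin// -ge0_fin_numE// fin_num_measure.
Qed.

Let ck k : 0 < k.+1%:R^-1 :> R. Proof. by rewrite invr_gt0. Qed.

Let over0 k : P (over k) = 0%E.
Proof.
have mo : measurable (over k) by apply: genm; exact: mover.
have eI : (\int[P]_(w in over k) r w = \int[P]_(w in over k) (rho w)%:E)%E.
  by apply: hE => // w [[]].
apply: (gap_null mo _ _ (ck k)  (u := fun w => (rho w)%:E) (v := r)) => //.
- exact: measurable_funTS.
- exact: measurable_funTS.
- by move=> x _; rewrite lee_fin.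
- by move=> x [].
- by apply: (rho_fin (k := k) mo) => w [[_ h] _].
Qed.

Let under0 k : P (under k) = 0%E.
Proof.
have mo : measurable (under k) by apply: genm; exact: munder.
have eI : (\int[P]_(w in under k) r w = \int[P]_(w in under k) (rho w)%:E)%E.
  by apply: hE => // w [[[]]].
apply: (gap_null mo _ _ (ck k)  (u := r) (v := fun w => (rho w)%:E)) => //.
- exact: measurable_funTS.
- exact: measurable_funTS.
- by move=> x [[_ /=]].
- by move=> x [].
- by rewrite eI; apply: (rho_fin (k := k) mo) => w [[[_ h] _] _].
Qed.

Let small (a b : R) : 0 < b -> exists k : nat, a <= k%:R /\ k.+1%:R^-1 <= b.
Proof.
move=> b0; pose x := `|a| + b^-1.
have x0 : 0 <= x by rewrite addr_ge0// invr_ge0 ltW.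
exists (Num.truncn x).+1.
have h := truncnS_gt x; have h1 := ler_norm a.
have h2 : 0 < b^-1 by rewrite invr_gt0.
split; first by apply: le_trans (ltW h); rewrite /x; lra.
rewrite -[leRHS]invrK lef_pV2 ?posrE//.
have : (Num.truncn x).+1%:R <= (Num.truncn x).+2%:R :> R by rewrite ler_nat.
move: h; rewrite /x; have := normr_ge0 a; lra.
Qed.

(** Test the identity of the integrals on the events where the two functions
    differ by at least 1/k while the second is at most k. *)
Lemma version_unique : P.-negligible (E `&` [set w | r w <> (rho w)%:E]).
Proof.
have sub : E `&` [set w | r w <> (rho w)%:E] `<=`
    neg `|` ((\bigcup_k over k) `|` (\bigcup_k under k)).
  move=> w [Ew /= hw]; have [r0|r0] := ltP (r w) 0%E; first by left; split.
  right; move: hw r0; case rw : (r w) => [t| |] //.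
  - rewrite lee_fin => hw t0; have [tr|tr|e] := ltgtP t (rho w); last by rewrite e in hw.
    + have b0 : 0 < rho w - t by rewrite subr_gt0.
      have [k [h1 h2]] := small (rho w) b0.
      right; exists k => //; split; [split; [split|]|] => //=; rewrite rw ?lee_fin//.
      by rewrite addrC -lerBrDr.
    + have b0 : 0 < t - rho w by rewrite subr_gt0.
      have [k [h1 h2]] := small (rho w) b0.
      left; exists k => //; split; [split|] => //=; rewrite rw lee_fin.
      by rewrite addrC -lerBrDr.
  - move=> _ _; have [k [h1 h2]] := small (rho w) ltr01.
    by left; exists k => //; split; [split|] => //=; rewrite rw leey.
apply: (negligibleS sub).
apply: negligibleU; first by exists neg; split => //; exact: genm.
have no k : P.-negligible (over k).
  by apply/negligibleP; [apply: genm; exact: mover|exact: over0].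
have nu k : P.-negligible (under k).
  by apply/negligibleP; [apply: genm; exact: munder|exact: under0].
by apply: negligibleU; apply: negligible_bigcup.
Qed.

End Version.

(** * The regression model *)

Section IndependenceRules.
Context (d : measure_display) (T : measurableType d) (R : realType).
Context (P : probability T R).

Lemma indep_all (J : finType) (G : J -> set (set T)) (A : J -> set T) :
  mutually_independent P G -> (forall i, G i (A i)) ->
  P [set w | forall i, A i w] = (\prod_i P (A i))%E.
Proof.
move=> hG hA; have := hG [set: J]%SET A hA.
rewrite (_ : \bigcap_(i in _) A i = [set w | forall i, A i w]); last first.
  by apply/seteqP; split => w h i => [|_]; apply: h => //=; rewrite finset.in_setT.
by move=> ->; apply: eq_bigl => i; rewrite finset.in_setT.
Qed.

Lemma indep5 (G1 G2 G3 G4 G5 : set (set T)) :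
  mutually_independent_seq P [:: G1; G2; G3; G4; G5] ->
  forall A1 A2 A3 A4 A5, G1 A1 -> G2 A2 -> G3 A3 -> G4 A4 -> G5 A5 ->
  P (A1 `&` (A2 `&` (A3 `&` (A4 `&` A5)))) =
  (P A1 * (P A2 * (P A3 * (P A4 * P A5))))%E.
Proof.
move=> h A1 A2 A3 A4 A5 h1 h2 h3 h4 h5.
have := indep_all (A := fun i : 'I_5 => nth setT [:: A1; A2; A3; A4; A5] i) h.
rewrite !big_ord_recl big_ord0 /= mule1 => <-; last first.
  by case=> [[|[|[|[|[|k]]]]] hk].
congr (P _); apply/seteqP; split => w.
  by move=> [w1 [w2 [w3 [w4 w5]]]] [[|[|[|[|[|k]]]]] hk].
move=> hw; split; first exact: (hw (@Ordinal 5 0 isT)).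
split; first exact: (hw (@Ordinal 5 1 isT)).
split; first exact: (hw (@Ordinal 5 2 isT)).
split; first exact: (hw (@Ordinal 5 3 isT)).
exact: (hw (@Ordinal 5 4 isT)).
Qed.

Lemma indep2 (J : finType) (G : J -> set (set T)) : mutually_independent P G ->
  (forall i, G i setT) -> forall i j A B, i != j -> G i A -> G j B ->
  P (A `&` B) = (P A * P B)%E.
Proof.
move=> h hT i j A B ij hA hB.
pose F k := if k == i then A else if k == j then B else setT.
have hF k : G k (F k).
  by rewrite /F; have [->//|_] := eqVneq k i; have [->//|_] := eqVneq k j.
have := indep_all h hF.
rewrite (bigD1 i)//= (bigD1 j)/=; last by rewrite eq_sym.
rewrite big1 ?mule1; last first.
  by move=> k /andP[/negbTE ki /negbTE kj]; rewrite /F ki kj probability_setT.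
rewrite {2 3}/F eqxx [j == i]eq_sym (negbTE ij) eqxx => <-.
congr (P _); apply/seteqP; split => w.
  by move=> [wA wB] k; rewrite /F; case: eqP => // _; case: eqP.
move=> hw; split; first by have := hw i; rewrite /F eqxx.
by have := hw j; rewrite /F [j == i]eq_sym (negbTE ij) eqxx.
Qed.

Lemma sigma_mxT m n (M : T -> 'M[R]_(m, n)) : sigma_mx M setT.
Proof. exact: (@measurableT _ (g_sigma_algebraType (mx_events M))). Qed.

Lemma sigma_mxI m n (M : T -> 'M[R]_(m, n)) : setI_closed (sigma_mx M).
Proof. by move=> A B; exact: (@measurableI _ (g_sigma_algebraType (mx_events M))). Qed.

Lemma sigma_splitT n (I : T -> {set 'I_n}) : sigma_split I setT.
Proof. by exists setT => //; rewrite preimage_setT setTI. Qed.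

Lemma sigma_splitI n (I : T -> {set 'I_n}) : setI_closed (sigma_split I).
Proof.
move=> _ _ [A _ <-] [B _ <-]; exists (A `&` B) => //.
by rewrite !setTI preimage_setI.
Qed.

Lemma sigma_mx_entry m n (M : T -> 'M[R]_(m, n)) i j (B : set R) : measurable B ->
  sigma_mx M ((fun w => M w i j) @^-1` B).
Proof.
move=> mB; apply: sub_sigma_algebra; exists (i, j) => //=; exists B => //.
by rewrite setTI.
Qed.

Lemma random_mx_mxm m n (M : T -> 'M[R]_(m, n)) : random_mx M -> mxm M.
Proof.
by move=> h i j _ B mB; rewrite setTI; apply: h; exact: sigma_mx_entry.
Qed.

Lemma entry_eventsT m n (M : T -> 'M[R]_(m, n)) i j : entry_events M i j setT.
Proof. by exists setT => //; rewrite preimage_setT setTI. Qed.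

Lemma entry_eventsE m n (M : T -> 'M[R]_(m, n)) i j (B : set R) : measurable B ->
  entry_events M i j ((fun w => M w i j) @^-1` B).
Proof. by move=> mB; exists B => //; rewrite setTI. Qed.

End IndependenceRules.

Section Model.
Context (R : realType) (p n1 n2 : nat) (sigma : R).
Context (d : measure_display) (T : measurableType d) (P : probability T R).
Context (Z1 : T -> 'M[R]_(n1, p)) (Z2 : T -> 'M[R]_(n2, p)).
Context (eps1 : T -> 'cV[R]_n1) (eps2 : T -> 'cV[R]_n2) (I : T -> {set 'I_n2}).
Hypothesis hZ1 : gaussian_design P Z1.
Hypothesis hZ2 : gaussian_design P Z2.
Hypothesis heps1 : noise P sigma eps1.
Hypothesis heps2 : noise P sigma eps2.
Hypothesis hI : random_split I.
Hypothesis hindep : mutually_independent_seq P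
  [:: sigma_mx Z1; sigma_mx Z2; sigma_mx eps1; sigma_mx eps2; sigma_split I].

Definition design w : 'M[R]_(n1 + n2, p) := col_mx (Z1 w) (Z2 w).
Definition errors w : 'cV[R]_(n1 + n2) := col_mx (eps1 w) (eps2 w).

Lemma mxm_design : mxm design.
Proof.
by case: hZ1 => h1 _ _; case: hZ2 => h2 _ _; apply: mxm_col; exact: random_mx_mxm.
Qed.

Lemma mxm_errors : mxm errors.
Proof.
by case: heps1 => h1 _ _; case: heps2 => h2 _ _; apply: mxm_col; exact: random_mx_mxm.
Qed.

Lemma measurable_design : measurable_fun setT design.
Proof. by apply/measurable_mxP; exact: mxm_design. Qed.

Lemma measurable_errors : measurable_fun setT errors.
Proof. by apply/measurable_mxP; exact: mxm_errors. Qed.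

Let i5 := indep5 hindep.
Let T1 : sigma_mx Z1 setT. Proof. exact: sigma_mxT. Qed.
Let T2 : sigma_mx Z2 setT. Proof. exact: sigma_mxT. Qed.
Let T3 : sigma_mx eps1 setT. Proof. exact: sigma_mxT. Qed.
Let T4 : sigma_mx eps2 setT. Proof. exact: sigma_mxT. Qed.
Let T5 : sigma_split I setT. Proof. exact: sigma_splitT. Qed.

Lemma gauss_design : gauss_law (law P measurable_design).
Proof.
move=> A mA; case: hZ1 => r1 h1 N1; case: hZ2 => r2 h2 N2.
pose A1 := [set w | forall ik : 'I_n1 * 'I_p, A (lshift n2 ik.1) ik.2 (Z1 w ik.1 ik.2)].
pose A2 := [set w | forall ik : 'I_n2 * 'I_p, A (rshift n1 ik.1) ik.2 (Z2 w ik.1 ik.2)].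
have E1 : P A1 = (\prod_(ik : 'I_n1 * 'I_p) stdnormal R (A (lshift n2 ik.1) ik.2))%E.
  rewrite (indep_all (A := fun ik => (fun w => Z1 w ik.1 ik.2) @^-1` A (lshift n2 ik.1) ik.2) h1).
    by apply: eq_bigr => ik _; rewrite N1.
  by move=> ik; exact: entry_eventsE.
have E2 : P A2 = (\prod_(ik : 'I_n2 * 'I_p) stdnormal R (A (rshift n1 ik.1) ik.2))%E.
  rewrite (indep_all (A := fun ik => (fun w => Z2 w ik.1 ik.2) @^-1` A (rshift n1 ik.1) ik.2) h2).
    by apply: eq_bigr => ik _; rewrite N2.
  by move=> ik; exact: entry_eventsE.
have S1 : sigma_mx Z1 A1.
  rewrite (_ : A1 = \bigcap_(ik in setT) ((fun w => Z1 w ik.1 ik.2) @^-1` A (lshift n2 ik.1) ik.2)); last first.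
    by apply/seteqP; split => w h ik => [_|]; exact: h.
  apply: (@fin_bigcap_measurable _ (g_sigma_algebraType (mx_events Z1))) => //.
  by move=> ik _; exact: sigma_mx_entry.
have S2 : sigma_mx Z2 A2.
  rewrite (_ : A2 = \bigcap_(ik in setT) ((fun w => Z2 w ik.1 ik.2) @^-1` A (rshift n1 ik.1) ik.2)); last first.
    by apply/seteqP; split => w h ik => [_|]; exact: h.
  apply: (@fin_bigcap_measurable _ (g_sigma_algebraType (mx_events Z2))) => //.
  by move=> ik _; exact: sigma_mx_entry.
have -> : law P measurable_design (mx_rect A) = P (A1 `&` (A2 `&` (setT `&` (setT `&` setT)))).
  rewrite lawE !setIT; congr (P _); apply/seteqP; split => w /=.
    move=> h; split => -[i k] /=; first by have := h (lshift n2 i) k; rewrite col_mxEu.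
    by have := h (rshift n1 i) k; rewrite col_mxEd.
  move=> [h1' h2'] i k; rewrite /design; case: (split_ordP i) => a ->.
    by rewrite col_mxEu; exact: (h1' (a, k)).
  by rewrite col_mxEd; exact: (h2' (a, k)).
rewrite (i5 S1 S2 T3 T4 T5) probability_setT !mule1 E1 E2.
rewrite -(pair_bigA _ (fun (i : 'I_n1) k => stdnormal R (A (lshift n2 i) k))) /=.
rewrite -(pair_bigA _ (fun (i : 'I_n2) k => stdnormal R (A (rshift n1 i) k))) /=.
by rewrite -(pair_bigA _ (fun (i : 'I_(n1 + n2)) k => stdnormal R (A i k))) big_split_ord.
Qed.

(** Intersection-stable generators, on which independence is the product
    rule. *)
Definition design_events : set (set T) := [set A | exists A1 A2 A5,
  [/\ sigma_mx Z1 A1, sigma_mx Z2 A2, sigma_split I A5 & A = A1 `&` (A2 `&` A5)]].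
Definition error_events : set (set T) := [set A | exists A3 A4,
  [/\ sigma_mx eps1 A3, sigma_mx eps2 A4 & A = A3 `&` A4]].
(** The generators of the conditioning sigma-algebra in [is_risk]. *)
Definition given : set (set T) := sigma_mx design `|` sigma_split I.

Let design_eventsI : setI_closed design_events.
Proof.
move=> _ _ [A1 [A2 [A5 [h1 h2 h5 ->]]]] [B1 [B2 [B5 [k1 k2 k5 ->]]]].
exists (A1 `&` B1), (A2 `&` B2), (A5 `&` B5); split.
- exact: sigma_mxI.
- exact: sigma_mxI.
- exact: sigma_splitI.
by rewrite setIACA; congr (_ `&` _); rewrite setIACA.
Qed.

Let error_eventsI : setI_closed error_events.
Proof.
move=> _ _ [A1 [A2 [h1 h2 ->]]] [B1 [B2 [k1 k2 ->]]].
exists (A1 `&` B1), (A2 `&` B2); split; [exact: sigma_mxI|exact: sigma_mxI|].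
by rewrite setIACA.
Qed.

Let design_eventsm : design_events `<=` measurable.
Proof.
case: hZ1 => r1 _ _; case: hZ2 => r2 _ _ _ [A1 [A2 [A5 [h1 h2 h5 ->]]]].
by apply: measurableI; [exact: r1|apply: measurableI; [exact: r2|exact: hI]].
Qed.

Let error_eventsm : error_events `<=` measurable.
Proof.
case: heps1 => r1 _ _; case: heps2 => r2 _ _ _ [A1 [A2 [h1 h2 ->]]].
by apply: measurableI; [exact: r1|exact: r2].
Qed.

Let indep_events A B : design_events A -> error_events B ->
  P (A `&` B) = (P A * P B)%E.
Proof.
move=> [A1 [A2 [A5 [h1 h2 h5 ->]]]] [A3 [A4 [h3 h4 ->]]].
have e1 := i5 h1 h2 h3 h4 h5.
have e2 := i5 h1 h2 T3 T4 h5; rewrite !setTI probability_setT !mul1e in e2.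
have e3 := i5 T1 T2 h3 h4 T5; rewrite !setTI setIT probability_setT !mul1e mule1 in e3.
rewrite (_ : _ `&` (A3 `&` A4) = A1 `&` (A2 `&` (A3 `&` (A4 `&` A5)))); last first.
  rewrite -!setIA; congr (_ `&` (_ `&` _)).
  by rewrite [A4 `&` A5]setIC [RHS]setICA.
rewrite e1 e2 e3 -!muleA; congr (_ * (_ * _))%E.
by rewrite [(P A4 * P A5)%E]muleC muleCA.
Qed.

Let indep_sigmas A B : <<s design_events >> A -> <<s error_events >> B ->
  P (A `&` B) = (P A * P B)%E.
Proof.
have sub : <<s error_events >> `<=` measurable.
  by apply: smallest_sub => //; exact: sigma_algebra_measurable.
have sub' : <<s design_events >> `<=` measurable.
  by apply: smallest_sub => //; exact: sigma_algebra_measurable.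
move=> hA hB; rewrite setIC muleC.
apply: (indep_sigma error_eventsI) => //; first exact: sub'.
move=> B' hB'; rewrite setIC muleC.
apply: (indep_sigma design_eventsI) => //; first exact: error_eventsm.
by move=> A' hA'; exact: indep_events.
Qed.

Lemma given_sub : <<s given >> `<=` <<s design_events >>.
Proof.
apply: smallest_sub; first exact: smallest_sigma_algebra.
move=> A [|hA]; last first.
  by apply: sub_sigma_algebra; exists setT, setT, A; split=> //; rewrite !setTI.
move: A; apply: smallest_sub; first exact: smallest_sigma_algebra.
move=> _ [[i k] _ [B mB <-]]; rewrite setTI /=.
apply: sub_sigma_algebra; rewrite /design.
case: (split_ordP i) => a ->.
  exists ((fun w => Z1 w a k) @^-1` B), setT, setT; split=> //; first exact: sigma_mx_entry.
  by rewrite !setIT; apply/seteqP; split => w /=; rewrite col_mxEu.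
exists setT, ((fun w => Z2 w a k) @^-1` B), setT; split=> //; first exact: sigma_mx_entry.
by rewrite setTI setIT; apply/seteqP; split => w /=; rewrite col_mxEd.
Qed.

Lemma given_measurable : <<s given >> `<=` measurable.
Proof.
apply: subset_trans given_sub _.
by apply: smallest_sub => //; exact: sigma_algebra_measurable.
Qed.

Lemma errors_sub (B : set 'cV[R]_(n1 + n2)) : measurable B ->
  <<s error_events >> (errors @^-1` B).
Proof.
move=> mB.
have h : mxm (errors : g_sigma_algebraType error_events -> 'cV[R]_(n1 + n2)).
  move=> i k _ C mC; rewrite setTI; apply: sub_sigma_algebra; rewrite /errors.
  case: (split_ordP i) => a ->.
    exists ((fun w => eps1 w a k) @^-1` C), setT; split=> //; first exact: sigma_mx_entry.
    by rewrite setIT; apply/seteqP; split => w /=; rewrite col_mxEu.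
  exists setT, ((fun w => eps2 w a k) @^-1` C); split=> //; first exact: sigma_mx_entry.
  by rewrite setTI; apply/seteqP; split => w /=; rewrite col_mxEd.
by have := (measurable_mxP _).2 h measurableT B mB; rewrite setTI.
Qed.

Lemma given_errors_indep A (B : set 'cV[R]_(n1 + n2)) : <<s given >> A ->
  measurable B -> P (A `&` errors @^-1` B) = (P A * P (errors @^-1` B))%E.
Proof.
by move=> /given_sub hA mB; apply: indep_sigmas => //; exact: errors_sub.
Qed.

Lemma design_split_indep (C : set 'M[R]_(n1 + n2, p)) S : measurable C ->
  P (design @^-1` C `&` [set w | I w = S]) = (P (design @^-1` C) * P [set w | I w = S])%E.
Proof.
move=> mC.
pose H : set (set T) := [set A | exists A1 A2,
  [/\ sigma_mx Z1 A1, sigma_mx Z2 A2 & A = A1 `&` A2]].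
have HI : setI_closed H.
  move=> _ _ [A1 [A2 [h1 h2 ->]]] [B1 [B2 [k1 k2 ->]]].
  exists (A1 `&` B1), (A2 `&` B2); split; [exact: sigma_mxI|exact: sigma_mxI|].
  by rewrite setIACA.
have Hm : H `<=` measurable.
  case: hZ1 => r1 _ _; case: hZ2 => r2 _ _ _ [A1 [A2 [h1 h2 ->]]].
  by apply: measurableI; [exact: r1|exact: r2].
have hS : sigma_split I [set w | I w = S] by exists [set S] => //; rewrite setTI.
apply: (indep_sigma HI Hm); first exact: hI.
  move=> _ [A1 [A2 [h1 h2 ->]]].
  have := i5 h1 h2 T3 T4 hS; rewrite !setTI probability_setT !mul1e => e1.
  have := i5 h1 h2 T3 T4 T5; rewrite !setIT probability_setT !mule1 => e2.
  by rewrite -setIA e1 e2 muleA.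
have h : mxm (design : g_sigma_algebraType H -> 'M[R]_(n1 + n2, p)).
  move=> i k _ B mB; rewrite setTI; apply: sub_sigma_algebra; rewrite /design.
  case: (split_ordP i) => a ->.
    exists ((fun w => Z1 w a k) @^-1` B), setT; split=> //; first exact: sigma_mx_entry.
    by rewrite setIT; apply/seteqP; split => w /=; rewrite col_mxEu.
  exists setT, ((fun w => Z2 w a k) @^-1` B); split=> //; first exact: sigma_mx_entry.
  by rewrite setTI; apply/seteqP; split => w /=; rewrite col_mxEd.
by have := (measurable_mxP _).2 h measurableT C mC; rewrite setTI.
Qed.

End Model.

(** * Conditional risk of a linear estimator *)

Section NoiseMoments.
Context (R : realType) (sigma : R).
Context (d : measure_display) (T : measurableType d) (P : probability T R).

Lemma noise_moments n (eps : T -> 'cV[R]_n) (i : 'I_n) : noise P sigma eps ->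
  [/\ L1 P (fun w => eps w i 0), Ex P (fun w => eps w i 0) = 0,
      L1 P (fun w => eps w i 0 ^+ 2) & Ex P (fun w => eps w i 0 ^+ 2) = sigma ^+ 2].
Proof.
case=> r _ /(_ i)[hE hV]; have m := random_mx_mxm r i 0.
have hV' : (\int[P]_w (eps w i 0 ^+ 2)%:E = (sigma ^+ 2)%:E)%E.
  rewrite -hV /variance covariance.unlock hE expectation.unlock.
  by apply: eq_integral => w _; rewrite !fctE /= subr0 expr2.
have l2 : L1 P (fun w => eps w i 0 ^+ 2).
  apply/integrableP; split; first by apply/measurable_EFinP; exact: measurable_funX.
  rewrite (eq_integral (fun w => (eps w i 0 ^+ 2)%:E)); last first.
    by move=> w _ /=; rewrite ger0_norm// sqr_ge0.
  by rewrite hV' ltry.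
have l1 : L1 P (fun w => eps w i 0).
  apply: (L1_le (g := fun w => 1 + eps w i 0 ^+ 2)) => //.
    move=> w; have := sqr_ge0 (`|eps w i 0| - 1).
    rewrite sqrrB real_normK ?num_real// mulr1 expr1n -[_ *+ 2]mulr_natr.
    have := sqr_ge0 (eps w i 0); lra.
  by apply: L1D => //; exact: L1_cst.
split=> //; first by move: hE; rewrite expectation.unlock /Ex => ->.
by rewrite /Ex hV'.
Qed.

End NoiseMoments.

Section ConditionalRisk.
Context (R : realType) (p n1 n2 : nat) (sigma : R).
Context (d : measure_display) (T : measurableType d) (P : probability T R).
Context (Z1 : T -> 'M[R]_(n1, p)) (Z2 : T -> 'M[R]_(n2, p)).
Context (eps1 : T -> 'cV[R]_n1) (eps2 : T -> 'cV[R]_n2) (I : T -> {set 'I_n2}).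
Hypothesis hZ1 : gaussian_design P Z1.
Hypothesis hZ2 : gaussian_design P Z2.
Hypothesis heps1 : noise P sigma eps1.
Hypothesis heps2 : noise P sigma eps2.
Hypothesis hI : random_split I.
Hypothesis hindep : mutually_independent_seq P
  [:: sigma_mx Z1; sigma_mx Z2; sigma_mx eps1; sigma_mx eps2; sigma_split I].

Local Notation X := (design Z1 Z2).
Local Notation e := (errors eps1 eps2).
Local Notation m := (n1 + n2)%N.

Let me a : measurable_fun setT (fun w => e w a 0).
Proof. exact: (mxm_errors heps1 heps2). Qed.

Let moments a : [/\ L1 P (fun w => e w a 0), Ex P (fun w => e w a 0) = 0,
      L1 P (fun w => e w a 0 ^+ 2) & Ex P (fun w => e w a 0 ^+ 2) = sigma ^+ 2].
Proof.
rewrite /errors; case: (split_ordP a) => b ->.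
  have [h1 h2 h3 h4] := noise_moments b heps1.
  by split; [apply: L1_eq h1|rewrite -[RHS]h2; apply: Ex_eq|apply: L1_eq h3|
    rewrite -[RHS]h4; apply: Ex_eq] => w; rewrite col_mxEu.
have [h1 h2 h3 h4] := noise_moments b heps2.
by split; [apply: L1_eq h1|rewrite -[RHS]h2; apply: Ex_eq|apply: L1_eq h3|
    rewrite -[RHS]h4; apply: Ex_eq] => w; rewrite col_mxEd.
Qed.

Let indep_entries a b (A B : set R) : a != b -> measurable A -> measurable B ->
  P ((fun w => e w a 0%R) @^-1` A `&` (fun w => e w b 0%R) @^-1` B) =
  (P ((fun w => e w a 0%R) @^-1` A) * P ((fun w => e w b 0%R) @^-1` B))%E.
Proof.
move=> ab mA mB.
have i5 := indep5 hindep.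
have eu (c : 'I_n1) (C : set R) : (fun w => e w (lshift n2 c) 0%R) @^-1` C =
    (fun w => eps1 w c 0%R) @^-1` C.
  by apply/seteqP; split => w /=; rewrite /errors col_mxEu.
have ed (c : 'I_n2) (C : set R) : (fun w => e w (rshift n1 c) 0%R) @^-1` C =
    (fun w => eps2 w c 0%R) @^-1` C.
  by apply/seteqP; split => w /=; rewrite /errors col_mxEd.
have mixed (c : 'I_n1) (c' : 'I_n2) (C C' : set R) : measurable C -> measurable C' ->
    P ((fun w => eps1 w c 0%R) @^-1` C `&` (fun w => eps2 w c' 0%R) @^-1` C') =
    (P ((fun w => eps1 w c 0%R) @^-1` C) * P ((fun w => eps2 w c' 0%R) @^-1` C'))%E.
  move=> mC mC'; have := i5 setT setT _ _ setT (@sigma_mxT _ T R _ _ Z1) (@sigma_mxT _ T R _ _ Z2)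
    (@sigma_mx_entry _ _ _ _ _ eps1 c 0%R C mC) (@sigma_mx_entry _ _ _ _ _ eps2 c' 0%R C' mC') (sigma_splitT _).
  by rewrite !setTI setIT probability_setT !mul1e mule1.
move: ab; case: (split_ordP a) => a' ->; case: (split_ordP b) => b' -> ab; rewrite ?eu ?ed.
- case: heps1 => _ h _.
  have ab' : (a', 0%R) != (b', 0%R) :> 'I_n1 * 'I_1 by apply: contra ab => /eqP[->].
  have hT (i : 'I_n1 * 'I_1) : entry_events eps1 i.1 i.2 setT by exact: entry_eventsT.
  exact: (indep2 h hT ab' (@entry_eventsE _ T R _ _ eps1 a' 0%R A mA)
    (@entry_eventsE _ T R _ _ eps1 b' 0%R B mB)).
- exact: mixed.
- by rewrite setIC muleC; exact: mixed.
- case: heps2 => _ h _.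
  have ab' : (a', 0%R) != (b', 0%R) :> 'I_n2 * 'I_1 by apply: contra ab => /eqP[->].
  have hT (i : 'I_n2 * 'I_1) : entry_events eps2 i.1 i.2 setT by exact: entry_eventsT.
  exact: (indep2 h hT ab' (@entry_eventsE _ T R _ _ eps2 a' 0%R A mA)
    (@entry_eventsE _ T R _ _ eps2 b' 0%R B mB)).
Qed.

Let L1_mul a b : L1 P (fun w => e w a 0 * e w b 0).
Proof.
have [_ _ la _] := moments a; have [_ _ lb _] := moments b.
apply: (L1_le (g := fun w => e w a 0 ^+ 2 + e w b 0 ^+ 2)); last exact: L1D.
  exact: measurable_funM.
move=> w; move: (e w a 0) (e w b 0) => x y.
rewrite ler_norml; have := sqr_ge0 (x - y); have := sqr_ge0 (x + y).
have := sqr_ge0 x; have := sqr_ge0 y; nra.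
Qed.

Let Ex_mul a b : Ex P (fun w => e w a 0 * e w b 0) = sigma ^+ 2 * (a == b)%:R.
Proof.
have [<-|ab] := eqVneq a b.
  by have [_ _ _ <-] := moments a; rewrite mulr1; apply: Ex_eq => w; rewrite expr2.
have [la Ea _ _] := moments a; have [lb Eb _ _] := moments b.
have := @Ex_indep_mul _ _ _ _ _ _ R P (fun w => e w a 0) (fun w => e w b 0)
  (me a) (me b) (fun A B mA mB => indep_entries ab mA mB) idfun idfun
  (@measurable_id _ _ _) (@measurable_id _ _ _) la lb (L1_mul a b).
by move=> /= ->; rewrite [Ex P _]Ea mul0r mulr0.
Qed.

(** Expand the square: the noise is centered and its covariance is sigma^2
    times the identity. *)
Lemma integral_linear_noise (v : 'cV[R]_p) (L : 'M[R]_(p, m)) :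
  (\int[P]_w (sqn (v + L *m e w))%:E = (noisy_risk sigma v L)%:E)%E.
Proof.
pose c a := (L^T *m v) a 0; pose Q := L^T *m L.
have expand w : sqn (v + L *m e w) =
    (sqn v + 2 * (\sum_a c a * e w a 0)) + \sum_a \sum_b Q a b * (e w a 0 * e w b 0).
  rewrite sqn_addv -quad_gram quadE; congr (_ + _ * _ + _).
    rewrite trmx_mul -mulmxA [LHS]mxE; apply: eq_bigr => a _.
    by rewrite [(e w)^T 0 a]mxE mulrC.
  by apply: eq_bigr => a _; apply: eq_bigr => b _; rewrite mulrC.
have l1 a : L1 P (fun w => c a * e w a 0) by apply: L1Z; have [] := moments a.
have l1s : L1 P (fun w => \sum_a c a * e w a 0) by apply: L1_sum.
have l2 a b : L1 P (fun w => Q a b * (e w a 0 * e w b 0)) by apply: L1Z; exact: L1_mul.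
have l2s a : L1 P (fun w => \sum_b Q a b * (e w a 0 * e w b 0)) by apply: L1_sum.
have l2ss : L1 P (fun w => \sum_a \sum_b Q a b * (e w a 0 * e w b 0)) by apply: L1_sum.
have l0 : L1 P (fun w => sqn v + 2 * (\sum_a c a * e w a 0)).
  by apply: L1D; [exact: L1_cst|exact: L1Z].
have lt : L1 P (fun w => sqn (v + L *m e w)).
  by apply: (L1_eq _ (L1D l0 l2ss)) => w; rewrite expand.
rewrite -(Ex_EFin lt) (Ex_eq _ expand); congr (_%:E).
rewrite (ExD l0 l2ss) (ExD (L1_cst P (sqn v)) (L1Z 2 l1s)) Ex_cst (ExZ _ l1s).
rewrite (Ex_sum _ (fun a _ => l1 a)) big1; last first.
  by move=> a _; rewrite ExZ; have [? E _ _] := moments a => //; rewrite E mulr0.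
rewrite mulr0 addr0 (Ex_sum _ (fun a _ => l2s a)) /noisy_risk; congr (_ + _).
rewrite mxtrace_mulC -/Q mulr_sumr; apply: eq_bigr => a _.
rewrite (Ex_sum _ (fun b _ => l2 a b)) (bigD1 a)//= big1 ?addr0; last first.
  by move=> b ba; rewrite (ExZ _ (L1_mul a b)) Ex_mul eq_sym (negbTE ba) mulr0 mulr0.
by rewrite (ExZ _ (L1_mul a a)) Ex_mul eqxx mulr1 mulrC.
Qed.

Local Notation TG := (g_sigma_algebraType (given Z1 Z2 I)).

Let sub := given_measurable hZ1 hZ2 hI.

Let mid : measurable_fun setT (idfun : T -> TG).
Proof. by move=> _ B mB; rewrite setTI; exact: (sub mB). Qed.

Let mXG : measurable_fun (setT : set TG) (X : TG -> 'M[R]_(m, p)).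
Proof.
apply/measurable_mxP => i j _ B mB; rewrite setTI.
by apply: sub_sigma_algebra; left; exact: sigma_mx_entry.
Qed.

(** On the event {I = S, U} the estimation error is affine in the noise with
    coefficients known given the design, so Tonelli evaluates the integral of
    the loss over every conditioning event. *)
Lemma risk_version (b : T -> 'cV[R]_p) (beta : 'cV[R]_p) (r : T -> \bar R)
    (S : {set 'I_n2}) (U : set 'M[R]_(m, p))
    (V : 'M[R]_(m, p) -> 'cV[R]_p) (L : 'M[R]_(m, p) -> 'M[R]_(p, m)) :
  is_risk P X I 1%:M b beta r -> measurable U -> mxm V -> mxm L ->
  (forall w, I w = S -> U (X w) -> b w - beta = V (X w) + L (X w) *m e w) ->
  P.-negligible ([set w | I w = S /\ U (X w)] `&`
    [set w | r w <> (noisy_risk sigma (V (X w)) (L (X w)))%:E]).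
Proof.
move=> [hr1 hr2] mU mV mL hb.
apply: (@version_unique _ T R P (given Z1 Z2 I) sub r
  (fun w => noisy_risk sigma (V (X w)) (L (X w))) [set w | I w = S /\ U (X w)]).
- by move=> _ B mB; rewrite setTI; exact: hr1.
- apply: (@measurableT_comp _ _ _ _ _ _ (fun M => noisy_risk sigma (V M) (L M))) => //.
  apply: measurable_funD; first exact: meas_sqn.
  apply: measurable_funM => //; apply: meas_trace; apply: mxm_mul => //.
  exact: mxm_tr.
- rewrite (_ : [set w | _] = [set w | I w = S] `&` X @^-1` U); last by [].
  apply: (@measurableI _ TG).
    by apply: sub_sigma_algebra; right; exists [set S] => //; rewrite setTI.
  by rewrite -[X in measurable X]setTI; exact: mXG.
- move=> w; rewrite addr_ge0 ?sqn_ge0// mulr_ge0 ?sqr_ge0//.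
  by apply: sumr_ge0 => i _; exact: gram_diag_ge0.
move=> A hA AE; rewrite (hr2 A hA).
pose F (z : TG * 'cV[R]_m) : \bar R :=
  (\1_A (z.1 : T) * sqn (V (X z.1) + L (X z.1) *m z.2))%:E.
have mA : measurable A by exact: (sub hA).
have mF : measurable_fun setT F.
  apply/measurable_EFinP; apply: measurable_funM.
    have m1 : measurable_fun (setT : set TG) (\1_A : TG -> R) by exact: measurable_indic.
    exact: (measurableT_comp m1 measurable_fst).
  have mVX i j : measurable_fun setT (fun z : TG * 'cV[R]_m => V (X z.1) i j).
    by apply: (measurableT_comp (mV i j)); exact: (measurableT_comp mXG measurable_fst).
  have mLX i j : measurable_fun setT (fun z : TG * 'cV[R]_m => L (X z.1) i j).
    by apply: (measurableT_comp (mL i j)); exact: (measurableT_comp mXG measurable_fst).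
  have mz : mxm (fun z : TG * 'cV[R]_m => z.2).
    by move=> i j; apply: (measurableT_comp (@measurable_entry R m 1 i j)); exact: measurable_snd.
  by apply: meas_sqn; apply: mxm_add => //; exact: mxm_mul.
have F0 z : (0 <= F z)%E by rewrite lee_fin mulr_ge0 ?sqn_ge0.
have ind C D mC mD : P (idfun @^-1` C `&` e @^-1` D) = (P (idfun @^-1` C) * P (e @^-1` D))%E :=
  given_errors_indep hZ1 hZ2 heps1 heps2 hI hindep (A := C) (B := D) mC mD.
transitivity (\int[P]_w F (w, e w))%E.
  rewrite integral_mkcond; apply: eq_integral => w _; rewrite /F /= patchE indicE.
  case: ifPn => wA; last by rewrite mul0r.
  have [h1 h2] : I w = S /\ U (X w) by apply: AE; rewrite inE in wA.
  by rewrite mul1r /quad_loss mulmx1 sqnE (hb _ h1 h2).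
rewrite (integral_indep mid (measurable_errors heps1 heps2) ind mF F0).
rewrite [RHS]integral_mkcond; apply: eq_integral => w _; rewrite patchE /F /= indicE.
case: ifPn => wA.
  rewrite -integral_linear_noise; apply: eq_integral => w' _.
  by rewrite mul1r.
by rewrite -[RHS](integral0 P setT); apply: eq_integral => w' _; rewrite mul0r.
Qed.

End ConditionalRisk.

(** * Deviation for a fixed split *)

Section FixedSplit.
Context (R : realType) (n1 n2 p : nat) (S : {set 'I_n2}).
Context (G : probability 'M[R]_(n1 + n2, p) R).
Hypothesis hG : gauss_law G.
Context (sigma lambda gamma m Gam eta : R) (b2 bt : 'cV[R]_p).
Local Notation Mx := 'M[R]_(n1 + n2, p).
Local Notation np := (n1 + #|S|)%N.
Local Notation N := #|~: S|.
Hypothesis lambda0 : 0 < lambda.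
Hypothesis N0 : (0 < N)%N.
Hypothesis p1 : (1 < p)%N.
Hypothesis np2 : (np + 2 < p)%N.
Hypothesis gammaE : gamma = p%:R / N%:R.
Hypothesis gamma1 : 1 <= gamma.
Hypothesis gammaG : gamma <= Gam.
Hypothesis hm : is_mn gamma lambda m.
Hypothesis eta0 : 0 < eta.
Let mu := N%:R * lambda.
Let nu := N%:R * (lambda * (1 + eta)).

Definition first_risk (X : Mx) : R := noisy_risk sigma
  (pooled_bias b2 bt (@pool_mx R n1 n2 p S X)) (pooled_noise (pool_mx S X)).
Definition corrected_risk (l : R) (X : Mx) : R := noisy_risk sigma
  (ridge l (fresh_mx S X) *m pooled_bias b2 bt (pool_mx S X))
  (corrected_noise l (pool_mx S X) (fresh_mx S X)).

Let A (X : Mx) := error_form b2 bt (pool_mx S X) sigma.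
Let K (X : Mx) := ridge mu (fresh_mx S X).
Let iso (X : Mx) := \tr (A X *m (K X *m K X)) - \tr (A X) * \tr (K X *m K X) / p%:R.
Let df (X : Mx) := mp_defect mu (fresh_mx S X) / N%:R.
Let df' (X : Mx) := mp_defect nu (fresh_mx S X) / N%:R.
Let a := risk_slope gamma lambda m.
Let cc := sigma ^+ 2 * (gamma / lambda * (lambda * m - a)).

Let NR : 0 < (N%:R : R). Proof. by rewrite ltr0n. Qed.
Let pR : 0 < (p%:R : R). Proof. by rewrite ltr0n ltnW. Qed.
Let mu0 : 0 < mu. Proof. exact: mulr_gt0. Qed.
Let eta1 : 0 < 1 + eta. Proof. exact: addr_gt0. Qed.
Let nu0 : 0 < nu. Proof. by rewrite /nu !mulr_gt0. Qed.
Let mn : mu < nu.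
Proof. by rewrite /mu /nu ltr_pM2l// ltr_pMr// ltrDl. Qed.
Let gamma0 : 0 < gamma. Proof. by apply: lt_le_trans gamma1. Qed.
Let m0 : 0 < m. Proof. by case: hm. Qed.

(** Rates at which the two sources of error in tr K^2 / p enter: the increment
    of the difference quotient and the Marchenko-Pastur defects. *)
Definition slope_rate : R := 1 + (lambda + lambda^-1) * Gam / lambda.
Definition defect_rate : R := eta^-1 + (lambda + lambda^-1) / lambda + lambda^-1 ^+ 2.

Let defect_fun l (Y : 'M[R]_(N, p)) : 0 < l ->
  mp_fun l (\tr (ridge (N%:R * l) Y) / (N%:R * l)) = gamma - mp_defect (N%:R * l) Y / N%:R.
Proof.
move=> l0; rewrite /mp_defect /mp_fun gammaE.
have t0 : 0 <= \tr (ridge (N%:R * l) Y) by apply: trace_ridge_ge0; exact: mulr_gt0.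
move: (\tr _) t0 => t t0.
have q0 : 0 < N%:R * l + t by rewrite ltr_wpDr// mulr_gt0.
by field; rewrite !gt_eqF.
Qed.

Let k1 X := \tr (K X) / p%:R.
Let k2 X := \tr (K X *m K X) / p%:R.

(** The trace of K solves the limit equation up to the defect, and that
    equation is strongly monotone. *)
Let first_trace X : `|k1 X - lambda * m| <= `|df X|.
Proof.
set g := \tr (K X) / mu.
have g0 : 0 <= g by rewrite divr_ge0 ?trace_ridge_ge0// ltW.
have h := defect_fun (fresh_mx S X) lambda0; rewrite -/mu -/(K X) -/g -/(df X) in h.
have s0 : 0 <= gamma * m by rewrite mulr_ge0// ltW.
have := mp_fun_inj lambda0 g0 s0; rewrite h (mp_fun_mn gamma0 hm).
rewrite [gamma - df X - gamma]addrAC subrr add0r normrN => h1.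
have -> : k1 X - lambda * m = gamma^-1 * (lambda * (g - gamma * m)).
  rewrite /k1 /g /mu gammaE; field.
  by rewrite !gt_eqF.
have gi : 0 <= gamma^-1 by rewrite invr_ge0 ltW.
rewrite normrM (ger0_norm gi) [`|lambda * _|]normrM (gtr0_norm lambda0).
apply: le_trans h1; apply: ler_piMl; first by rewrite mulr_ge0// ltW.
by rewrite invf_le1.
Qed.

Let second_trace X : `|k2 X - a| <= eta * slope_rate + (`|df X| + `|df' X|) * defect_rate.
Proof.
set g := \tr (K X) / mu; set g' := \tr (ridge nu (fresh_mx S X)) / nu.
have g0 : 0 <= g by rewrite divr_ge0 ?trace_ridge_ge0// ltW.
have g'0 : 0 <= g' by rewrite divr_ge0 ?trace_ridge_ge0// ltW.
have h := defect_fun (fresh_mx S X) lambda0; rewrite -/mu -/(K X) -/g -/(df X) in h.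
have l1 : 0 < lambda * (1 + eta) by rewrite mulr_gt0.
have h' := defect_fun (fresh_mx S X) l1; rewrite -/nu -/g' -/(df' X) in h'.
have lg' : lambda * g' <= gamma.
  have ht := trace_ridge_le (fresh_mx S X) nu0.
  have gn : gamma * nu = lambda * (1 + eta) * p%:R by rewrite /nu gammaE; field; rewrite gt_eqF.
  rewrite /g' [lambda * (_ / _)]mulrA ler_pdivrMr// gn -mulrA ler_pM2l//.
  by apply: le_trans ht _; rewrite ler_peMl// ?lerDl ltW.
have q := risk_slope_diffquot gamma0 lambda0 hm eta0 gamma1 gammaG g0 g'0 lg' h h'.
have r := trace_ridge2_diffquot (fresh_mx S X) mu0 mn.
rewrite -/(K X) -/g -/g' in r.
have e1 : lambda / gamma * ((g - g') / eta) - k2 X =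
    mu ^+ 2 / p%:R * ((g - g') / (nu - mu) - \tr (K X *m K X) / mu ^+ 2).
  rewrite /k2 (_ : nu - mu = mu * eta); last by rewrite /nu /mu; ring.
  rewrite gammaE /mu; field.
  by rewrite !gt_eqF.
have e2 : `|lambda / gamma * ((g - g') / eta) - k2 X| <= eta.
  have c0 : 0 < mu ^+ 2 / p%:R by rewrite divr_gt0// exprn_gt0.
  rewrite e1 normrM (gtr0_norm c0); apply: le_trans (ler_wpM2l (ltW c0) r) _.
  rewrite le_eqVlt; apply/orP; left; apply/eqP.
  rewrite (_ : nu - mu = mu * eta); last by rewrite /nu /mu; ring.
  by field; rewrite !gt_eqF.
rewrite -/a -/defect_rate in q.
have -> : k2 X - a = (lambda / gamma * ((g - g') / eta) - a) -
   (lambda / gamma * ((g - g') / eta) - k2 X) by ring.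
apply: le_trans (ler_normB _ _) _; rewrite /slope_rate; lra.
Qed.

Let risk_decomposition X : corrected_risk mu X - (a * first_risk X + cc) =
  iso X + (k2 X - a) * first_risk X +
  sigma ^+ 2 * (gamma / lambda) * ((k1 X - lambda * m) - (k2 X - a)).
Proof.
rewrite /corrected_risk corrected_riskE// /first_risk pooled_riskE -/(A X) -/(K X).
rewrite /iso /k1 /k2 /cc /mu gammaE; field.
by rewrite !gt_eqF.
Qed.

Let first_risk_ge0 X : 0 <= first_risk X.
Proof.
rewrite /first_risk pooled_riskE; apply: sumr_ge0 => i _; exact: gram_diag_ge0.
Qed.

(** On the event RI + sigma^2 Gam / lambda <= B. *)
Lemma risk_gap (B : R) X : first_risk X + sigma ^+ 2 * (Gam / lambda) <= B ->
  `|corrected_risk mu X - (a * first_risk X + cc)| <=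
  `|iso X| + eta * slope_rate * B + (`|df X| + `|df' X|) * ((defect_rate + 1) * B).
Proof.
move=> hB; rewrite risk_decomposition.
have RI0 := first_risk_ge0 X.
set c := sigma ^+ 2 * (gamma / lambda).
have c0 : 0 <= c by rewrite mulr_ge0 ?sqr_ge0// divr_ge0// ltW.
have cB : first_risk X + c <= B.
  apply: le_trans hB; rewrite lerD2l /c ler_wpM2l ?sqr_ge0//.
  by rewrite ler_pM2r// invr_gt0.
have h1 := first_trace X; have h2 := second_trace X.
apply: le_trans (_ : `|iso X| + (`|k2 X - a| * first_risk X + c * (`|k1 X - lambda * m| + `|k2 X - a|)) <= _).
  rewrite -addrA; apply: le_trans (ler_normD _ _) _; rewrite lerD2l.
  apply: le_trans (ler_normD _ _) _; apply: lerD.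
    by rewrite normrM (ger0_norm RI0).
  by rewrite normrM (ger0_norm c0) ler_wpM2l// ler_normB.
rewrite -addrA lerD2l.
have d0 := normr_ge0 (df X); have d0' := normr_ge0 (df' X).
apply: le_trans (_ : (`|k2 X - a| + `|df X|) * B <= _).
  apply: le_trans (_ : (`|k2 X - a| + `|df X|) * (first_risk X + c) <= _).
    have := normr_ge0 (k2 X - a); move: h1 (normr_ge0 (k1 X - lambda * m)); nra.
  by rewrite ler_wpM2l// addr_ge0.
have B0 : 0 <= B by apply: le_trans cB; exact: addr_ge0.
have -> : eta * slope_rate * B + (`|df X| + `|df' X|) * ((defect_rate + 1) * B) =
   (eta * slope_rate + (`|df X| + `|df' X|) * defect_rate + (`|df X| + `|df' X|)) * B by ring.
by rewrite ler_wpM2r// lerD// lerDl.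
Qed.


Lemma mxm_pool (d : measure_display) (T : measurableType d) (X : T -> Mx) :
  mxm X -> mxm (fun w => pool_mx S (X w)).
Proof. exact: mxm_rowsub. Qed.

Lemma mxm_fresh (d : measure_display) (T : measurableType d) (X : T -> Mx) :
  mxm X -> mxm (fun w => fresh_mx S (X w)).
Proof. exact: mxm_rowsub. Qed.

Lemma mxm_min_norm_map : mxm (fun X : Mx => min_norm_map (pool_mx S X)).
Proof.
have h := mxm_pool (@mxm_id R (n1 + n2) p).
apply: mxm_mul; first exact: mxm_tr.
by apply: mxm_inv; apply: mxm_mul => //; exact: mxm_tr.
Qed.

Lemma mxm_pooled_bias : mxm (fun X : Mx => pooled_bias b2 bt (pool_mx S X)).
Proof.
have h := mxm_pool (@mxm_id R (n1 + n2) p).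
apply: mxm_add; apply: mxm_mul; try exact: mxm_cst.
- apply: mxm_sub; last exact: mxm_cst.
  by apply: mxm_mul => //; exact: mxm_min_norm_map.
- exact: mxm_min_norm_map.
- by apply: mxm_mul; [apply: mxm_mul => //; exact: mxm_cst|exact: mxm_cst].
Qed.

Lemma mxm_pooled_noise : mxm (fun X : Mx => @pooled_noise R n1 n2 p S (pool_mx S X)).
Proof. by apply: mxm_mul; [exact: mxm_min_norm_map|exact: mxm_cst]. Qed.

Lemma mxm_ridge_fresh l : mxm (fun X : Mx => ridge l (fresh_mx S X)).
Proof. by apply: mxm_ridge; apply: mxm_fresh; exact: mxm_id. Qed.

Lemma mxm_corrected_noise l :
  mxm (fun X : Mx => corrected_noise l (pool_mx S X) (fresh_mx S X)).
Proof.
apply: mxm_add.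
  by apply: mxm_mul; [exact: mxm_ridge_fresh|exact: mxm_pooled_noise].
apply: mxm_scale => //; apply: mxm_mul; last exact: mxm_cst.
apply: mxm_mul; first exact: mxm_ridge_fresh.
by apply: mxm_tr; apply: mxm_fresh; exact: mxm_id.
Qed.

Lemma meas_noisy_risk q (V : Mx -> 'cV[R]_p) (L : Mx -> 'M[R]_(p, q)) : mxm V -> mxm L ->
  measurable_fun setT (fun X => noisy_risk sigma (V X) (L X)).
Proof.
move=> mV mL; apply: measurable_funD; first exact: meas_sqn.
by apply: measurable_funM => //; apply: meas_trace; apply: mxm_mul => //; exact: mxm_tr.
Qed.

Lemma measurable_first_risk : measurable_fun setT first_risk.
Proof. by apply: meas_noisy_risk; [exact: mxm_pooled_bias|exact: mxm_pooled_noise]. Qed.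

Lemma measurable_corrected_risk l : measurable_fun setT (corrected_risk l).
Proof.
apply: meas_noisy_risk; last exact: mxm_corrected_noise.
by apply: mxm_mul; [exact: mxm_ridge_fresh|exact: mxm_pooled_bias].
Qed.

Let mA : mxm A.
Proof.
have h : mxm (fun X : Mx => pooled_bias b2 bt (pool_mx S X) *m (pooled_bias b2 bt (pool_mx S X))^T
   + sigma ^+ 2 *: (pooled_noise (pool_mx S X) *m (@pooled_noise R n1 n2 p S (pool_mx S X))^T)).
  apply: mxm_add.
    by apply: mxm_mul; [|apply: mxm_tr]; exact: mxm_pooled_bias.
  apply: mxm_scale => //.
  by apply: mxm_mul; [|apply: mxm_tr]; exact: mxm_pooled_noise.
by move=> i j; apply: (meas_eq _ (h i j)) => X; rewrite /A error_formE.
Qed.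

Let mK : mxm K. Proof. exact: mxm_ridge_fresh. Qed.

Let miso : measurable_fun setT iso.
Proof.
have mKK : mxm (fun X => K X *m K X) by exact: mxm_mul.
apply: measurable_funB; first by apply: meas_trace; exact: mxm_mul.
by apply: measurable_funM => //; apply: measurable_funM; exact: meas_trace.
Qed.

Let mle (f : Mx -> R) (t : R) : measurable_fun setT f -> measurable [set X | t <= f X].
Proof.
move=> mf; rewrite (_ : [set X | _] = f @^-1` `[t, +oo[%classic).
  by rewrite -[X in measurable X]setTI; exact: mf.
by apply/seteqP; split => w /=; rewrite in_itv/= andbT.
Qed.

Let mlt (f : Mx -> R) (t : R) : measurable_fun setT f -> measurable [set X | f X < t].
Proof.
move=> mf; rewrite (_ : [set X | _] = f @^-1` `]-oo, t[%classic).
  by rewrite -[X in measurable X]setTI; exact: mf.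
by apply/seteqP; split => w /=; rewrite in_itv.
Qed.

Let mpoolf : measurable_fun setT (fun M : Mx => rowsub (@pool_rows n1 n2 S) M).
Proof. exact: measurable_rowsub. Qed.
Let gauss_pool : gauss_law (law G mpoolf).
Proof. by apply: (gauss_rowsub hG); exact: pool_rows_inj. Qed.
Let mfreshf : measurable_fun setT (fun M : Mx => rowsub (@fresh_rows n1 n2 S) M).
Proof. exact: measurable_rowsub. Qed.
Let gauss_fresh : gauss_law (law G mfreshf).
Proof. by apply: (gauss_rowsub hG); exact: fresh_rows_inj. Qed.

Definition pool_singular : set Mx := [set X | pool_mx S X *m (pool_mx S X)^T \notin unitmx].

Lemma measurable_pool_singular : measurable pool_singular.
Proof.
rewrite -[X in measurable X]setTI; exact: (mpoolf measurableT (@measurable_singular R np p)).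
Qed.

Lemma pool_singular0 : G pool_singular = 0%E.
Proof. exact: (gauss_singular0 gauss_pool np2). Qed.

Let first_risk_tail (c : R) : 0 < c ->
  (G (~` pool_singular `&` [set X | (sqn b2 + c <= first_risk X)%R]) <=
   (2 * pooled_const np bt (sigma ^+ 2) / c)%:E)%E.
Proof.
move=> c0.
have mB : mxm (fun X : Mx => invmx (pool_mx S X *m (pool_mx S X)^T)).
  have h := mxm_pool (@mxm_id R (n1 + n2) p).
  by apply: mxm_inv; apply: mxm_mul => //; exact: mxm_tr.
have mI : mxm (fun W : 'M[R]_(np, p) => invmx (W *m W^T)).
  by apply: mxm_inv; apply: mxm_mul; [|apply: mxm_tr]; exact: mxm_id.
pose F := [set W : 'M[R]_(np, p) | (c <= pooled_bound (source_rows n1 S) bt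
  (sigma ^+ 2) (invmx (W *m W^T)) W)%R].
apply: (@le_trans _ _ (G (pool_mx S @^-1` F))); last first.
  exact: (pooled_tight gauss_pool np2 (source_rows n1 S) bt (sqr_ge0 sigma) c0).
apply: le_measure; rewrite ?inE.
- apply: measurableI; first by apply: measurableC; exact: measurable_pool_singular.
  by apply: mle; exact: measurable_first_risk.
- rewrite -[X in measurable X]setTI; apply: mpoolf => //.
  rewrite (_ : F = (fun W : 'M[R]_(np, p) => pooled_bound (source_rows n1 S) bt
     (sigma ^+ 2) (invmx (W *m W^T)) W) @^-1` `[c, +oo[%classic); last first.
    by apply/seteqP; split => w /=; rewrite in_itv/= andbT.
  rewrite -[X in measurable X]setTI; apply: measurable_pooled_bound => //.
- move=> X [/= /negP]; rewrite negbK => u h.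
  have := le_trans h (pooled_risk_le b2 bt sigma u).
  by rewrite lerD2l.
Qed.

(** The entries to be integrated first, the pooled rows being held fixed. *)
Let fresh_mask : 'I_(n1 + n2) -> 'I_p -> bool := fun i _ => i \in codom (@fresh_rows n1 n2 S).

Let fresh_mix (M M' : Mx) : fresh_mx S (mix fresh_mask M M') = fresh_mx S M.
Proof. by apply/matrixP => i j; rewrite !mxE /fresh_mask codom_f. Qed.

Let pool_mix (M M' : Mx) : pool_mx S (mix fresh_mask M M') = pool_mx S M'.
Proof.
apply/matrixP => i j; rewrite !mxE /fresh_mask.
case: ifPn => // /codomP[k hk]; have := pool_fresh_disjoint i k.
by rewrite hk eqxx.
Qed.

(** Given the pooled rows, the error form is a fixed matrix and the fresh rows
    are still Gaussian. *)
Let isotropy_tail (t B : R) : 0 < t -> 0 <= B ->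
  (G ([set X | (first_risk X < B)%R] `&` [set X | (t <= `|iso X|)%R]) <=
   (12 * B ^+ 2 / (p%:R - 1) / t ^+ 2)%:E)%E.
Proof.
move=> t0 B0; set E := _ `&` _.
have mE : measurable E.
  apply: measurableI; first by apply: mlt; exact: measurable_first_risk.
  by apply: mle; exact: measurableT_comp.
have p10 : 0 < (p%:R - 1 : R) by rewrite subr_gt0 ltr1n.
have C0 : 0 <= 12 * B ^+ 2 / (p%:R - 1) / t ^+ 2.
  by rewrite divr_ge0 ?exprn_ge0 ?(ltW t0)// divr_ge0 ?(ltW p10)// mulr_ge0// sqr_ge0.
have -> : G E = (\int[G]_X (\1_E X)%:E)%E by rewrite integral_indic// setIT.
rewrite (integral_mix fresh_mask hG); last 2 first.
- by apply/measurable_EFinP; exact: measurable_indic.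
- by move=> X; rewrite lee_fin.
have inner M' : (\int[G]_M (\1_E (mix fresh_mask M M'))%:E <=
    (12 * B ^+ 2 / (p%:R - 1) / t ^+ 2)%:E)%E.
  have eR M : first_risk (mix fresh_mask M M') = first_risk M'.
    by rewrite /first_risk pool_mix.
  have [hB|hB] := leP B (first_risk M').
    have e0 M : M \in [set: Mx] -> (\1_E (mix fresh_mask M M'))%:E = cst 0%E M :> \bar R.
      move=> _ /=; rewrite indicE; case: (boolP (_ \in E)) => //; rewrite inE => -[/=].
      by rewrite eR ltNge hB.
    by rewrite (eq_integral _ _ e0) integral0 lee_fin.
  pose Q (Y : 'M[R]_(N, p)) := ridge mu Y *m ridge mu Y.
  have mQ : mxm Q by apply: mxm_mul; apply: mxm_ridge; exact: mxm_id.
  have Qs Y : (Q Y)^T = Q Y by exact: ridge2_sym.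
  have Qc (H : 'M[R]_p) Y : H^T = H -> H *m H = 1%:M -> Q (Y *m H) = H *m Q Y *m H.
    move=> hs hh; rewrite /Q ridge_conj// !mulmxA -[H *m ridge mu Y *m H *m H]mulmxA hh.
    by rewrite mulmx1.
  have Qr Y i : \sum_j Q Y i j ^+ 2 <= 1 by exact: ridge2_row_sqr.
  have As : (A M')^T = A M' by rewrite /A /error_form trmx_mul trmxK.
  have Ad i : 0 <= A M' i i by exact: gram_diag_ge0.
  have Ac i j : A M' i j ^+ 2 <= A M' i i * A M' j j by exact: gram_cauchy.
  have [lI hI] := isotropy gauss_fresh mQ Qs Qc Qr As Ad Ac p1.
  pose f (Y : 'M[R]_(N, p)) := (\tr (A M' *m Q Y) - \tr (A M') * \tr (Q Y) / p%:R) ^+ 2.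
  have f0 Y : 0 <= f Y by exact: sqr_ge0.
  have t20 : 0 < t ^+ 2 by rewrite exprn_gt0.
  have Mk := Ex_markov (L1_measurable lI) f0 lI t20.
  have trA : \tr (A M') = first_risk M' by rewrite /first_risk pooled_riskE.
  apply: (@le_trans _ _ (law G mfreshf [set Y | (t ^+ 2 <= f Y)%R])); last first.
    apply: le_trans Mk _; rewrite lee_fin ler_wpM2r ?invr_ge0 ?(ltW t20)//.
    apply: le_trans hI _; rewrite trA ler_wpM2r ?invr_ge0 ?(ltW p10)// ler_wpM2l//.
    by apply: lerXn2r; rewrite ?nnegrE ?first_risk_ge0// ltW.
  have mF : measurable [set Y | (t ^+ 2 <= f Y)%R].
    rewrite (_ : [set Y | _] = f @^-1` `[t ^+ 2, +oo[%classic); last first.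
      by apply/seteqP; split => w /=; rewrite in_itv/= andbT.
    by rewrite -[X in measurable X]setTI; apply: L1_measurable lI _ _ _.
  rewrite lawE -[X in (_ <= G X)%E]setIT -integral_indic//; last first.
    by rewrite -[X in measurable X]setTI; exact: mfreshf.
  have mmix : measurable_fun setT (fun M : Mx => mix fresh_mask M M').
    apply/measurable_mxP => i j.
    apply: (meas_eq (f := fun M : Mx => if fresh_mask i j then M i j else M' i j)).
      by move=> M; rewrite mxE.
    by case: (fresh_mask i j); [exact: measurable_entry|exact: measurable_cst].
  apply: ge0_le_integral => //.
  - apply/measurable_EFinP; apply: (measurableT_comp _ mmix).
    exact: measurable_indic.
  - apply/measurable_EFinP; apply: measurable_indic.
    by rewrite -[X in measurable X]setTI; exact: mfreshf.
  move=> M _; rewrite lee_fin !indicE ler_nat; case: (boolP (_ \in E)) => // hE.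
  suff -> : M \in (rowsub (@fresh_rows n1 n2 S)) @^-1` [set Y | (t ^+ 2 <= f Y)%R] by [].
  rewrite inE /= /f; move: hE; rewrite inE => -[_ /=].
  have -> : iso (mix fresh_mask M M') = \tr (A M' *m Q (fresh_mx S M)) -
      \tr (A M') * \tr (Q (fresh_mx S M)) / p%:R.
    by rewrite /iso /A /K fresh_mix pool_mix.
  by move=> h; rewrite -[leRHS]real_normK ?num_real//; apply: lerXn2r; rewrite ?nnegrE// ltW.
apply: (@le_trans _ _ (\int[G]_M' (12 * B ^+ 2 / (p%:R - 1) / t ^+ 2)%:E)%E).
  apply: ge0_le_integral => //.
  - by move=> M' _; apply: integral_ge0 => M _; rewrite lee_fin.
  - have mswap : measurable_fun setT (fun z : Mx * Mx => mix fresh_mask z.2 z.1).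
      apply/measurable_mxP => i j.
      apply: (meas_eq (f := fun z : Mx * Mx => if fresh_mask i j then z.2 i j else z.1 i j)).
        by move=> z; rewrite mxE.
      by case: (fresh_mask i j);
        apply: (measurableT_comp (@measurable_entry R _ _ i j));
        [exact: measurable_snd|exact: measurable_fst].
    have m1E : measurable_fun setT (\1_E : Mx -> R) by exact: measurable_indic.
    have m2 : measurable_fun setT (fun z : Mx * Mx => (\1_E (mix fresh_mask z.2 z.1))%:E : \bar R).
      by apply/measurable_EFinP; exact: (measurableT_comp m1E mswap).
    pose F2 (z : Mx * Mx) : \bar R := (\1_E (mix fresh_mask z.2 z.1))%:E.
    have F20 z : (0 <= F2 z)%E by rewrite lee_fin.
    have m3 : measurable_fun setT (fubini_F G F2).
      exact: (@measurable_fun_fubini_tonelli_F _ _ _ _ R G F2 m2 F20).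
    exact: m3.
have -> : (\int[G]_(M' in setT) (12 * B ^+ 2 / (p%:R - 1) / t ^+ 2)%:E =
    (12 * B ^+ 2 / (p%:R - 1) / t ^+ 2)%:E * G setT)%E by exact: integral_cst.
have -> : G setT = 1%E by exact: probability_setT.
by rewrite mule1.
Qed.

Definition mp_rate : R := lambda^-1 * (2 * Num.sqrt (mp_const R * p%:R) + 1).

Let defect_tail (t : R) : 0 < t ->
  (G [set X | (t <= `|df X| + `|df' X|)%R] <= (2 * mp_rate / N%:R / t)%:E)%E.
Proof.
move=> t0.
have s0 : 0 <= 2 * Num.sqrt (mp_const R * p%:R) + 1 by rewrite addr_ge0// mulr_ge0// sqrtr_ge0.
have one l : 0 < l -> lambda <= l -> L1 G (fun X => `|mp_defect (N%:R * l) (fresh_mx S X) / N%:R|) /\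
    Ex G (fun X => `|mp_defect (N%:R * l) (fresh_mx S X) / N%:R|) <= mp_rate / N%:R.
  move=> l0 ll; have l1 : 0 < N%:R * l by rewrite mulr_gt0.
  have [lI hI] := mp_equation gauss_fresh p1 l1.
  have mD : measurable_fun setT (fun Y : 'M[R]_(N, p) => `|mp_defect (N%:R * l) Y|).
    exact: L1_measurable (L1_norm lI).
  have lI' := (L1_law G mfreshf mD).1 (L1_norm lI).
  have eL := @Ex_law _ _ _ _ R G _ mfreshf _ mD lI'; rewrite eL in hI.
  have e (X : Mx) : `|mp_defect (N%:R * l) (fresh_mx S X) / N%:R| =
     N%:R^-1 * `|mp_defect (N%:R * l) (fresh_mx S X)|.
    by rewrite normrM mulrC ger0_norm ?invr_ge0 ?(ltW NR).
  split; first by apply: (L1_eq (fun X => esym (e X))); exact: (L1Z _ lI').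
  rewrite (Ex_eq _ e) (ExZ _ lI') mulrC ler_wpM2r ?invr_ge0 ?(ltW NR)//.
  apply: le_trans hI _; rewrite /mp_rate ler_wpM2r// invfM mulrA mulfV ?gt_eqF// mul1r.
  by rewrite lef_pV2 ?posrE.
have [l1 h1] := one _ lambda0 (lexx _).
have [|l2 h2] := one (lambda * (1 + eta)) (mulr_gt0 lambda0 eta1).
  by rewrite ler_peMr ?(ltW lambda0)// lerDl ltW.
have lD := L1D l1 l2.
have pos X : 0 <= `|df X| + `|df' X| by rewrite addr_ge0.
apply: le_trans (Ex_markov (L1_measurable lD) pos lD t0) _.
rewrite lee_fin ler_wpM2r ?invr_ge0 ?(ltW t0)// ExD//.
have -> : 2 * mp_rate / N%:R = mp_rate / N%:R + mp_rate / N%:R by ring.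
exact: lerD.
Qed.

(** Truncate at RI < Cb + c; then the deviation exceeds eps only if the isotropy
    error exceeds eps / 3 or the defects do so after multiplication by
    their rate, the increment eta having been chosen small. *)
Lemma deviation_bound (eps c Cb : R) : 0 < eps -> 0 < c -> sqn b2 <= Cb ->
  let B := Cb + c + sigma ^+ 2 * (Gam / lambda) in
  eta * slope_rate * B <= eps / 3 ->
  (G (~` pool_singular `&`
      [set X | (eps < `|corrected_risk mu X - (a * first_risk X + cc)|)%R]) <=
   (2 * pooled_const np bt (sigma ^+ 2) / c +
    (12 * (Cb + c) ^+ 2 / (p%:R - 1) / (eps / 3) ^+ 2 +
     2 * mp_rate / N%:R * (3 * ((defect_rate + 1) * B) / eps)))%:E)%E.
Proof.
move=> eps0 c0 hb B hB.
have Cb0 : 0 <= Cb by apply: le_trans hb; exact: sqn_ge0.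
have e30 : 0 < eps / 3 by rewrite divr_gt0.
have B0 : 0 < B.
  rewrite /B ltr_wpDr ?ltr_wpDl// mulr_ge0 ?sqr_ge0// divr_ge0 ?(ltW lambda0)//.
  by apply: le_trans gammaG; exact: ltW.
have d10 : 0 < defect_rate + 1.
  have h1 : 0 < eta^-1 by rewrite invr_gt0.
  have h2 : 0 <= (lambda + lambda^-1) / lambda.
    by rewrite divr_ge0 ?addr_ge0 ?invr_ge0 ?(ltW lambda0).
  have := sqr_ge0 lambda^-1; rewrite /defect_rate; lra.
pose t := eps / (3 * ((defect_rate + 1) * B)).
have t0 : 0 < t by rewrite divr_gt0 ?mulr_gt0.
have mdf : measurable_fun setT (fun X => `|df X| + `|df' X|).
  have mD l : measurable_fun setT (fun X : Mx => `|mp_defect l (fresh_mx S X) / N%:R|).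
    apply: measurableT_comp => //; apply: measurable_funM => //.
    exact: (measurableT_comp (@measurable_mp_defect R N p l) mfreshf).
  by apply: measurable_funD; exact: mD.
pose E1 := ~` pool_singular `&` [set X | (sqn b2 + c <= first_risk X)%R].
pose E2 := [set X | (first_risk X < Cb + c)%R] `&` [set X | (eps / 3 <= `|iso X|)%R].
pose E3 := [set X | (t <= `|df X| + `|df' X|)%R].
have mE1 : measurable E1.
  apply: measurableI; first by apply: measurableC; exact: measurable_pool_singular.
  by apply: mle; exact: measurable_first_risk.
have mE2 : measurable E2.
  apply: measurableI; first by apply: mlt; exact: measurable_first_risk.
  by apply: mle; exact: measurableT_comp.
have mE3 : measurable E3 by exact: mle.
have mgap : measurable_fun setT (fun X => `|corrected_risk mu X - (a * first_risk X + cc)|).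
  apply: measurableT_comp => //; apply: measurable_funB; first exact: measurable_corrected_risk.
  apply: measurable_funD => //; apply: measurable_funM => //; exact: measurable_first_risk.
have sub : ~` pool_singular `&`
    [set X | (eps < `|corrected_risk mu X - (a * first_risk X + cc)|)%R] `<=` E1 `|` (E2 `|` E3).
  move=> X [uX /= hX].
  have [h1|h1] := leP (sqn b2 + c) (first_risk X); first by left.
  right; have [h2|h2] := leP (eps / 3) `|iso X|.
    by left; split => //=; apply: lt_le_trans h1 _; rewrite lerD2r.
  right; rewrite /E3 /=; rewrite leNgt; apply/negP => h3.
  have hRB : first_risk X + sigma ^+ 2 * (Gam / lambda) <= B.
    by rewrite /B lerD2r; apply: le_trans (ltW h1) _; rewrite lerD2r.
  have := risk_gap hRB.
  have h4 : (`|df X| + `|df' X|) * ((defect_rate + 1) * B) < eps / 3.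
    have : t * ((defect_rate + 1) * B) = eps / 3.
      by rewrite /t; field; rewrite !gt_eqF.
    by move=> <-; rewrite ltr_pM2r// mulr_gt0.
  move: hB h2 h4 hX; lra.
apply: le_trans (le_measure G _ _ sub) _; rewrite ?inE.
- apply: measurableI; first by apply: measurableC; exact: measurable_pool_singular.
  rewrite (_ : [set X | _] = ~` [set X | (`|corrected_risk mu X - (a * first_risk X + cc)| <= eps)%R]).
    apply: measurableC.
    rewrite (_ : [set X | _] = (fun X => `|corrected_risk mu X - (a * first_risk X + cc)|) @^-1` `]-oo, eps]%classic).
      by rewrite -[X in measurable X]setTI; exact: mgap.
    by apply/seteqP; split => w /=; rewrite in_itv.
  by apply/seteqP; split => w /=; rewrite ltNge => /negP.
- by apply: measurableU => //; exact: measurableU.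
apply: le_trans (measureU2 _ _ _) _ => //; first exact: measurableU.
rewrite EFinD; apply: leeD; first exact: first_risk_tail.
apply: le_trans (measureU2 _ _ _) _ => //.
rewrite EFinD; apply: leeD.
  by apply: isotropy_tail => //; rewrite addr_ge0// ltW.
apply: le_trans (defect_tail t0) _.
by rewrite lee_fin /t invf_div.
Qed.

End FixedSplit.

(** * Deviation for a random split *)

Lemma total_probability (d : measure_display) (T : measurableType d) (R : realType)
    (P : probability T R) (J : finType) (I : T -> J) (A : set T) : measurable A ->
  (forall S, measurable [set w | I w = S]) ->
  P A = (\sum_S P (A `&` [set w | I w = S]))%E.
Proof.
move=> mA mI.
have mAS S : measurable (A `&` [set w | I w = S]) by exact: measurableI.
have -> : P A = (\int[P]_w \sum_(S <- index_enum J) (\1_(A `&` [set w | I w = S]) w)%:E)%E.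
  rewrite -[A in LHS]setIT -integral_indic//; apply: eq_integral => w _.
  rewrite (bigD1_seq (I w)) ?mem_index_enum ?index_enum_uniq//= big1 ?adde0; last first.
    move=> S hS; rewrite indicE; case: (boolP (_ \in _)) => //; rewrite inE => -[_ /= hw].
    by rewrite hw eqxx in hS.
  congr (_%:E); rewrite !indicE; congr (_%:R); congr nat_of_bool.
  by have [h|h] := pselect (A w); [rewrite !mem_set|rewrite !memNset// => -[]].
rewrite ge0_integral_sum//; last first.
  by move=> S; apply/measurable_EFinP; exact: measurable_indic.
by apply: eq_bigr => S _; rewrite integral_indic// setIT.
Qed.

Section ModelDeviation.
Context (R : realType) (p n1 n2 k0 : nat).
Context (sigma kappa lambda gamma m Gam eta : R) (b1 b2 : 'cV[R]_p).
Context (d : measure_display) (T : measurableType d) (P : probability T R).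
Context (Z1 : T -> 'M[R]_(n1, p)) (Z2 : T -> 'M[R]_(n2, p)).
Context (eps1 : T -> 'cV[R]_n1) (eps2 : T -> 'cV[R]_n2) (I : T -> {set 'I_n2}).
Hypothesis hZ1 : gaussian_design P Z1.
Hypothesis hZ2 : gaussian_design P Z2.
Hypothesis heps1 : noise P sigma eps1.
Hypothesis heps2 : noise P sigma eps2.
Hypothesis hI : random_split I.
Hypothesis hindep : mutually_independent_seq P
  [:: sigma_mx Z1; sigma_mx Z2; sigma_mx eps1; sigma_mx eps2; sigma_split I].
Hypothesis hcard : forall w, #|I w| = k0.
Local Notation N := (n2 - k0)%N.
Hypothesis lambda0 : 0 < lambda.
Hypothesis N0 : (0 < N)%N.
Hypothesis p1 : (1 < p)%N.
Hypothesis np2 : (n1 + k0 + 2 < p)%N.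
Hypothesis ceilE : ceil_nb kappa n2 = N%:R.
Hypothesis gammaE : gamma = p%:R / N%:R.
Hypothesis gamma1 : 1 <= gamma.
Hypothesis gammaG : gamma <= Gam.
Hypothesis hm : is_mn gamma lambda m.
Hypothesis eta0 : 0 < eta.
Let bt := b1 - b2.
Let a := risk_slope gamma lambda m.
Let cc := sigma ^+ 2 * (gamma / lambda * (lambda * m - a)).
Let y1 w := response (Z1 w) b1 (eps1 w).
Let y2 w := response (Z2 w) b2 (eps2 w).
Context (riskI riskBC : T -> \bar R).
Hypothesis hriskI : is_risk P (design Z1 Z2) I 1%:M
  (fun w => first_stage (I w) (Z1 w) (y1 w) (Z2 w) (y2 w)) b2 riskI.
Hypothesis hriskBC : is_risk P (design Z1 Z2) I 1%:M
  (fun w => bias_corrected kappa lambda (I w) (Z1 w) (y1 w) (Z2 w) (y2 w)) b2 riskBC.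

Let close (eps : R) := [set w | (`|riskBC w - (a%:E * riskI w + cc%:E)| <= eps%:E)%E].

Let mrisk (b : T -> 'cV[R]_p) r : is_risk P (design Z1 Z2) I 1%:M b b2 r ->
  measurable_fun setT r.
Proof.
move=> [h _] _ B mB; rewrite setTI; apply: (given_measurable hZ1 hZ2 hI).
exact: h.
Qed.

Lemma measurable_close eps : measurable (close eps).
Proof.
have m1 := mrisk hriskI; have m2 := mrisk hriskBC.
have mf : measurable_fun setT (fun w => `|riskBC w - (a%:E * riskI w + cc%:E)|)%E.
  apply: measurableT_comp => //; apply: emeasurable_funB => //.
  by apply: emeasurable_funD => //; exact: measurable_funeM.
by have := @measurable_lee _ T R setT measurableT _ _ mf (measurable_cst eps%:E); rewrite setTI.
Qed.

Let msplit S : measurable [set w | I w = S].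
Proof. by apply: hI; exists [set S] => //; rewrite setTI. Qed.

Definition gap_tail (eps c Cb : R) : R :=
  2 * pooled_const (n1 + k0) bt (sigma ^+ 2) / c +
  (12 * (Cb + c) ^+ 2 / (p%:R - 1) / (eps / 3) ^+ 2 +
   2 * mp_rate p lambda / N%:R *
     (3 * ((defect_rate lambda eta + 1) * (Cb + c + sigma ^+ 2 * (Gam / lambda))) / eps)).

(** On {I = S} both versions equal their closed forms outside null sets, and
    the remaining event concerns the design only, hence is independent
    of {I = S}. *)
Let split_deviation (eps c Cb : R) S : 0 < eps -> 0 < c -> sqn b2 <= Cb ->
  eta * slope_rate lambda Gam * (Cb + c + sigma ^+ 2 * (Gam / lambda)) <= eps / 3 ->
  (P (~` close eps `&` [set w | I w = S]) <= (gap_tail eps c Cb)%:E * P [set w | I w = S])%E.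
Proof.
move=> eps0 c0 hb hB.
have [kS|kS] := eqVneq #|S| k0; last first.
  have -> : [set w | I w = S] = set0.
    by apply/seteqP; split => // w /= hw; rewrite -hw hcard eqxx in kS.
  by rewrite setI0 measure0 mule0.
have NS : #|~: S| = N by rewrite finset.cardsCs finset.setCK card_ord kS.
have mX := measurable_design hZ1 hZ2.
pose mu := (#|~: S|%:R * lambda : R).
have muE : ceil_nb kappa n2 * lambda = mu by rewrite ceilE /mu NS.
have mu0 : 0 < mu by rewrite mulr_gt0// NS ltr0n.
have mU : measurable (~` @pool_singular R n1 n2 p S).
  by apply: measurableC; exact: measurable_pool_singular.
have unitU X : (~` @pool_singular R n1 n2 p S) X -> pool_mx S X *m (pool_mx S X)^T \in unitmx.
  by move=> /negP; rewrite negbK.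
have hfs w : I w = S -> (~` @pool_singular R n1 n2 p S) (design Z1 Z2 w) ->
    first_stage (I w) (Z1 w) (y1 w) (Z2 w) (y2 w) - b2 =
    pooled_bias b2 bt (pool_mx S (design Z1 Z2 w)) +
    pooled_noise (pool_mx S (design Z1 Z2 w)) *m errors eps1 eps2 w.
  by move=> hw hu; rewrite hw; exact: first_stage_error (unitU _ hu).
have [M1 [mM1 M10 sM1]] := risk_version hZ1 hZ2 heps1 heps2 hI hindep (S := S) hriskI mU
  (mxm_pooled_bias S b2 bt) (@mxm_pooled_noise R n1 n2 p S)
  hfs.
have mVC : mxm (fun X : 'M[R]_(n1 + n2, p) =>
    ridge mu (fresh_mx S X) *m pooled_bias b2 bt (pool_mx S X)).
  by apply: mxm_mul; [exact: mxm_ridge_fresh|exact: mxm_pooled_bias].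
have hbc w : I w = S -> (~` @pool_singular R n1 n2 p S) (design Z1 Z2 w) ->
    bias_corrected kappa lambda (I w) (Z1 w) (y1 w) (Z2 w) (y2 w) - b2 =
    ridge mu (fresh_mx S (design Z1 Z2 w)) *m pooled_bias b2 bt (pool_mx S (design Z1 Z2 w)) +
    corrected_noise mu (pool_mx S (design Z1 Z2 w)) (fresh_mx S (design Z1 Z2 w)) *m
      errors eps1 eps2 w.
  move=> hw hu; rewrite hw.
  have mu0' : 0 < ceil_nb kappa n2 * lambda by rewrite muE.
  by rewrite -muE; apply: corrected_error => //; exact: unitU.
have [M2 [mM2 M20 sM2]] := risk_version hZ1 hZ2 heps1 heps2 hI hindep (S := S) hriskBC mU
  mVC (mxm_corrected_noise S mu) hbc.
pose Dev := ~` @pool_singular R n1 n2 p S `&` [set X | (eps < `|@corrected_risk R n1 n2 p S sigma b2 bt mu X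
   - (a * @first_risk R n1 n2 p S sigma b2 bt X + cc)|)%R].
have mDev : measurable Dev.
  apply: measurableI => //.
  have mgap : measurable_fun setT (fun X => `|@corrected_risk R n1 n2 p S sigma b2 bt mu X
      - (a * @first_risk R n1 n2 p S sigma b2 bt X + cc)|).
    apply: measurableT_comp => //; apply: measurable_funB; first exact: measurable_corrected_risk.
    by apply: measurable_funD => //; apply: measurable_funM => //; exact: measurable_first_risk.
  rewrite (_ : [set X | _] = (fun X => `|@corrected_risk R n1 n2 p S sigma b2 bt mu X
      - (a * @first_risk R n1 n2 p S sigma b2 bt X + cc)|) @^-1` `]eps, +oo[%classic).
    by rewrite -[X in measurable X]setTI; exact: mgap.
  by apply/seteqP; split => w /=; rewrite in_itv/= andbT.
pose M3 := design Z1 Z2 @^-1` @pool_singular R n1 n2 p S.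
pose M4 := design Z1 Z2 @^-1` Dev `&` [set w | I w = S].
have mM3 : measurable M3.
  by rewrite -[X in measurable X]setTI; apply: mX => //; exact: measurable_pool_singular.
have mM4 : measurable M4.
  by apply: measurableI => //; rewrite -[X in measurable X]setTI; exact: mX.
have sub : ~` close eps `&` [set w | I w = S] `<=` M1 `|` (M2 `|` (M3 `|` M4)).
  move=> w [hc /= hS]; have [hs|hs] := pselect (M3 w); first by right; right; left.
  have [rI|rI] := pselect (riskI w = (@first_risk R n1 n2 p S sigma b2 bt (design Z1 Z2 w))%:E); last first.
    by left; apply: sM1; split.
  have [rB|rB] := pselect (riskBC w = (@corrected_risk R n1 n2 p S sigma b2 bt mu (design Z1 Z2 w))%:E); last first.
    by right; left; apply: sM2; split.
  right; right; right; split => //; split => //=.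
  rewrite ltNge; apply/negP => h; apply: hc; rewrite /close /= rI rB.
  by rewrite lee_fin.
have hDev : (P (design Z1 Z2 @^-1` Dev) <= (gap_tail eps c Cb)%:E)%E.
  have hG := gauss_design hZ1 hZ2 hindep.
  have N0' : (0 < #|~: S|)%N by rewrite NS.
  have gammaE' : gamma = p%:R / #|~: S|%:R by rewrite NS.
  have np2' : (n1 + #|S| + 2 < p)%N by rewrite kS.
  have h := @deviation_bound R n1 n2 p S _ hG sigma lambda gamma m Gam eta b2 bt
    lambda0 N0' p1 np2' gammaE' gamma1 gammaG hm eta0 eps c Cb eps0 c0 hb hB.
  by apply: le_trans h _; rewrite /gap_tail NS kS.
apply: le_trans (le_measure P _ _ sub) _; rewrite ?inE.
- by apply: measurableI => //; apply: measurableC; exact: measurable_close.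
- by do 3![apply: measurableU => //].
apply: le_trans (measureU2 _ _ _) _ => //; first by do 2![apply: measurableU => //].
rewrite [X in (X + _)%E]M10 add0e; apply: le_trans (measureU2 _ _ _) _ => //; first exact: measurableU.
rewrite [X in (X + _)%E]M20 add0e; apply: le_trans (measureU2 _ _ _) _ => //.
have M30 : P M3 = 0%E.
  rewrite -[LHS](lawE P mX); apply: (pool_singular0 (gauss_design hZ1 hZ2 hindep)).
  by rewrite kS.
rewrite [X in (X + _)%E]M30 add0e [X in (X <= _)%E](design_split_indep hZ1 hZ2 hI hindep S mDev).
by rewrite lee_wpmul2r.
Qed.

Lemma model_deviation (eps c Cb : R) : 0 < eps -> 0 < c -> sqn b2 <= Cb ->
  eta * slope_rate lambda Gam * (Cb + c + sigma ^+ 2 * (Gam / lambda)) <= eps / 3 ->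
  (P (~` close eps) <= (gap_tail eps c Cb)%:E)%E.
Proof.
move=> eps0 c0 hb hB.
rewrite (total_probability P (I := I)); last exact: msplit; last first.
  by apply: measurableC; exact: measurable_close.
apply: (@le_trans _ _ (\sum_S (gap_tail eps c Cb)%:E * P [set w | I w = S])%E).
  by apply: lee_sum => S _; exact: split_deviation.
rewrite -ge0_sume_distrr; last by move=> S _; exact: measure_ge0.
have -> : (\sum_S P [set w | I w = S] = 1)%E.
  rewrite -(probability_setT P) (total_probability P (I := I) measurableT msplit).
  by apply: eq_bigr => S _; rewrite setTI.
by rewrite mule1.
Qed.

End ModelDeviation.

(** * Asymptotics *)

Section KyFan.
Context (R : realType) (d : nat -> measure_display) (Omega : forall j, measurableType (d j)).
Context (P : forall j, probability (Omega j) R).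
Context (close : forall j, R -> set (Omega j)).
Hypothesis mclose : forall j e, measurable (@close j e).
Hypothesis tends : forall e t : R, 0 < e -> 0 < t ->
  \forall j \near \oo, (P j (~` @close j e) <= t%:E)%E.

(** A level that decreases slowly enough still dominates the deviation: use
    1/(k+1) for the largest k at most j that j can afford. *)
Lemma ky_fan : exists o1 : nat -> R, o1 j @[j --> \oo] --> 0 /\
  P j (@close j (o1 j)) @[j --> \oo] --> 1%:E.
Proof.
pose r (k : nat) : R := k.+1%:R^-1.
have r0 k : 0 < r k by rewrite invr_gt0.
pose Q j (k : nat) := (k == 0)%N || ((k <= j)%N && `[< (P j (~` @close j (r k)) <= (r k)%:E)%E >]).
have Q0 j : exists k, Q j k by exists 0%N.
have Qb j k : Q j k -> (k <= j)%N.
  by rewrite /Q => /orP[/eqP->//|/andP[]].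
pose K j := ex_maxn (Q0 j) (Qb j).
have small j : (P j (~` @close j (r (K j))) <= (r (K j))%:E)%E.
  rewrite /K; case: ex_maxnP => k /orP[/eqP->|/andP[_ /asboolP//]] _.
  rewrite /r invr1; apply: probability_le1; apply: measurableC; exact: mclose.
have large k : \forall j \near \oo, (k <= K j)%N.
  have h := tends (r0 k) (r0 k).
  near=> j; rewrite /K; case: ex_maxnP => k' _; apply.
  rewrite /Q; apply/orP; right; apply/andP; split; first by near: j; exact: nbhs_infty_ge.
  by apply/asboolP; near: j.
have o0 : r (K j) @[j --> \oo] --> 0.
  apply/cvgr0Pnorm_le => e e0; near=> j.
  rewrite ger0_norm ?(ltW (r0 _))// /r -[leRHS]invrK lef_pV2 ?posrE ?invr_gt0//.
  apply: le_trans (ltW (truncnS_gt _)) _; rewrite ler_nat ltnS.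
  by near: j; exact: large.
exists (fun j => r (K j)); split => //.
apply: (@squeeze_cvge _ _ _ _ (fun j => (1 - r (K j))%:E) _ (cst 1%:E)).
- apply: nearW => j; apply/andP; split; last exact: probability_le1.
  have := probability_setC (P j) (mclose j (r (K j))).
  have := small j; move=> h e; rewrite e in h.
  rewrite -[P j (@close j _)]fineK ?fin_num_measure// in h *.
  by move: h; rewrite -EFinB !lee_fin; lra.
- apply: cvg_EFin; first exact: nearW.
  rewrite -[X in _ --> X]subr0; apply: cvgB => //; exact: cvg_cst.
- exact: cvg_cst.
Unshelve. all: by end_near.
Qed.

End KyFan.

Section Asymptotics.
Context (R : realType).

Lemma ceil_complement (kappa : R) (n k : nat) : k%:Z = Num.floor ((1 - kappa) * n%:R) ->
  (k <= n)%N -> ceil_nb kappa n = (n - k)%:R.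
Proof.
move=> hk kn; have /andP[h1 h2] := floor_itv ((1 - kappa) * n%:R).
rewrite -hk in h1 h2; rewrite intrD /= in h2.
have -> : (n - k)%:R = ((n%:Z - k%:Z)%:~R : R) by rewrite intrB natrB.
rewrite /ceil_nb; congr (_%:~R); apply: ceil_def; rewrite !intrB.
change (k%:Z%:~R) with (k%:R : R) in h1, h2.
by apply/andP; split; [move: h2|move: h1]; rewrite /= ?mulr1z; lra.
Qed.

(** By the arithmetic-geometric mean inequality, 2 sqrt (C p) <= e p + C / e. *)
Lemma sqrt_negligible (C M t : R) : 0 <= C -> 0 <= M -> 0 < t ->
  exists P0 : nat, forall p : nat, (P0 <= p)%N ->
    M * (2 * Num.sqrt (C * p%:R) + 1) <= t * p%:R.
Proof.
move=> C0 M0 t0.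
pose e := t / (2 * (M + 1)).
have e0 : 0 < e by rewrite divr_gt0 ?mulr_gt0 ?ltr_wpDl.
pose z := 2 * M * (C / e + 1) / t.
exists (Num.truncn z).+1 => p hp.
have pz : z <= p%:R.
  by apply: le_trans (ltW (truncnS_gt _)) _; rewrite ler_nat.
have amgm : 2 * Num.sqrt (C * p%:R) <= e * p%:R + C / e.
  have x0 : 0 <= C * p%:R by rewrite mulr_ge0.
  have y0 : 0 <= e * p%:R + C / e.
    by apply: addr_ge0; [apply: mulr_ge0|apply: divr_ge0] => //; exact: ltW.
  have w0 : 0 <= 2 * Num.sqrt (C * p%:R) by apply: mulr_ge0 => //; exact: sqrtr_ge0.
  rewrite -ler_sqr; [|exact: w0|exact: y0].
  rewrite exprMn (sqr_sqrtr x0); have := sqr_ge0 (e * p%:R - C / e).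
  have -> : (e * p%:R + C / e) ^+ 2 = (e * p%:R - C / e) ^+ 2 + 4 * (C * p%:R).
    by field; rewrite gt_eqF.
  have -> : 2 ^+ 2 = 4 :> R by ring.
  lra.
have h1 : M * (2 * Num.sqrt (C * p%:R) + 1) <= M * (e * p%:R + (C / e + 1)).
  by rewrite ler_wpM2l// addrA lerD2r.
apply: le_trans h1 _; rewrite mulrDr.
have h2 : M * (e * p%:R) <= t / 2 * p%:R.
  rewrite mulrA ler_wpM2r// /e mulrA ler_pdivrMr ?mulr_gt0 ?ltr_wpDl//.
  have -> : t / 2 * (2 * (M + 1)) = M * t + t by field.
  by rewrite lerDl ltW.
have h3 : M * (C / e + 1) <= t / 2 * p%:R.
  have : t / 2 * z <= t / 2 * p%:R by rewrite ler_wpM2l// divr_ge0 ?(ltW t0).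
  suff -> : t / 2 * z = M * (C / e + 1) by [].
  by rewrite /z; field; rewrite !gt_eqF.
lra.
Qed.

(** Choose the truncation level c first, then the increment eta in terms of c,
    and p last. *)
Lemma gap_tail_small (eps t lambda tau kappa sigma Cb Ct Gam : R) :
  0 < eps -> 0 < t -> 0 < lambda -> 0 < tau -> 0 < kappa -> 0 <= Cb -> 0 <= Ct -> 0 <= Gam ->
  exists c eta : R, exists P0 : nat, [/\ 0 < c, 0 < eta,
    eta * slope_rate lambda Gam * (Cb + c + sigma ^+ 2 * (Gam / lambda)) <= eps / 3 &
    forall (p n1 n2 k0 : nat) (b1 b2 : 'cV[R]_p), (P0 <= p)%N ->
      (n1 + k0)%:R * (1 + tau) <= p%:R :> R -> kappa * tau * p%:R <= (n2 - k0)%:R :> R ->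
      sqn (b1 - b2) <= Ct ->
      [/\ (1 < p)%N, (n1 + k0 + 2 < p)%N &
        gap_tail n1 n2 k0 sigma lambda Gam eta b1 b2 eps c Cb <= t]].
Proof.
move=> eps0 t0 l0 tau0 k0 Cb0 Ct0 Gam0.
pose rho := tau / (2 * (1 + tau)).
have tau1 : 0 < 1 + tau by rewrite addr_gt0.
have rho0 : 0 < rho by rewrite divr_gt0// mulr_gt0.
pose Cc := Ct * (rho^-1 + 1) + sigma ^+ 2 * rho^-1.
have ri0 : 0 < rho^-1 by rewrite invr_gt0.
have Cc0 : 0 <= Cc by rewrite addr_ge0// mulr_ge0 ?sqr_ge0 ?addr_ge0// ltW.
pose c := 6 * (Cc + 1) / t.
have c0 : 0 < c by rewrite divr_gt0// mulr_gt0// ltr_wpDl.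
have li0 : 0 < lambda^-1 by rewrite invr_gt0.
have gl0 : 0 <= sigma ^+ 2 * (Gam / lambda).
  by rewrite mulr_ge0 ?sqr_ge0// divr_ge0// ltW.
pose B := Cb + c + sigma ^+ 2 * (Gam / lambda).
have B0 : 0 < B by rewrite ltr_wpDr// ltr_wpDl.
have sr0 : 0 < slope_rate lambda Gam.
  rewrite /slope_rate ltr_wpDr//; apply: mulr_ge0; last exact: ltW.
  by apply: mulr_ge0 => //; rewrite addr_ge0// ltW.
pose eta := eps / (3 * (slope_rate lambda Gam * B)).
have eta0 : 0 < eta by rewrite divr_gt0// !mulr_gt0.
have dr0 : 0 < defect_rate lambda eta + 1.
  have h1 : 0 < eta^-1 by rewrite invr_gt0.
  have h2 : 0 <= (lambda + lambda^-1) / lambda.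
    by apply: divr_ge0; [rewrite addr_ge0// ltW|rewrite ltW].
  have := sqr_ge0 lambda^-1; rewrite /defect_rate; lra.
pose M3 := 3 * ((defect_rate lambda eta + 1) * B) / eps.
have M30 : 0 < M3 by rewrite divr_gt0// !mulr_gt0.
pose M := 2 * lambda^-1 * M3 / (kappa * tau).
have kt0 : 0 < kappa * tau by rewrite mulr_gt0.
have M0 : 0 <= M by apply/ltW/divr_gt0 => //; apply: mulr_gt0 => //; exact: mulr_gt0.
have t30 : 0 < t / 3 by rewrite divr_gt0.
have [P3 hP3] := sqrt_negligible (mp_const_ge0 R) M0 t30.
pose z2 := 36 * (Cb + c) ^+ 2 / ((eps / 3) ^+ 2 * t).
exists c, eta, (maxn P3 (maxn (Num.truncn (2 / rho)).+1 (maxn 2 (Num.truncn (z2 + 1)).+1))).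
split=> //.
  rewrite -/B /eta le_eqVlt; apply/orP; left; apply/eqP; field.
  by rewrite !gt_eqF.
move=> p n1 n2 kk b1 b2; rewrite !geq_max => /and4P[pP3 pr p2 pz] hnp hN hb.
have pr' : 2 / rho < p%:R by apply: lt_le_trans (truncnS_gt _) _; rewrite ler_nat.
have pz' : z2 + 1 < p%:R by apply: lt_le_trans (truncnS_gt _) _; rewrite ler_nat.
have p0 : 0 < (p%:R : R) by rewrite ltr0n ltnW.
set x : R := (n1 + kk)%:R in hnp *.
have x0 : 0 <= x by rewrite ler0n.
have q1 : rho * p%:R <= p%:R - x - 2.
  have h1 : 2 <= rho * p%:R by rewrite mulrC -ler_pdivrMr// ltW.
  have h2 : x <= p%:R - 2 * (rho * p%:R).
    have -> : p%:R - 2 * (rho * p%:R) = p%:R / (1 + tau).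
      by rewrite /rho; field; rewrite gt_eqF.
    by rewrite ler_pdivlMr.
  lra.
have rp0 : 0 < rho * p%:R by rewrite mulr_gt0.
have q0 : 0 < p%:R - x - 2 by apply: lt_le_trans q1.
split=> //.
  by rewrite -(ltr_nat R) natrD -/x; lra.
have f1 : p%:R / (p%:R - x - 2) <= rho^-1.
  by rewrite ler_pdivrMr// -ler_pdivrMl ?invr_gt0// invrK.
have f2 : x / (p%:R - x - 2) <= rho^-1.
  apply: le_trans f1; rewrite ler_pM2r ?invr_gt0//; lra.
have f3 : x / p%:R <= 1 by rewrite ler_pdivrMr// mul1r; lra.
have f10 : 0 <= p%:R / (p%:R - x - 2) by rewrite divr_ge0// ltW.
have f30 : 0 <= x / p%:R by rewrite divr_ge0.
have pc : pooled_const (n1 + kk) (b1 - b2) (sigma ^+ 2) <= Cc.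
  rewrite /pooled_const -/x /Cc; apply: lerD; last by rewrite ler_wpM2l ?sqr_ge0.
  apply: ler_pM => //; first exact: sqn_ge0.
    by rewrite mulr_ge0// addr_ge0.
  rewrite -[leRHS]mul1r; apply: ler_pM => //; first by rewrite addr_ge0.
  by rewrite lerD2r.
have t1 : 2 * pooled_const (n1 + kk) (b1 - b2) (sigma ^+ 2) / c <= t / 3.
  rewrite ler_pdivrMr//; have -> : t / 3 * c = 2 * (Cc + 1).
    by rewrite /c; field; rewrite gt_eqF.
  by rewrite ler_pM2l//; apply: le_trans pc _; rewrite lerDl.
have t2 : 12 * (Cb + c) ^+ 2 / (p%:R - 1) / (eps / 3) ^+ 2 <= t / 3.
  have e20 : 0 < (eps / 3) ^+ 2 by rewrite exprn_gt0// divr_gt0.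
  have z0 : 0 <= z2.
    by apply: divr_ge0; [rewrite mulr_ge0 ?sqr_ge0|rewrite ltW// mulr_gt0].
  have pm : 0 < p%:R - 1 :> R by lra.
  rewrite ler_pdivrMr// ler_pdivrMr//.
  have -> : 12 * (Cb + c) ^+ 2 = t / 3 * (eps / 3) ^+ 2 * z2.
    by rewrite /z2; field; rewrite !gt_eqF.
  by apply: ler_wpM2l; [rewrite ltW// mulr_gt0|lra].
have N0 : 0 < ((n2 - kk)%:R : R) by apply: lt_le_trans hN; rewrite mulr_gt0.
have t3 : 2 * mp_rate p lambda / (n2 - kk)%:R * M3 <= t / 3.
  have s0 : 0 <= 2 * Num.sqrt (mp_const R * p%:R) + 1.
    by rewrite addr_ge0// mulr_ge0// sqrtr_ge0.
  apply: (@le_trans _ _ (M * (2 * Num.sqrt (mp_const R * p%:R) + 1) / p%:R)); last first.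
    by rewrite ler_pdivrMr//; exact: hP3.
  have -> : M * (2 * Num.sqrt (mp_const R * p%:R) + 1) / p%:R =
      2 * mp_rate p lambda / (kappa * tau * p%:R) * M3.
    by rewrite /M /mp_rate; field; rewrite !gt_eqF.
  apply: ler_wpM2r; first exact: ltW.
  apply: ler_wpM2l; first by rewrite /mp_rate !mulr_ge0// ltW.
  by rewrite lef_pV2 ?posrE// mulr_gt0.
rewrite /gap_tail -/B -/M3; lra.
Qed.

End Asymptotics.

(** * The risk of the bias-corrected estimator *)

Theorem theorem5p3 (R : realType) (kappa lambda tau sigma : R)
  (hkappa : 0 < kappa < 1) (hlambda : 0 < lambda) (htau : 0 < tau < 1)
  (p n1 n2 : nat -> nat)
  (hp : p j @[j --> \oo] --> \oo)
  (hn1 : forall j, 1 + tau <= (p j)%:R / (n1 j)%:R <= tau^-1)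
  (hn2 : forall j, 1 + tau <= (p j)%:R / (n2 j)%:R <= tau^-1)
  (hn : forall j, 1 + tau <= (p j)%:R / (n1 j + n2 j)%:R <= tau^-1)
  (beta1 beta2 : forall j, 'cV[R]_(p j))
  (hbeta2 : exists C : R, forall j, l2norm (beta2 j) <= C)
  (hbetatilde : exists C : R, forall j, l2norm (beta1 j - beta2 j) <= C)
  (d : nat -> measure_display) (Omega : forall j, measurableType (d j))
  (P : forall j, probability (Omega j) R)
  (Z1 : forall j, Omega j -> 'M[R]_(n1 j, p j))
  (Z2 : forall j, Omega j -> 'M[R]_(n2 j, p j))
  (eps1 : forall j, Omega j -> 'cV[R]_(n1 j))
  (eps2 : forall j, Omega j -> 'cV[R]_(n2 j))
  (I : forall j, Omega j -> {set 'I_(n2 j)})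
  (hZ1 : forall j, gaussian_design (P j) (Z1 j))
  (hZ2 : forall j, gaussian_design (P j) (Z2 j))
  (heps1 : forall j, noise (P j) sigma (eps1 j))
  (heps2 : forall j, noise (P j) sigma (eps2 j))
  (hI : forall j, random_split (I j))
  (hcardI : forall j w,
     #|I j w|%:Z = Num.floor ((1 - kappa) * (n2 j)%:R))
  (hindep : forall j, mutually_independent_seq (P j)
     [:: sigma_mx (Z1 j); sigma_mx (Z2 j); sigma_mx (eps1 j);
         sigma_mx (eps2 j); sigma_split (I j)])
  (m : nat -> R)
  (hm : forall j, is_mn (gamma_kappa kappa (p j) (n2 j)) lambda (m j)) :
  (* Sigma1 = Sigma2 = I, hence X1 = Z1 and X2 = Z2 *)
  let X1 := Z1 in
  let X2 := Z2 in
  let X j w := col_mx (X1 j w) (X2 j w) in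
  let y1 j w := response (X1 j w) (beta1 j) (eps1 j w) in
  let y2 j w := response (X2 j w) (beta2 j) (eps2 j w) in
  let bI j w := first_stage (I j w) (X1 j w) (y1 j w) (X2 j w) (y2 j w) in
  let bBC j w := bias_corrected kappa lambda (I j w)
                   (X1 j w) (y1 j w) (X2 j w) (y2 j w) in
  let gamma j := gamma_kappa kappa (p j) (n2 j) in
  let m1 j := mn1 (gamma j) lambda (m j) in
  let D j := lambda + 1 - gamma j + gamma j * lambda * m j in
  let a j := lambda ^+ 2 * (1 + gamma j * m1 j) / D j ^+ 2 in
  let c j := sigma ^+ 2 * gamma j *
             ((D j - lambda * (1 + gamma j * m1 j)) / D j ^+ 2) in
  forall riskI riskBC : forall j, Omega j -> \bar R,
  (forall j, is_risk (P j) (X j) (I j) 1%:M (bI j) (beta2 j) (riskI j)) ->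
  (forall j, is_risk (P j) (X j) (I j) 1%:M (bBC j) (beta2 j) (riskBC j)) ->
  exists o1 : nat -> R,
    o1 j @[j --> \oo] --> 0 /\
    P j [set w | (`|riskBC j w - ((a j)%:E * riskI j w + (c j)%:E)|
                    <= (o1 j)%:E)%E] @[j --> \oo] --> 1%:E.
Proof.
move=> X1 X2 X y1 y2 bI bBC gamma m1 D a c riskI riskBC hrI hrBC.
have [/andP[kap0 kap1] /andP[tau0 tau1]] := (hkappa, htau).
have n20 j : (0 < n2 j)%N.
  have /andP[h _] := hn2 j; rewrite lt0n; apply: contraTneq h => ->.
  by rewrite invr0 mulr0 -ltNge ltr_wpDl// ltW.
pose k0 j := `|Num.floor ((1 - kappa) * (n2 j)%:R)|%N.
have n2R j : 0 < ((n2 j)%:R : R) by rewrite ltr0n.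
have fl0 j : 0 <= (1 - kappa) * (n2 j)%:R.
  by rewrite mulr_ge0// subr_ge0 ltW.
have k0E j : (k0 j)%:Z = Num.floor ((1 - kappa) * (n2 j)%:R).
  by rewrite /k0 gez0_abs// floor_ge0.
have hcard j w : #|I j w| = k0 j by rewrite /k0 -(hcardI j w).
have k0n j : (k0 j <= n2 j)%N.
  rewrite -(ler_nat R); apply: le_trans (_ : (1 - kappa) * (n2 j)%:R <= _).
    by have := floor_le ((1 - kappa) * (n2 j)%:R); rewrite -k0E.
  by rewrite ler_piMl// lerBlDr lerDl ltW.
have ceilE j : ceil_nb kappa (n2 j) = (n2 j - k0 j)%:R by exact: ceil_complement.
have Nge j : kappa * (n2 j)%:R <= (n2 j - k0 j)%:R.
  by rewrite -ceilE; exact: ceil_ge.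
have NR j : 0 < ((n2 j - k0 j)%:R : R) by apply: lt_le_trans (Nge j); rewrite mulr_gt0.
have N0 j : (0 < n2 j - k0 j)%N by move: (NR j); rewrite ltr0n.
have hN j : kappa * tau * (p j)%:R <= (n2 j - k0 j)%:R.
  apply: le_trans (Nge j); rewrite -mulrA ler_pM2l//.
  have /andP[_] := hn2 j; rewrite ler_pdivrMr// => h.
  by rewrite mulrC -ler_pdivlMr// mulrC.
have hnp j : (n1 j + k0 j)%:R * (1 + tau) <= (p j)%:R.
  have nn : 0 < ((n1 j + n2 j)%:R : R) by rewrite ltr0n addn_gt0 n20 orbT.
  have /andP[h _] := hn j; rewrite ler_pdivlMr// in h.
  apply: le_trans h; rewrite mulrC ler_pM2l ?addr_gt0// ler_nat leq_add2l.
  exact: k0n.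
have gammaE j : gamma j = (p j)%:R / (n2 j - k0 j)%:R.
  by rewrite /gamma /gamma_kappa ceilE.
have gamma1 j : 1 <= gamma j.
  rewrite gammaE ler_pdivlMr// mul1r; apply: le_trans (_ : (n2 j)%:R <= _).
    by rewrite ler_nat leq_subr.
  have /andP[h _] := hn2 j; rewrite ler_pdivlMr// in h; apply: le_trans h.
  by rewrite ler_peMl// ?lerDl ltW.
pose Gam := (kappa * tau)^-1.
have kt0 : 0 < kappa * tau by rewrite mulr_gt0.
have gammaG j : gamma j <= Gam.
  by rewrite gammaE ler_pdivrMr// /Gam -ler_pdivrMl ?invr_gt0// invrK.
have Gam0 : 0 <= Gam by rewrite invr_ge0 ltW.
have [C2 hC2] := hbeta2; have [Ct hCt] := hbetatilde.
have sqn_le n (v : 'cV[R]_n) (C : R) : l2norm v <= C -> sqn v <= C ^+ 2.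
  move=> h; rewrite -l2norm_sqr; apply: lerXn2r => //; rewrite nnegrE ?sqrtr_ge0//.
  by apply: le_trans h; exact: sqrtr_ge0.
have aE j : a j = risk_slope (gamma j) lambda (m j) by [].
have gamma0 j : 0 < gamma j by apply: lt_le_trans (gamma1 j).
have cE j : c j = sigma ^+ 2 * (gamma j / lambda *
    (lambda * m j - risk_slope (gamma j) lambda (m j))).
  by rewrite /c -mulrA; congr (_ * _); exact: noise_coefE hlambda (hm j).
pose close j (e : R) := [set w | (`|riskBC j w -
  ((risk_slope (gamma j) lambda (m j))%:E * riskI j w +
   (sigma ^+ 2 * (gamma j / lambda *
    (lambda * m j - risk_slope (gamma j) lambda (m j))))%:E)| <= e%:E)%E].
have mclose j e : measurable (close j e).
  exact: (measurable_close sigma (gamma j) (m j) (hZ1 j) (hZ2 j) (hI j) (hrI j) (hrBC j) e).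
have tends (e t : R) : 0 < e -> 0 < t -> \forall j \near \oo, (P j (~` close j e) <= t%:E)%E.
  move=> e0 t0.
  have [cc [eta [P0 [cc0 eta0 hB small]]]] := gap_tail_small sigma e0 t0 hlambda tau0 kap0
    (sqr_ge0 C2) (sqr_ge0 Ct) Gam0.
  have pP : \forall j \near \oo, (P0 <= p j)%N by exact: (hp _ (nbhs_infty_ge P0)).
  near=> j; have pj : (P0 <= p j)%N by near: j.
  have [p1 np2 gt] := small _ _ _ _ _ _ pj (hnp j) (hN j) (sqn_le _ _ _ (hCt j)).
  apply: (@le_trans _ _ (gap_tail (n1 j) (n2 j) (k0 j) sigma lambda Gam eta
    (beta1 j) (beta2 j) e cc (C2 ^+ 2))%:E); last by rewrite lee_fin.
  exact: (model_deviation (hZ1 j) (hZ2 j) (heps1 j) (heps2 j) (hI j) (hindep j) (hcard j)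
    hlambda (N0 j) p1 np2 (ceilE j) (gammaE j) (gamma1 j) (gammaG j) (hm j) eta0
    (hrI j) (hrBC j) e0 cc0 (sqn_le _ _ _ (hC2 j)) hB).
have [lv [lv0 hP]] := ky_fan mclose tends.
exists lv; split=> //.
rewrite (_ : (fun j => P j _) = (fun j => P j (close j (lv j)))) //.
by apply/funext => j; congr (P j _); apply/funext => w; rewrite /close /= cE.
Unshelve. all: by end_near.
Qed.
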